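(* Let $\mathcal{LW}$ be the loop Virasoro Lie conformal algebra over $\mathbb{C}$, i.e. the Lie conformal algebra with $\mathbb{C}[D]$-basis $\{L_i\}_{i\in\mathbb{Z}}$ and products $L_{i[0]}L_j=-DL_{i+j}$, $L_{i[1]}L_j=-2L_{i+j}$, $L_{i[n]}L_j=0$ for $n\ge2$ ($i,j\in\mathbb{Z}$). Its universal enveloping associative conformal algebra with respect to $\{L_i\}_{i\in\mathbb{Z}}$ and $N=2$ is $\mathcal{U}_{N=2}(\mathcal{LW})=C(\{L_i\}_{i\in\mathbb{Z}},N=2\mid S^{(-)})$, where $S^{(-)}$ consists of $$f_{ij}^0=L_{i(0)}L_j+L_{j(1)}DL_i-2L_{j(0)}L_i+DL_{i+j},\qquad f_{ij}^1=L_{i(1)}L_j+L_{j(1)}L_i+2L_{i+j}\qquad(i,j\in\mathbb{Z}).$$ Then the following hold. (i) $C(\{L_i\}_{i\in\mathbb{Z}},N=2\mid S^{(-)})=C(\{L_i\}_{i\in\mathbb{Z}},N=2\mid S_1)$ (that is, $Id(S^{(-)})=Id(S_1)$), where $S_1$ consists of $s_{ij}^0=L_{i(0)}L_j-L_{0(0)}L_{i+j}$ ($i\ne0$, $i,j\in\mathbb{Z}$) and $s_{ij}^1=L_{i(1)}L_j+L_{i+j}$ ($i,j\in\mathbb{Z}$). (ii) Order $\{L_i\}_{i\in\mathbb{Z}}$ by: $L_i>L_j$ iff $|i|>|j|$, or $|i|=|j|$ and $i>j$. Then $S_1$ is a Gröbner-Shirshov basis in $C(\{L_i\}_{i\in\mathbb{Z}},N=2)$.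 (iii) The set $Irr(S_1)=\{[\underbrace{L_{0(0)}L_{0(0)}\cdots L_{0(0)}}_{k}D^tL_i]\mid i\in\mathbb{Z},\ t\ge0,\ k\ge0\}$ is a $\mathbb{C}$-basis of $\mathcal{U}_{N=2}(\mathcal{LW})$, and the set $A=\{[\underbrace{L_{0(0)}L_{0(0)}\cdots L_{0(0)}}_{k}L_i]\mid i\in\mathbb{Z},\ k\ge0\}$ is a $\mathbb{C}[D]$-basis of $\mathcal{U}_{N=2}(\mathcal{LW})$. Moreover, $\mathcal{LW}$ is embeddable into its universal enveloping associative conformal algebra: the canonical homomorphism of Lie conformal algebras $\mathcal{LW}\to\mathcal{U}_{N=2}(\mathcal{LW})^{(-)}$, $L_i\mapsto L_i$, is injective.
   Context: Conformal algebras (here $\mathbf{k}=\mathbb{C}$). A conformal algebra is a $\mathbf{k}$-space $C$ with bilinear products $a_{(n)}b$ ($n\in\mathbb{Z}_{\ge0}$) and a linear map $D$ such that: for all $a,b$ there is $N(a,b)\in\mathbb{Z}_{\ge 0}$ with $a_{(n)}b=0$ for $n\ge N(a,b)$; $D(a_{(n)}b)=Da_{(n)}b+a_{(n)}Db$; $Da_{(n)}b=-n\,a_{(n-1)}b$ for $n>0$ and $Da_{(0)}b=0$. It is associative if $(a_{(n)}b)_{(m)}c=\sum_{t\ge0}(-1)^t\binom nt a_{(n-t)}(b_{(m+t)}c)$. A Lie conformal algebra is a conformal algebra, with products written $a_{[n]}b$, such that $a_{[n]}b=-\{b_{[n]}a\}$, where $\{b_{[n]}a\}=\sum_{k\ge0}(-1)^{n+k}\frac1{k!}D^k(b_{[n+k]}a)$,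 and $(a_{[n]}b)_{[m]}c=\sum_{k\ge0}(-1)^k\binom nk\big(a_{[n-k]}(b_{[m+k]}c)-b_{[m+k]}(a_{[n-k]}c)\big)$. For an associative conformal algebra $A$, $A^{(-)}$ is the Lie conformal algebra on $A$ (same $D$) with $x_{[n]}y=x_{(n)}y-\{y_{(n)}x\}$, $\{y_{(n)}x\}=\sum_{k\ge0}(-1)^{n+k}\frac1{k!}D^k(y_{(n+k)}x)$. An ideal is a $D$-stable subspace closed under all products with arbitrary elements on either side; $Id(S)$ is the ideal generated by $S$. $C(B,N)$ is the free associative conformal algebra generated by $B$ subject to $a_{(n)}b=0$ for $a,b\in B$, $n\ge N$ (any map $\varepsilon$ from $B$ to an associative conformal algebra with $\varepsilon(a)_{(n)}\varepsilon(b)=0$ for $a,b\in B$, $n\ge N$, extends uniquely to a homomorphism), and $C(B,N|S)=C(B,N)/Id(S)$. For a Lie conformal algebra $L$ free over $\mathbf{k}[D]$ with basis $B=\{b_i\}_{i\in I}$ and locality of basis elements bounded by $N$, $\mathcal{U}_N(L)=C(B,N\mid b_{i(n)}b_j-\{b_{j(n)}b_i\}-b_{i[n]}b_j=0,\ i,j\in I,\ 0\le n<N)$, where $b_{i[n]}b_j$ is expressed as a $\mathbf{k}[D]$-combination of $B$. Words. $T$ is the set of associative normal words $u=b_{1(n_1)}b_{2(n_2)}\cdots b_{k(n_k)}D^ib_{k+1}$ with $b_j\in B$, $0\le n_j<N$, $k,i\ge0$; $|u|=k+1$, $ind(u)=i$; $u$ is $D$-free if $ind(u)=0$. $[u]=b_{1(n_1)}(b_{2(n_2)}(\cdots(b_{k(n_k)}D^ib_{k+1})\cdots))\in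 C(B,N)$ is the corresponding (right-normed) normal word; square brackets on words always denote right-normed bracketing. It is known that $\{[u]:u\in T\}$ is a $\mathbf{k}$-basis of $C(B,N)$. An element of $C(B,N)$ is $D$-free if all normal words occurring in it are. $uD^l$ is $u$ with $D^ib_{k+1}$ replaced by $D^{i+l}b_{k+1}$. If $u$ is $D$-free and $0\le n<N$, $u_{(n)}v\in T$ is the concatenation; if $a$ is empty, $a_{(n)}v$ means $v$. Ordering. $B$ is well-ordered; for $u\in T$, $wt(u)=(|u|,b_1,n_1,\dots,b_k,n_k,b_{k+1},i)$, and $u>v$ iff $wt(u)>wt(v)$ lexicographically; $u>0$ for all $u\in T$. For $0\ne f\in C(B,N)$, $\bar f\in T$ is the largest word occurring in $f$; $\bar0=0$; $f$ is monic if $\bar f$ has coefficient $1$. Normal $S$-words. For a set $S$ of monic elements, a normal $S$-word $[u]_{D^is}$ is either (first kind) $[a_{(n)}s_{(m)}c]$ with $s\in S$, $a,c\in T$ ($a$ may be empty), $a$ and $\bar s$ $D$-free, $0\le n,m<N$; or (second kind) $[a_{(n)}D^is]$ with $s\in S$, $i\ge0$, $a\in T$ $D$-free ($a$ may be empty), $0\le n<N$. Here, for $a=b_{1(n_1)}\cdots b_{k(n_k)}b_{k+1}$, $[a_{(n)}s_{(m)}c]=b_{1(n_1)}(\cdots(b_{k+1(n)}(s_{(m)}[c]))\cdots)$ and $[a_{(n)}D^is]=b_{1(n_1)}(\cdots(b_{k+1(n)}D^is)\cdots)$. $Irr(S)$ is the set of normal words $[u]$, $u\in T$, such that $u\ne\overline{[v]_{D^is}}$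 for every normal $S$-word $[v]_{D^is}$. Compositions of monic $f,g$ (all product indices occurring in words lie in $[0,N)$): - inclusion: if $w=\bar f=a_{(n)}\bar g_{(m)}c$, $a,c\in T$, $a,\bar g$ $D$-free ($a$ may be empty), $(f,g)_w=f-[a_{(n)}g_{(m)}c]$; - right inclusion: if $w=\bar f=a_{(n)}\bar gD^i$, $a\in T$ $D$-free ($a$ may be empty), $i\ge0$, $(f,g)_w=f-[a_{(n)}D^ig]$; - intersection: if $w=\bar f_{(m)}c=a_{(n)}\bar g$, $a,c\in T$, $a,\bar f$ $D$-free, $|\bar f|+|\bar g|>|w|$, $(f,g)_w=[f_{(m)}c]-[a_{(n)}g]$; - right intersection: if $w=\bar fD^i=a_{(n)}\bar g$, $a\in T$ $D$-free, $i>0$, $(f,g)_w=D^if-[a_{(n)}g]$; - left multiplication: $b_{(n)}f$ with $b\in B$, $n\ge N$; - right multiplication: $f_{(n)}b$ with $b\in B$ and either ($\bar f$ not $D$-free and $0\le n<N$) or ($f$ not $D$-free and $n\ge N$). An element $h$ is trivial modulo $S$ if $h$ is a finite $\mathbf{k}$-linear combination of normal $S$-words $[u_i]_{D^{l_i}s_i}$ with $\overline{[u_i]_{D^{l_i}s_i}}\le\bar h$. $S$ is a Gröbner-Shirshov basis in $C(B,N)$ if all compositions of elements of $S$ are trivial modulo $S$. *)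

(* Defs.v *)
From HB Require Import structures.
From mathcomp Require Import all_boot all_order all_algebra.
From mathcomp Require Import generic_quotient zify.
From mathcomp Require Import all_classical reals complex.
From Stdlib Require Wf_nat.
Set Implicit Arguments.
Unset Strict Implicit.
Unset Printing Implicit Defensive.
Import Order.TTheory GRing.Theory.
Local Open Scope classical_set_scope.
Local Open Scope ring_scope.

Reserved Notation "a *_( n ) b" (at level 40, n at level 200, left associativity,
  format "a  *_( n )  b").

(* The bare operations; the axioms are in the records below. *)
Record confAlg (k : fieldType) := ConfAlg {
  conf_car :> lmodType k;
  confD : conf_car -> conf_car;
  confp : nat -> conf_car -> conf_car -> conf_car }.
Arguments confD {k c} x.
Arguments confp {k c} n a b.

Notation "a *_( n ) b" := (confp n a b) : ring_scope.

Section ConfAlgDefs.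
Variable k : fieldType.
Implicit Type C : confAlg k.

Definition confDn C (t : nat) (x : C) : C := iter t confD x.

(* {b_(n) a}; all but finitely many terms vanish, by locality. *)
Definition cflip C (n : nat) (b a : C) : C :=
  \sum_(j \in [set: nat])
    ((-1) ^+ (n + j) / (j`!)%:R) *: confDn j (b *_(n + j) a).

Record conformal_axioms C : Prop := ConformalAxioms {
  confD_lin : forall (c : k) (a b : C), confD (c *: a + b) = c *: confD a + confD b;
  confp_linl : forall n (c : k) (a a' b : C),
    (c *: a + a') *_(n) b = c *: (a *_(n) b) + a' *_(n) b;
  confp_linr : forall n (c : k) (a b b' : C),
    a *_(n) (c *: b + b') = c *: (a *_(n) b) + a *_(n) b';
  conf_local : forall a b : C, exists N, forall n, (N <= n)%N -> a *_(n) b = 0;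
  confD_prod : forall n (a b : C),
    confD (a *_(n) b) = confD a *_(n) b + a *_(n) confD b;
  confpDl : forall n (a b : C), (0 < n)%N ->
    confD a *_(n) b = - (n%:R *: (a *_(n.-1) b));
  confpDl0 : forall a b : C, confD a *_(0) b = 0 }.

Definition assoc_axiom C := forall n m (a b c : C),
  (a *_(n) b) *_(m) c =
  \sum_(t < n.+1) ((-1) ^+ t * 'C(n, t)%:R) *: (a *_(n - t) (b *_(m + t) c)).

Record assocConf := AssocConf {
  assoc_conf :> confAlg k;
  assoc_confP : conformal_axioms assoc_conf;
  assoc_assocP : assoc_axiom assoc_conf }.

Record lieConf := LieConf {
  lie_conf :> confAlg k;
  lie_confP : conformal_axioms lie_conf;
  lie_skew : forall n (a b : lie_conf), a *_(n) b = - cflip n b a;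
  lie_jacobi : forall n m (a b c : lie_conf),
    (a *_(n) b) *_(m) c =
    \sum_(t < n.+1) ((-1) ^+ t * 'C(n, t)%:R) *:
      (a *_(n - t) (b *_(m + t) c) - b *_(m + t) (a *_(n - t) c)) }.

(* The underlying conformal algebra of the Lie conformal algebra A^(-). *)
Definition conf_minus (A : assocConf) : confAlg k :=
  @ConfAlg k A confD (fun n x y => x *_(n) y - cflip n y x).

Record conf_hom C C' (phi : C -> C') : Prop := ConfHom {
  conf_hom_lin : forall (c : k) x y, phi (c *: x + y) = c *: phi x + phi y;
  conf_homD : forall x, phi (confD x) = confD (phi x);
  conf_homM : forall n x y, phi (x *_(n) y) = phi x *_(n) phi y }.

Record is_ideal C (I : set C) : Prop := IsIdeal {
  ideal0 : I 0;
  ideal_lin : forall (c : k) x y, I x -> I y -> I (c *: x + y);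
  idealD : forall x, I x -> I (confD x);
  idealMl : forall n x y, I x -> I (y *_(n) x);
  idealMr : forall n x y, I x -> I (x *_(n) y) }.

Definition Id C (S : set C) : set C := smallest (@is_ideal C) S.

Definition fin_supp (I : Type) (M : nmodType) (c : I -> M) : Prop :=
  finite_set [set i | c i != 0].

Definition k_comb (V : lmodType k) (I : choiceType) (c : I -> k) (e : I -> V) : V :=
  \sum_(i \in [set: I]) c i *: e i.

Definition is_k_basis (V : lmodType k) (I : choiceType) (e : I -> V) : Prop :=
  forall x : V, exists! c : I -> k, fin_supp c /\ x = k_comb c e.

(* p(D) x *)
Definition polyD C (p : {poly k}) (x : C) : C :=
  \sum_(t < size p) p`_t *: confDn t x.

Definition kD_comb C (I : choiceType) (c : I -> {poly k}) (e : I -> C) : C :=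
  \sum_(i \in [set: I]) polyD (c i) (e i).

Definition is_kD_basis C (I : choiceType) (e : I -> C) : Prop :=
  forall x : C, exists! c : I -> {poly k}, fin_supp c /\ x = kD_comb c e.

End ConfAlgDefs.

(* The free associative conformal algebra C(B, N) is the set of formal
   expressions in B, two expressions being identified when they take the same
   value in every associative conformal algebra under every map from B of
   locality bounded by N. That this is an associative conformal algebra, with
   the universal property, is [freeConf] and [free_lift] below. *)

Inductive cterm (k : fieldType) (B : Type) : Type :=
| TGen of B
| TZero
| TAdd of cterm k B & cterm k B
| TScale of k & cterm k B
| TD of cterm k B
| TProd of nat & cterm k B & cterm k B.
Arguments TGen {k B} _.
Arguments TZero {k B}.

HB.instance Definition _ (k : fieldType) (B : Type) := gen_eqMixin (cterm k B).
HB.instance Definition _ (k : fieldType) (B : Type) := gen_choiceMixin (cterm k B).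

Definition locality_le (k : fieldType) (B : Type) (N : nat) (A : confAlg k)
    (e : B -> A) : Prop :=
  forall a b n, (N <= n)%N -> e a *_(n) e b = 0.

Section AssocTheory.
Variables (k : fieldType) (A : assocConf k).
Implicit Types a b c : A.

Lemma confpDl_add n a a' b : (a + a') *_(n) b = a *_(n) b + a' *_(n) b.
Proof. by have := confp_linl (assoc_confP A) n 1 a a' b; rewrite !scale1r. Qed.

Lemma confpDr_add n a b b' : a *_(n) (b + b') = a *_(n) b + a *_(n) b'.
Proof. by have := confp_linr (assoc_confP A) n 1 a b b'; rewrite !scale1r. Qed.

Lemma confp0l n b : (0 : A) *_(n) b = 0.
Proof.
by have := confp_linl (assoc_confP A) n (-1) 0 0 b;
  rewrite scaler0 addr0 scaleN1r addNr.
Qed.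

Lemma confp0r n a : a *_(n) (0 : A) = 0.
Proof.
by have := confp_linr (assoc_confP A) n (-1) a 0 0;
  rewrite scaler0 addr0 scaleN1r addNr.
Qed.

Lemma confpZl n (z : k) a b : (z *: a) *_(n) b = z *: (a *_(n) b).
Proof. by have := confp_linl (assoc_confP A) n z a 0 b; rewrite !addr0 confp0l addr0. Qed.

Lemma confpZr n (z : k) a b : a *_(n) (z *: b) = z *: (a *_(n) b).
Proof. by have := confp_linr (assoc_confP A) n z a b 0; rewrite !addr0 confp0r addr0. Qed.

Lemma confDD a b : confD (a + b) = confD a + confD b.
Proof. by have := confD_lin (assoc_confP A) 1 a b; rewrite !scale1r. Qed.

Lemma confD0 : confD (0 : A) = 0.
Proof.
by have := confD_lin (assoc_confP A) (-1) 0 0; rewrite scaler0 addr0 scaleN1r addNr.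
Qed.

Lemma confDZ (z : k) a : confD (z *: a) = z *: confD a.
Proof. by have := confD_lin (assoc_confP A) z a 0; rewrite !addr0 confD0 addr0. Qed.

Lemma confpDr n a b : a *_(n) confD b = confD (a *_(n) b) + n%:R *: (a *_(n.-1) b).
Proof.
rewrite (confD_prod (assoc_confP A)); case: n => [|n].
  by rewrite (confpDl0 (assoc_confP A)) scale0r addr0 add0r.
by rewrite (confpDl (assoc_confP A)) //= addrAC addNr add0r.
Qed.

Definition local_at N a b := forall n, (N <= n)%N -> a *_(n) b = 0.

Lemma local_at_le N M a b : (N <= M)%N -> local_at N a b -> local_at M a b.
Proof. by move=> h l n hn; apply: l; apply: leq_trans hn. Qed.

Lemma local_prodl N n a b c : local_at N b c -> local_at N (a *_(n) b) c.
Proof.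
move=> h m hm; rewrite (@assoc_assocP _ A) big1// => t _.
by rewrite h ?confp0r ?scaler0// (leq_trans hm) // leq_addr.
Qed.

Lemma local_prodr N M m a b c :
  local_at N a b -> local_at M b c -> local_at (N + M) a (b *_(m) c).
Proof.
move=> hN hM; suff H r : forall m n, (M - m <= r)%N -> (N + (M - m) <= n)%N ->
    a *_(n) (b *_(m) c) = 0.
  by move=> n hn; apply: (H M); rewrite ?leq_subr //; lia.
elim: r => [|r IH] {}m n hr hn.
  by rewrite hM ?confp0r // -subn_eq0 -leqn0.
have := @assoc_assocP _ A n m a b c.
rewrite hN ?confp0l; last by apply: leq_trans hn; apply: leq_addr.
rewrite big_ord_recl /= expr0 bin0 mul1r scale1r subn0 addn0 big1 ?addr0 // => t _.
have tn : (t < n)%N by [].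
rewrite /bump /= add1n.
have [h|h] := leqP M (m + t.+1); first by rewrite hM // confp0r scaler0.
by rewrite IH ?scaler0 //; lia.
Qed.

Lemma local_Dl N a b : local_at N a b -> local_at N.+1 (confD a) b.
Proof.
move=> h [|n] //; rewrite ltnS => hn.
by rewrite (confpDl (assoc_confP A)) //= h // scaler0 oppr0.
Qed.

Lemma local_Dr N a b : local_at N a b -> local_at N.+1 a (confD b).
Proof.
move=> h [|n] //; rewrite ltnS => hn.
by rewrite confpDr /= !h // ?(leqW hn) // confD0 scaler0 addr0.
Qed.

End AssocTheory.

Section FreeConf.
Variables (k : fieldType) (B : Type) (N : nat).
Local Notation term := (cterm k B).

Fixpoint teval (A : confAlg k) (e : B -> A) (s : term) : A :=
  match s with
  | TGen b => e b
  | TZero => 0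
  | TAdd s1 s2 => teval e s1 + teval e s2
  | TScale c s1 => c *: teval e s1
  | TD s1 => confD (teval e s1)
  | TProd n s1 s2 => teval e s1 *_(n) teval e s2
  end.

Definition tequiv (s t : term) : Prop :=
  forall (A : assocConf k) (e : B -> A), locality_le N e -> teval e s = teval e t.

Definition tequivb : rel term := fun s t => `[< tequiv s t >].

Lemma tequivb_equiv : equiv_class_of tequivb.
Proof.
split=> [x|x y|y x z]; first exact/asboolP.
  by apply/asboolP/asboolP => h A e l; rewrite h.
by move=> /asboolP h1 /asboolP h2; apply/asboolP => A e l; rewrite h1 // h2.
Qed.
Canonical tequiv_equiv := EquivRelPack tequivb_equiv.

Definition freeT : Type := {eq_quot tequivb}%qT.
HB.instance Definition _ := Choice.on freeT.
HB.instance Definition _ := Quotient.on freeT.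
HB.instance Definition _ := EqQuotient.on freeT.

Definition fcl (s : term) : freeT := (\pi_freeT s)%qT.

Lemma fclP s t : fcl s = fcl t <-> tequiv s t.
Proof. by split=> [/eqquotP/asboolP //|h]; apply/eqquotP/asboolP. Qed.

Lemma fclW (P : freeT -> Prop) : (forall s, P (fcl s)) -> forall x, P x.
Proof. exact: quotW. Qed.

Lemma repr_fcl s : tequiv (repr (fcl s)) s.
Proof. by apply/fclP; rewrite /fcl reprK. Qed.

Lemma teval_repr (A : assocConf k) (e : B -> A) s : locality_le N e ->
  teval e (repr (fcl s)) = teval e s.
Proof. exact: repr_fcl. Qed.

Definition fzero : freeT := fcl TZero.
Definition fadd (x y : freeT) : freeT := fcl (TAdd (repr x) (repr y)).
Definition fscale (c : k) (x : freeT) : freeT := fcl (TScale c (repr x)).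
Definition fopp (x : freeT) : freeT := fscale (-1) x.
Definition fD (x : freeT) : freeT := fcl (TD (repr x)).
Definition fprod n (x y : freeT) : freeT := fcl (TProd n (repr x) (repr y)).

Lemma faddE s t : fadd (fcl s) (fcl t) = fcl (TAdd s t).
Proof. by apply/fclP => A e l /=; rewrite !repr_fcl. Qed.
Lemma fscaleE c s : fscale c (fcl s) = fcl (TScale c s).
Proof. by apply/fclP => A e l /=; rewrite !repr_fcl. Qed.
Lemma foppE s : fopp (fcl s) = fcl (TScale (-1) s).
Proof. exact: fscaleE. Qed.
Lemma fDE s : fD (fcl s) = fcl (TD s).
Proof. by apply/fclP => A e l /=; rewrite !repr_fcl. Qed.
Lemma fprodE n s t : fprod n (fcl s) (fcl t) = fcl (TProd n s t).
Proof. by apply/fclP => A e l /=; rewrite !repr_fcl. Qed.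
Let fE := (faddE, foppE, fscaleE, fDE, fprodE).

Fact faddA : associative fadd.
Proof.
elim/fclW=> x; elim/fclW=> y; elim/fclW=> z.
by rewrite !fE; apply/fclP => A e l /=; rewrite addrA.
Qed.
Fact faddC : commutative fadd.
Proof.
elim/fclW=> x; elim/fclW=> y.
by rewrite !fE; apply/fclP => A e l /=; rewrite addrC.
Qed.
Fact fadd0 : left_id fzero fadd.
Proof. by elim/fclW=> x; rewrite !fE; apply/fclP => A e l /=; rewrite add0r. Qed.
Fact faddN : left_inverse fzero fopp fadd.
Proof.
by elim/fclW=> x; rewrite !fE; apply/fclP => A e l /=; rewrite scaleN1r addNr.
Qed.
HB.instance Definition _ := GRing.isZmodule.Build freeT faddA faddC fadd0 faddN.

Fact fscaleA a b x : fscale a (fscale b x) = fscale (a * b) x.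
Proof.
by elim/fclW: x => x; rewrite !fE; apply/fclP => A e l /=; rewrite scalerA.
Qed.
Fact fscale1 : left_id 1 fscale.
Proof. by elim/fclW=> x; rewrite !fE; apply/fclP => A e l /=; rewrite scale1r. Qed.
Fact fscaleDr : right_distributive fscale +%R.
Proof.
move=> c; elim/fclW=> x; elim/fclW=> y; rewrite /GRing.add /= !fE.
by apply/fclP => A e l /=; rewrite scalerDr.
Qed.
Fact fscaleDl x : {morph fscale^~ x : a b / a + b}.
Proof.
elim/fclW: x => x a b; rewrite {2}/GRing.add /= !fE.
by apply/fclP => A e l /=; rewrite scalerDl.
Qed.
HB.instance Definition _ :=
  GRing.Zmodule_isLmodule.Build k freeT fscaleA fscale1 fscaleDr fscaleDl.

Lemma addfE s t : fcl s + fcl t = fcl (TAdd s t).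
Proof. exact: faddE. Qed.
Lemma scalefE c s : c *: fcl s = fcl (TScale c s).
Proof. exact: fscaleE. Qed.

Definition free_data : confAlg k := @ConfAlg k freeT fD fprod.
Definition fgen (b : B) : free_data := fcl (TGen b).

Lemma fcl_teval s : fcl s = teval fgen s.
Proof.
elim: s => //= [s <- t <-|c s <-|s <-|n s <- t <-].
- by rewrite addfE.
- by rewrite scalefE.
- by rewrite -fDE.
- by rewrite -fprodE.
Qed.

Lemma tlocal s t : exists M, forall (A : assocConf k) (e : B -> A),
  locality_le N e -> local_at M (teval e s) (teval e t).
Proof.
have H u : (forall b, exists M, forall (A : assocConf k) (e : B -> A),
    locality_le N e -> local_at M (e b) (teval e u)) ->
  forall s, exists M, forall (A : assocConf k) (e : B -> A),
    locality_le N e -> local_at M (teval e s) (teval e u).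
  move=> Hu; elim=> [b||s1 [M1 h1] s2 [M2 h2]|c s1 [M h]|s1 [M h]|n s1 _ s2 [M h]].
  - exact: Hu.
  - by exists 0%N => A e l n _; rewrite confp0l.
  - exists (maxn M1 M2) => A e l n /=; rewrite geq_max => /andP[n1 n2].
    by rewrite confpDl_add h1 // h2 // addr0.
  - by exists M => A e l n hn /=; rewrite confpZl h // scaler0.
  - by exists M.+1 => A e l /=; apply/local_Dl/h.
  - by exists M => A e l /=; apply/local_prodl/h.
apply: (H t); elim: t => [b'||s1 h1 s2 h2|c s1 h|s1 h|n s1 h1 s2 h2] b.
- by exists N => A e l n; apply: l.
- by exists 0%N => A e l n _; rewrite confp0r.
- have [M1 {}h1] := h1 b; have [M2 {}h2] := h2 b.
  exists (maxn M1 M2) => A e l n /=; rewrite geq_max => /andP[n1 n2].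
  by rewrite confpDr_add h1 // h2 // addr0.
- have [M {}h] := h b.
  by exists M => A e l n hn /=; rewrite confpZr h // scaler0.
- by have [M {}h] := h b; exists M.+1 => A e l /=; apply/local_Dr/h.
- have [M {}h1] := h1 b; have [M' h] := H _ h2 s1.
  by exists (M + M')%N => A e l /=; apply: local_prodr; [apply: h1|apply: h].
Qed.

Lemma free_confP : conformal_axioms free_data.
Proof.
split=> /=.
- move=> c; elim/fclW=> a; elim/fclW=> b; rewrite !(fDE, scalefE, addfE).
  by apply/fclP => A e l; do !rewrite /= ?(teval_repr _ l); rewrite confDD confDZ.
- move=> n c; elim/fclW=> a; elim/fclW=> a'; elim/fclW=> b.
  rewrite !(fprodE, scalefE, addfE).
  by apply/fclP => A e l; do !rewrite /= ?(teval_repr _ l); rewrite confpDl_add confpZl.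
- move=> n c; elim/fclW=> a; elim/fclW=> a'; elim/fclW=> b.
  rewrite !(fprodE, scalefE, addfE).
  by apply/fclP => A e l; do !rewrite /= ?(teval_repr _ l); rewrite confpDr_add confpZr.
- elim/fclW=> a; elim/fclW=> b; have [M h] := tlocal a b; exists M => n hn.
  by rewrite fprodE; apply/fclP => A e l; do !rewrite /= ?(teval_repr _ l); apply: h.
- move=> n; elim/fclW=> a; elim/fclW=> b.
  rewrite !(fprodE, fDE, scalefE, addfE).
  by apply/fclP => A e l; do !rewrite /= ?(teval_repr _ l); rewrite (confD_prod (assoc_confP A)).
- move=> n; elim/fclW=> a; elim/fclW=> b n0.
  rewrite -scaleN1r !(fprodE, fDE, scalefE, addfE).
  by apply/fclP => A e l; do !rewrite /= ?(teval_repr _ l); rewrite (confpDl (assoc_confP A)) // scaleN1r.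
- elim/fclW=> a; elim/fclW=> b; rewrite !(fprodE, fDE).
  by apply/fclP => A e l; do !rewrite /= ?(teval_repr _ l); rewrite (confpDl0 (assoc_confP A)).
Qed.

Lemma free_assocP : assoc_axiom free_data.
Proof.
move=> n m; elim/fclW=> a; elim/fclW=> b; elim/fclW=> c /=.
rewrite (eq_bigr (fun t : 'I_n.+1 => fcl (TScale ((-1) ^+ t * 'C(n, t)%:R)
    (TProd (n - t) a (TProd (m + t) b c))))); last first.
  by move=> t _; rewrite !fprodE scalefE.
rewrite !fprodE; pose F (t : 'I_n.+1) := TScale ((-1) ^+ t * 'C(n, t)%:R : k)
    (TProd (n - t) a (TProd (m + t) b c)).
have -> : \sum_(t < n.+1) fcl (F t) =
    fcl (\big[@TAdd k B/TZero]_(t < n.+1) F t).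
  elim/big_rec2: _ => // t u v _ ->; exact: addfE.
apply/fclP => A e l.
have -> : teval e (\big[@TAdd k B/TZero]_(t < n.+1) F t) =
    \sum_(t < n.+1) teval e (F t).
  by elim/big_rec2: _ => //= t u v _ ->.
by rewrite /= (@assoc_assocP _ A).
Qed.

Definition freeConf : assocConf k := AssocConf free_confP free_assocP.

Definition gen (b : B) : freeConf := fgen b.

Lemma gen_locality : locality_le N gen.
Proof. by move=> a b n hn; rewrite /= fprodE; apply/fclP => A e l; do !rewrite /= ?(teval_repr _ l); apply: l. Qed.

Lemma free_lift (A : assocConf k) (e : B -> A) : locality_le N e ->
  exists! phi : freeConf -> A, conf_hom phi /\ forall b, phi (gen b) = e b.
Proof.
move=> l; exists (fun x : freeT => teval e (repr x)); split.
  split=> [|b]; last by rewrite teval_repr.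
  split=> [c|x|n].
  - elim/fclW=> x; elim/fclW=> y; rewrite scalefE addfE.
    by do !rewrite /= ?(teval_repr _ l).
  - by elim/fclW: x => x; do !rewrite /= ?(teval_repr _ l).
  - elim/fclW=> x; elim/fclW=> y.
    by do !rewrite /= ?(teval_repr _ l).
move=> phi [hphi hb]; apply/funext.
have phi0 : phi 0 = 0.
  by have := conf_hom_lin hphi (-1) 0 0; rewrite scaler0 addr0 scaleN1r addNr.
elim/fclW=> x; rewrite teval_repr // fcl_teval.
elim: x => [b||s IHs t IHt|c s IH|s IH|n s IHs t IHt] /=.
- by rewrite -hb.
- by rewrite phi0.
- by rewrite -[X in phi (X + _)]scale1r (conf_hom_lin hphi) scale1r -IHs -IHt.
- by rewrite -[X in phi X]addr0 (conf_hom_lin hphi) phi0 addr0 -IH.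
- by rewrite IH -(conf_homD hphi).
- by rewrite IHs IHt -(conf_homM hphi).
Qed.

End FreeConf.

Section QuotConf.
Variables (k : fieldType) (A : assocConf k) (S : set A).

Lemma Id_ideal : is_ideal (Id S).
Proof.
split.
- by move=> I [hI _]; apply: ideal0 hI.
- by move=> c x y hx hy I hI; apply: ideal_lin hI.1 _ _ _ (hx _ hI) (hy _ hI).
- by move=> x hx I hI; apply: idealD hI.1 _ (hx _ hI).
- by move=> n x y hx I hI; apply: idealMl hI.1 _ _ _ (hx _ hI).
- by move=> n x y hx I hI; apply: idealMr hI.1 _ _ _ (hx _ hI).
Qed.

Lemma Id_add x y : Id S x -> Id S y -> Id S (x + y).
Proof. by move=> hx hy; rewrite -[x]scale1r; apply: (ideal_lin Id_ideal). Qed.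

Lemma Id_scale c x : Id S x -> Id S (c *: x).
Proof.
by move=> hx; rewrite -[_ *: _]addr0; apply: (ideal_lin Id_ideal) => //; apply: (ideal0 Id_ideal).
Qed.

Definition qequivb : rel A := fun x y => `[< Id S (x - y) >].

Lemma qequivb_equiv : equiv_class_of qequivb.
Proof.
split=> [x|x y|y x z].
- by apply/asboolP; rewrite subrr; apply: (ideal0 Id_ideal).
- by apply/asboolP/asboolP => h; rewrite -opprB -scaleN1r; apply: Id_scale.
- move=> /asboolP h1 /asboolP h2; apply/asboolP.
  by rewrite -(subrKA y); apply: Id_add.
Qed.
Canonical qequiv_equiv := EquivRelPack qequivb_equiv.

Definition quotT : Type := {eq_quot qequivb}%qT.
HB.instance Definition _ := Choice.on quotT.
HB.instance Definition _ := Quotient.on quotT.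
HB.instance Definition _ := EqQuotient.on quotT.

Definition qcl (x : A) : quotT := (\pi_quotT x)%qT.

Lemma qclP x y : qcl x = qcl y <-> Id S (x - y).
Proof. by split=> [/eqquotP/asboolP //|h]; apply/eqquotP/asboolP. Qed.

Lemma qclW (P : quotT -> Prop) : (forall s, P (qcl s)) -> forall x, P x.
Proof. exact: quotW. Qed.

Lemma repr_qcl x : Id S (repr (qcl x) - x).
Proof. by apply/qclP; rewrite /qcl reprK. Qed.

Definition qadd (x y : quotT) : quotT := qcl (repr x + repr y).
Definition qscale (c : k) (x : quotT) : quotT := qcl (c *: repr x).
Definition qopp (x : quotT) : quotT := qscale (-1) x.
Definition qD (x : quotT) : quotT := qcl (confD (repr x)).
Definition qprod n (x y : quotT) : quotT := qcl (repr x *_(n) repr y).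

Lemma qaddE x y : qadd (qcl x) (qcl y) = qcl (x + y).
Proof. by apply/qclP; rewrite opprD addrACA; apply: Id_add; apply: repr_qcl. Qed.
Lemma qscaleE c x : qscale c (qcl x) = qcl (c *: x).
Proof. by apply/qclP; rewrite -scalerBr; apply: Id_scale; apply: repr_qcl. Qed.
Lemma qoppE x : qopp (qcl x) = qcl (- x).
Proof. by rewrite /qopp qscaleE scaleN1r. Qed.
Lemma qDE x : qD (qcl x) = qcl (confD x).
Proof.
apply/qclP; rewrite -[- confD x]scaleN1r -confDZ -confDD scaleN1r.
by apply: (idealD Id_ideal); apply: repr_qcl.
Qed.
Lemma qprodE n x y : qprod n (qcl x) (qcl y) = qcl (x *_(n) y).
Proof.
apply/qclP; rewrite -(subrKA (x *_(n) repr (qcl y))); apply: Id_add.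
- rewrite -[- _]scaleN1r -confpZl -confpDl_add scaleN1r.
  by apply: (idealMr Id_ideal); apply: repr_qcl.
- rewrite -[- _]scaleN1r -confpZr -confpDr_add scaleN1r.
  by apply: (idealMl Id_ideal); apply: repr_qcl.
Qed.
Let qE := (qaddE, qoppE, qscaleE).

Fact qaddA : associative qadd.
Proof. by elim/qclW=> x; elim/qclW=> y; elim/qclW=> z; rewrite !qE addrA. Qed.
Fact qaddC : commutative qadd.
Proof. by elim/qclW=> x; elim/qclW=> y; rewrite !qE addrC. Qed.
Fact qadd0 : left_id (qcl 0) qadd.
Proof. by elim/qclW=> x; rewrite !qE add0r. Qed.
Fact qaddN : left_inverse (qcl 0) qopp qadd.
Proof. by elim/qclW=> x; rewrite !qE addNr. Qed.
HB.instance Definition _ := GRing.isZmodule.Build quotT qaddA qaddC qadd0 qaddN.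

Lemma addqE x y : qcl x + qcl y = qcl (x + y).
Proof. exact: qaddE. Qed.

Fact qscaleA a b x : qscale a (qscale b x) = qscale (a * b) x.
Proof. by elim/qclW: x => x; rewrite !qscaleE scalerA. Qed.
Fact qscale1 : left_id 1 qscale.
Proof. by elim/qclW=> x; rewrite qscaleE scale1r. Qed.
Fact qscaleDr : right_distributive qscale +%R.
Proof.
by move=> c; elim/qclW=> x; elim/qclW=> y; rewrite addqE !qscaleE addqE scalerDr.
Qed.
Fact qscaleDl x : {morph qscale^~ x : a b / a + b}.
Proof. by elim/qclW: x => x a b; rewrite !qscaleE addqE scalerDl. Qed.
HB.instance Definition _ :=
  GRing.Zmodule_isLmodule.Build k quotT qscaleA qscale1 qscaleDr qscaleDl.

Lemma scaleqE c x : c *: qcl x = qcl (c *: x).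
Proof. exact: qscaleE. Qed.

Definition quot_data : confAlg k := @ConfAlg k quotT qD qprod.

Lemma quot_confP : conformal_axioms quot_data.
Proof.
split=> /=.
- move=> c; elim/qclW=> a; elim/qclW=> b.
  by rewrite scaleqE addqE !qDE scaleqE addqE confDD confDZ.
- move=> n c; elim/qclW=> a; elim/qclW=> a'; elim/qclW=> b.
  by rewrite scaleqE addqE !qprodE scaleqE addqE confpDl_add confpZl.
- move=> n c; elim/qclW=> a; elim/qclW=> b; elim/qclW=> b'.
  by rewrite scaleqE addqE !qprodE scaleqE addqE confpDr_add confpZr.
- elim/qclW=> a; elim/qclW=> b; have [M h] := conf_local (assoc_confP A) a b.
  by exists M => n hn; rewrite qprodE h.
- move=> n; elim/qclW=> a; elim/qclW=> b.
  by rewrite qprodE !qDE !qprodE addqE (confD_prod (assoc_confP A)).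
- move=> n; elim/qclW=> a; elim/qclW=> b n0.
  rewrite qDE !qprodE scaleqE -[in RHS]scaleN1r scaleqE scaleN1r.
  by rewrite (confpDl (assoc_confP A)).
- by elim/qclW=> a; elim/qclW=> b; rewrite qDE qprodE (confpDl0 (assoc_confP A)).
Qed.

Lemma quot_assocP : assoc_axiom quot_data.
Proof.
move=> n m; elim/qclW=> a; elim/qclW=> b; elim/qclW=> c /=.
rewrite (eq_bigr (fun t : 'I_n.+1 => qcl (((-1) ^+ t * 'C(n, t)%:R) *:
    (a *_(n - t) (b *_(m + t) c))))); last first.
  by move=> t _; rewrite !qprodE scaleqE.
rewrite !qprodE (@assoc_assocP _ A).
by elim/big_rec2: _ => // t u v _ <-; rewrite addqE.
Qed.

Definition quotConf : assocConf k := AssocConf quot_confP quot_assocP.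

Definition quot_pi (x : A) : quotConf := qcl x.

Lemma quot_pi_hom : conf_hom quot_pi.
Proof.
split=> [c x y|x|n x y] /=; first by rewrite scaleqE addqE.
- by rewrite qDE.
- by rewrite qprodE.
Qed.

Lemma quot_pi_surj (y : quotConf) : exists x, quot_pi x = y.
Proof. by elim/qclW: y => x; exists x. Qed.

Lemma quot_pi_eq x y : quot_pi x = quot_pi y <-> Id S (x - y).
Proof. exact: qclP. Qed.

End QuotConf.

Section Words.
Variables (k : fieldType) (B : choiceType) (N : nat).
Local Notation C := (freeConf k B N).

(* The word b_1(n_1) ... b_k(n_k) D^i b_{k+1} is the triple
   ([:: (b_1, n_1); ...; (b_k, n_k)], (b_{k+1}, i)). *)
Definition word : Type := (seq (B * 'I_N) * (B * nat))%type.

(* A prefix [:: (b_1, n_1); ...; (b_j, n_j)] stands for "a_(n)" where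
   a = b_1(n_1) ... b_j is D-free and n = n_j; the empty list is the case of
   an empty a. *)
Definition prefix : Type := seq (B * 'I_N).

HB.instance Definition _ := Choice.on word.

Definition wsize (u : word) : nat := (size u.1).+1.
Definition wind (u : word) : nat := u.2.2.
Definition wdfree (u : word) : Prop := wind u = 0%N.

(* a_(n) u *)
Definition wpre (p : prefix) (u : word) : word := (p ++ u.1, u.2).
(* u_(n) v, for u D-free *)
Definition wcat (u : word) (n : 'I_N) (v : word) : word :=
  (u.1 ++ (u.2.1, n) :: v.1, v.2).
(* u D^l *)
Definition wD (u : word) (l : nat) : word := (u.1, (u.2.1, (u.2.2 + l)%N)).

Definition act (p : prefix) (x : C) : C :=
  foldr (fun (bn : B * 'I_N) (y : C) => gen k N bn.1 *_(bn.2) y) x p.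

(* [u] *)
Definition nword (u : word) : C := act u.1 (confDn u.2.2 (gen k N u.2.1)).

(* The normal words [nword] form a basis of C(B, N); these are the coordinates
   of [f] in it. *)
Definition coords (f : C) : word -> k :=
  xget (fun=> 0) [set c : word -> k | fin_supp c /\ f = k_comb c nword].

Definition occurs (u : word) (f : C) : Prop := coords f u != 0.
Definition dfree (f : C) : Prop := forall u, occurs u f -> wdfree u.

Section Order.
Variable ltB : rel B.

(* (b_1, n_1, ..., b_k, n_k, b_{k+1}, i) compared lexicographically; used only
   for words of the same length. *)
Fixpoint wt_lt (p : prefix) (x : B * nat) (q : prefix) (y : B * nat) : bool :=
  match p, q with
  | bn :: p', cm :: q' =>
      ltB bn.1 cm.1 ||
      (bn.1 == cm.1) &&
        ((bn.2 < cm.2)%N || (bn.2 == cm.2) && wt_lt p' x q' y)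
  | _, _ => ltB x.1 y.1 || (x.1 == y.1) && (x.2 < y.2)%N
  end.

Definition word_lt (u v : word) : bool :=
  (wsize u < wsize v)%N || (wsize u == wsize v) && wt_lt u.1 u.2 v.1 v.2.
Definition word_le (u v : word) : bool := (u == v) || word_lt u v.

(* [None] is the leading word of 0. *)
Definition lead_le (x y : option word) : bool :=
  match x, y with
  | None, _ => true
  | Some u, Some v => word_le u v
  | Some _, None => false
  end.

Definition lead (f : C) : option word :=
  xget None [set o : option word |
    if o is Some u then occurs u f /\ (forall v, occurs v f -> word_le v u)
    else f = 0].

Definition monic (f : C) : Prop := exists2 u, lead f = Some u & coords f u = 1.

(* The normal S-words, as elements of C(B, N). *)
Inductive normal_Sword (S : set C) : C -> Prop :=
| Sword_fst (p : prefix) (s : C) (w : word) (m : 'I_N) (c : word) of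
    S s & lead s = Some w & wdfree w :
    normal_Sword S (act p (s *_(m) nword c))
| Sword_snd (p : prefix) (s : C) (i : nat) of S s :
    normal_Sword S (act p (confDn i s)).

Definition Irr (S : set C) : set C :=
  [set x | exists u : word, x = nword u /\
           forall v, normal_Sword S v -> lead v <> Some u].

(* [composition f g h]: h is a composition of f and g; the multiplication
   compositions involve f only. *)
Inductive composition (f g : C) : C -> Prop :=
| Comp_incl (u v : word) (p : prefix) (m : 'I_N) (c : word) of
    lead f = Some u & lead g = Some v & wdfree v &
    u = wpre p (wcat v m c) :
    composition f g (f - act p (g *_(m) nword c))
| Comp_rincl (u v : word) (p : prefix) (i : nat) of
    lead f = Some u & lead g = Some v & u = wpre p (wD v i) :
    composition f g (f - act p (confDn i g))
| Comp_inter (u v w : word) (p : prefix) (m : 'I_N) (c : word) of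
    lead f = Some u & lead g = Some v & wdfree u & p != [::] &
    w = wcat u m c & w = wpre p v & (wsize w < wsize u + wsize v)%N :
    composition f g (f *_(m) nword c - act p g)
| Comp_rinter (u v : word) (p : prefix) (i : nat) of
    lead f = Some u & lead g = Some v & (0 < i)%N & p != [::] &
    wD u i = wpre p v :
    composition f g (confDn i f - act p g)
| Comp_lmul (b : B) (n : nat) of (N <= n)%N :
    composition f g (gen k N b *_(n) f)
| Comp_rmul (b : B) (n : nat) of
    (exists u, [/\ lead f = Some u, ~ wdfree u & (n < N)%N]) \/
    (~ dfree f /\ (N <= n)%N) :
    composition f g (f *_(n) gen k N b).

Definition trivial_mod (S : set C) (h : C) : Prop :=
  exists r : seq (k * C),
    (forall x, x \in r -> normal_Sword S x.2 /\ lead_le (lead x.2) (lead h)) /\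
    h = \sum_(x <- r) x.1 *: x.2.

Definition is_GSB (S : set C) : Prop :=
  (forall f, S f -> monic f) /\
  (forall f g h, S f -> S g -> composition f g h -> trivial_mod S h).

End Order.
End Words.

Section Enveloping.
Variables (k : fieldType) (L : lieConf k) (I : choiceType) (b : I -> L) (N : nat).
Local Notation g := (gen k N (B := I)).

(* b_i(n) b_j - {b_j(n) b_i} - b_i[n] b_j, where b_i[n] b_j = sum_l c_l(D) b_l in L. *)
Definition env_rels : set (freeConf k I N) :=
  [set x | exists (i j : I) (n : nat) (c : I -> {poly k}),
     [/\ (n < N)%N, fin_supp c, b i *_(n) b j = kD_comb c b &
         x = g i *_(n) g j - cflip n (g j) (g i) - kD_comb c g]].

Definition univ_env : assocConf k := quotConf env_rels.

Definition env_pi : freeConf k I N -> univ_env := @quot_pi _ _ env_rels.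

End Enveloping.
Arguments env_rels {k L I} b N _.
Arguments univ_env {k L I} b N.
Arguments env_pi {k L I} b N _.

Record is_loop_virasoro (k : fieldType) (LW : lieConf k) (ell : int -> LW) : Prop :=
  IsLoopVirasoro {
    lw_basis : is_kD_basis ell;
    lw_prod0 : forall i j, ell i *_(0) ell j = - confD (ell (i + j));
    lw_prod1 : forall i j, ell i *_(1) ell j = - (2 *: ell (i + j));
    lw_prod2 : forall i j n, (2 <= n)%N -> ell i *_(n) ell j = 0 }.

Section LoopVirasoro.
Variable k : fieldType.
Local Notation C := (freeConf k int 2).
Local Notation L := (gen k 2 (B := int)).

Definition Sminus : set C :=
  [set x | exists i j : int,
     x = L i *_(0) L j + L j *_(1) confD (L i) - 2 *: (L j *_(0) L i)
         + confD (L (i + j)) \/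
     x = L i *_(1) L j + L j *_(1) L i + 2 *: L (i + j)].

Definition S1 : set C :=
  [set x | exists i j : int,
     (i != 0 /\ x = L i *_(0) L j - L 0 *_(0) L (i + j)) \/
     x = L i *_(1) L j + L (i + j)].

(* L_i < L_j; a well-order, by [loop_lt_wf] and [loop_lt_total]. *)
Definition loop_lt : rel int := fun i j =>
  (`|i| < `|j|) || (`|i| == `|j|) && (i < j).

(* [L_0(0) L_0(0) ... L_0(0) D^t L_i], with n factors L_0(0) *)
Definition L0word (n t : nat) (i : int) : C :=
  iter n (fun x : C => L 0 *_(0) x) (confDn t (L i)).

End LoopVirasoro.
Arguments Sminus k _ : clear implicits.
Arguments S1 k _ : clear implicits.

Lemma loop_lt_wf : well_founded (fun i j => loop_lt i j).
Proof.
pose m (i : int) := ((absz i).*2 + (0 < i)%R)%N.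
have H i j : loop_lt i j -> (m i < m j)%N.
  rewrite /loop_lt /m => /orP[h|/andP[/eqP h1 h2]].
    have {}h : (absz i < absz j)%N by lia.
    by case: (0 < i); case: (0 < j); lia.
  have -> : absz i = absz j by lia.
  have -> : (0 < i) = false by apply/negbTE; rewrite -leNgt; lia.
  have -> : (0 < j) = true by lia.
  by rewrite addn1 addn0 ltnS.
apply: (Wf_nat.well_founded_lt_compat _ m) => i j h.
by apply/ssrnat.ltP; apply: H.
Qed.

Lemma loop_lt_total i j : i != j -> loop_lt i j || loop_lt j i.
Proof.
rewrite neq_lt /loop_lt [`|j| == _]eq_sym.
by case: (ltgtP `|i| `|j|).
Qed.

(* Main.v *)
Require Import Defs.
From HB Require Import structures.
From mathcomp Require Import all_boot all_order all_algebra.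
From mathcomp Require Import zify ring.
From mathcomp Require Import all_classical reals complex.
Set Implicit Arguments.
Unset Strict Implicit.
Unset Printing Implicit Defensive.
Import Order.TTheory GRing.Theory.
Local Open Scope classical_set_scope.
Local Open Scope ring_scope.

(** Two conformal algebras on A[x][D], for an associative algebra A, carry the
    proof; their product extends a_(n) b = a (d/dx)^n b sesquilinearly. For A the
    noncommutative power series in letters P_b, Q_b, the assignment
    b |-> P_b + x Q_b separates the normal words, so that these form a basis of
    C(B, 2) and leading words can be read off. For A = k, the assignments
    L_i |-> - alpha^i x (alpha <> 0) kill S_1 and separate the S_1-irreducible
    words, which gives the basis of the envelope without the
    composition-diamond lemma. The compositions of S_1 are resolved by hand. *)

(** * A conformal algebra over an associative algebra *)

(* In {poly {poly A}} the inner variable is x and the outer one is D. *)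
Section TotalDeriv.
Variable A : nzRingType.
Implicit Types (p : {poly A}) (w : {poly {poly A}}).

(** [freeConf] identifies formal expressions by their values in all models, and [coords] and [lead]
    are defined by choice. So inequalities cannot be computed inside C(B, 2): each one has to come
    from an explicit model, and leading words can be determined only once the normal words are known
    to be a basis. The shape of the first model is dictated by locality: with T the extension of
    d/dx, T^2 (P + x Q) = 0 is locality 2, while T (P + x Q) = Q keeps the index n of b_(n) visible.
    The letters must not commute, or the order of the factors would be lost. For the envelope, a
    single alpha is not enough, since it sends all L_i to multiples of one element x. Letting alpha
    vary recovers i as an exponent of a Laurent polynomial in alpha, and characteristic 0 supplies
    enough points to make such a polynomial vanish identically. The Groebner-Shirshov property is
    then a separate statement, for which only leading words matter. *)

Definition total_deriv w : {poly {poly A}} := w^`() + map_poly (@deriv A) w.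

Lemma total_derivD w w' : total_deriv (w + w') = total_deriv w + total_deriv w'.
Proof. by rewrite /total_deriv derivD raddfD /= addrACA. Qed.

Lemma total_derivX w : total_deriv ('X * w) = 'X * total_deriv w + w.
Proof.
rewrite /total_deriv derivM derivX mul1r.
have -> : map_poly (@deriv A) ('X * w) = 'X * map_poly (@deriv A) w.
  by apply/polyP=> -[|i]; rewrite coef_map !coefXM /= ?linear0 // coef_map.
by rewrite mulrDr -addrA addrC.
Qed.

Lemma total_derivM p w :
  total_deriv (p%:P * w) = (p^`())%:P * w + p%:P * total_deriv w.
Proof.
rewrite /total_deriv derivM derivC mul0r add0r.
have -> : map_poly (@deriv A) (p%:P * w) = p^`()%:P * w + p%:P * map_poly (@deriv A) w.
  by apply/polyP=> i; rewrite coef_map !(coefD, coefCM) /= derivM coef_map.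
by rewrite mulrDr addrCA.
Qed.

Lemma total_derivC p : total_deriv p%:P = (p^`())%:P.
Proof. by rewrite /total_deriv derivC add0r map_polyC. Qed.

End TotalDeriv.

Section Cend.
Variables (k : fieldType) (A0 : algType k).

(** A separate name, because the double polynomial type already carries scalars from [{poly A0}],
    whereas here k has to act. *)
Definition cend : Type := {poly {poly A0}}.
HB.instance Definition _ := GRing.NzRing.on cend.

Definition cendC (p : {poly A0}) : cend := p%:P.
Definition cend_const (c : k) : {poly A0} := (c%:A)%:P.

Lemma cend_const_comm c (p : {poly A0}) : cend_const c * p = p * cend_const c.
Proof.
apply/polyP => i; rewrite coefCM coefMC.
by rewrite -scalerAl mul1r -[in RHS]scalerAr mulr1.
Qed.

Definition cend_scale (c : k) (w : cend) : cend := cendC (cend_const c) * w.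

Fact cend_scaleA a b w : cend_scale a (cend_scale b w) = cend_scale (a * b) w.
Proof.
rewrite /cend_scale mulrA; congr (_ * _); rewrite /cendC -polyCM; congr _%:P.
by rewrite /cend_const -polyCM -scalerAl mul1r scalerA.
Qed.
Fact cend_scale1 : left_id 1 cend_scale.
Proof. by move=> w; rewrite /cend_scale /cend_const scale1r mul1r. Qed.
Fact cend_scaleDr : right_distributive cend_scale +%R.
Proof. by move=> c u v; rewrite /cend_scale mulrDr. Qed.
Fact cend_scaleDl w : {morph cend_scale^~ w : a b / a + b}.
Proof.
by move=> a b; rewrite /cend_scale /cend_const /cendC scalerDl !polyCD mulrDl.
Qed.
HB.instance Definition _ := GRing.Zmodule_isLmodule.Build k cend
  cend_scaleA cend_scale1 cend_scaleDr cend_scaleDl.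

Fact cend_scaleAl (c : k) (u v : cend) : c *: (u * v) = (c *: u) * v.
Proof. exact: mulrA. Qed.
HB.instance Definition _ := GRing.Lmodule_isLalgebra.Build k cend cend_scaleAl.

Lemma cendC_const_comm c (u : {poly {poly A0}}) :
  (cend_const c)%:P * u = u * (cend_const c)%:P.
Proof. by apply/polyP => i; rewrite coefCM coefMC cend_const_comm. Qed.

Fact cend_scaleAr (c : k) (u v : cend) : c *: (u * v) = u * (c *: v).
Proof.
rewrite cend_scaleAl [X in X * _](cendC_const_comm c u).
exact: esym (mulrA _ _ _).
Qed.
HB.instance Definition _ := GRing.Lalgebra_isAlgebra.Build k cend cend_scaleAr.

Lemma cend_scaleE c (w : cend) : c *: w = cendC (cend_const c) * w.
Proof. by []. Qed.

Lemma cendC_linear c p q : cendC (cend_const c * p + q) = c *: cendC p + cendC q.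
Proof. by rewrite /cendC polyCD polyCM. Qed.

Lemma cendCM p q : cendC (p * q) = cendC p * cendC q.
Proof. exact: polyCM. Qed.

Definition cend_D (w : cend) : cend := ('X : {poly {poly A0}}) * w.
(** The rule a_(n) D b = D (a_(n) b) + n a_(n-1) b forces [T, D] = 1; hence T is the derivative in x
    plus the derivative in D. *)
Definition cend_T (w : cend) : cend := total_deriv w.
Definition cend_coef (i : nat) (w : cend) : cend := cendC (w`_i).

Fact cend_T_linear : linear cend_T.
Proof.
move=> c u v; rewrite /cend_T [LHS]total_derivD; congr (_ + _).
by rewrite [LHS]total_derivM derivC polyC0 mul0r add0r.
Qed.
HB.instance Definition _ := GRing.isLinear.Build k cend cend _ cend_T cend_T_linear.

Fact cend_coef_linear i : linear (cend_coef i).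
Proof. by move=> c u v; rewrite -cendC_linear /cend_coef coefD coefCM. Qed.
HB.instance Definition _ i :=
  GRing.isLinear.Build k cend cend _ (cend_coef i) (@cend_coef_linear i).

Lemma cend_D_linear : linear cend_D.
Proof. by move=> c u v; rewrite /cend_D mulrDr scalerAr. Qed.
HB.instance Definition _ := GRing.isLinear.Build k cend cend _ cend_D cend_D_linear.

Lemma cend_TD w : cend_T (cend_D w) = cend_D (cend_T w) + w.
Proof. exact: total_derivX. Qed.

Lemma cend_TM p w : cend_T (cendC p * w) = cendC p^`() * w + cendC p * cend_T w.
Proof. exact: total_derivM. Qed.

Lemma cend_TC p : cend_T (cendC p) = cendC p^`().
Proof. exact: total_derivC. Qed.

Lemma cend_DMC p w : cend_D (cendC p * w) = cendC p * cend_D w.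
Proof. by rewrite /cend_D !mulrA; congr (_ * _); apply/esym/commr_polyX. Qed.

Lemma iter_linear (V : lmodType k) (f : {linear V -> V}) n : linear (iter n f).
Proof. by elim: n => // n IH c u v; rewrite !iterS IH linearP. Qed.
HB.instance Definition _ n :=
  GRing.isLinear.Build k cend cend _ (iter n cend_T) (@iter_linear _ _ n).

(** The Weyl relation [T, D] = 1, iterated: [T^n, D] = n T^(n-1). *)
Lemma iter_cend_T_D n w :
  iter n cend_T (cend_D w) = cend_D (iter n cend_T w) + n%:R *: iter n.-1 cend_T w.
Proof.
elim: n => [|n IH]; first by rewrite scale0r addr0.
rewrite iterS IH linearD /= cend_TD linearZ /=; case: n {IH} => [|n] /=.
  by rewrite scale0r addr0 scale1r.
by rewrite -addrA [in RHS]mulrS scalerDl scale1r.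
Qed.

(** Horner's scheme in D. It reduces an identity whose two sides react to D in the same way to
    arguments free of D. *)
Lemma cend_ind (P : cend -> Prop) :
  (forall p, P (cendC p)) -> (forall w, P w -> P (cend_D w)) ->
  (forall u v, P u -> P v -> P (u + v)) -> forall w, P w.
Proof.
move=> hC hD hA; elim/poly_ind => [|w p IH]; first by rewrite -polyC0; apply: hC.
by apply: hA; [rewrite [_ * 'X]commr_polyX; apply: hD | apply: hC].
Qed.

(** T lowers the total degree in x and D, so it is locally nilpotent; locality of the products rests
    on this. *)
Lemma cend_T_nilp w : exists M, forall n, (M <= n)%N -> iter n cend_T w = 0.
Proof.
elim/cend_ind: w => [p|w [M IH]|u v [M hM] [N hN]].
- exists (size p) => n hn; have -> : iter n cend_T (cendC p) = cendC (p^`(n)).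
    by elim: n {hn} => //= n ->; rewrite cend_TC.
  by rewrite derivn_poly0.
- exists M.+1 => -[//|n] hn; rewrite iter_cend_T_D !IH ?scaler0 ?addr0 ?linear0 //.
  exact: ltnW.
- exists (maxn M N) => n; rewrite geq_max => /andP[h1 h2].
  by rewrite linearD /= hM ?hN ?addr0.
Qed.

(* The product is a_(n) b = a T^n b for a without D; the coefficients make it
   satisfy (D f)_(n) g = - n f_(n-1) g. *)
Definition cend_prod (n : nat) (f g : cend) : cend :=
  \sum_(i < n.+1) ((-1) ^+ i * (n ^_ i)%:R) *: (cend_coef i f * iter (n - i) cend_T g).

Definition cend_data : confAlg k := @ConfAlg k cend cend_D cend_prod.

Lemma cend_prod_linl n g : linear (fun f => cend_prod n f g).
Proof.
move=> c f f'; rewrite /cend_prod scaler_sumr -big_split; apply: eq_bigr => i _ /=.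
by rewrite linearP mulrDl scalerDr -scalerAl !scalerA [c * _]mulrC.
Qed.

Lemma cend_prod_linr n f : linear (cend_prod n f).
Proof.
move=> c g g'; rewrite /cend_prod scaler_sumr -big_split; apply: eq_bigr => i _ /=.
by rewrite linearP mulrDr scalerDr -scalerAr !scalerA [c * _]mulrC.
Qed.

Lemma cend_coefD0 f : cend_coef 0 (cend_D f) = 0.
Proof. by rewrite /cend_coef /cend_D coefXM. Qed.

Lemma cend_coefDS i f : cend_coef i.+1 (cend_D f) = cend_coef i f.
Proof. by rewrite /cend_coef /cend_D coefXM. Qed.

Lemma cend_prodDl0 f g : cend_prod 0 (cend_D f) g = 0.
Proof. by rewrite /cend_prod big_ord1 cend_coefD0 mul0r scaler0. Qed.

Lemma cend_prodDl n f g : cend_prod n.+1 (cend_D f) g = - (n.+1%:R *: cend_prod n f g).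
Proof.
rewrite /cend_prod big_ord_recl /= cend_coefD0 mul0r scaler0 add0r.
rewrite scaler_sumr -sumrN; apply: eq_bigr => i _.
rewrite cend_coefDS /bump /= add1n subSS ffactSS natrM exprS -scaleNr scalerA.
by congr (_ *: _); rewrite !mulNr mul1r mulrCA.
Qed.

Lemma cend_prodDr0 f g : cend_prod 0 f (cend_D g) = cend_D (cend_prod 0 f g).
Proof. by rewrite /cend_prod !big_ord1 /= linearZ /= cend_DMC. Qed.

Lemma cend_prodDr n f g :
  cend_prod n.+1 f (cend_D g) = cend_D (cend_prod n.+1 f g) + n.+1%:R *: cend_prod n f g.
Proof.
rewrite /cend_prod linear_sum /=; under eq_bigr do
  rewrite iter_cend_T_D mulrDr scalerDr -cend_DMC -linearZ.
rewrite big_split /=; congr (_ + _).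
rewrite big_ord_recr /= subnn scale0r mulr0 scaler0 addr0 scaler_sumr.
apply: eq_bigr => -[i /=]; rewrite ltnS => hi _.
rewrite -scalerAr !scalerA (subSn hi) /=; congr (_ *: _).
by rewrite -mulrA -natrM -(subSn hi) -ffactnSr ffactSS natrM mulrCA.
Qed.

Lemma cend_prodC n p g : cend_prod n (cendC p) g = cendC p * iter n (@cend_T) g.
Proof.
rewrite /cend_prod big_ord_recl big1 => [|i _].
  rewrite /= addr0 expr0 mul1r ffactn0 scale1r subn0.
  by rewrite /cend_coef /cendC coefC.
by rewrite /cend_coef /cendC coefC /= polyC0 mul0r scaler0.
Qed.

Lemma cend_confP : conformal_axioms cend_data.
Proof.
split => /=.
- exact: cend_D_linear.
- move=> n c a a' b; exact: (cend_prod_linl n b c a a').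
- move=> n c a b b'; exact: (cend_prod_linr n a c b b').
- move=> a b; have [M h] := cend_T_nilp b; exists (M + size (a : {poly {poly A0}}))%N.
  move=> n hn; rewrite /cend_prod big1 // => i _.
  have [hi|hi] := leqP (size (a : {poly {poly A0}})) i.
    by rewrite /cend_coef nth_default // /cendC polyC0 mul0r scaler0.
  by rewrite h ?mulr0 ?scaler0 //; lia.
- move=> [|n] a b; first by rewrite cend_prodDl0 cend_prodDr0 add0r.
  by rewrite cend_prodDl cend_prodDr addrCA addNr addr0.
- by move=> [//|n] a b _; apply: cend_prodDl.
- exact: cend_prodDl0.
Qed.

(** The sum is (ad T)^n of the multiplication by q, applied to T^m c, and [T, q] = q'. *)
Lemma cend_leibniz n m q (c : cend) :
  \sum_(t < n.+1) ((-1) ^+ t * 'C(n, t)%:R) *: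
    iter (n - t) (@cend_T) (cendC q * iter (m + t) (@cend_T) c) =
  cendC q^`(n) * iter m (@cend_T) c.
Proof.
pose F n m t := iter (n - t) (@cend_T) (cendC q * iter (m + t) (@cend_T) c).
rewrite -[LHS]/(\sum_(t < n.+1) ((-1) ^+ t * 'C(n, t)%:R) *: F n m t).
elim: n m => [|n IH] m.
  by rewrite big_ord1 /F /= expr0 mul1r scale1r addn0.
have FS t : F n.+1 m (t.+1) = F n m.+1 t by rewrite /F subSS addSnnS.
have Fpre t : (t <= n)%N -> F n.+1 m t = cend_T (F n m t).
  by move=> h; rewrite /F subSn.
rewrite big_ord_recl /= bin0 mulr1 expr0 scale1r Fpre //.
(* Pascal's rule. Writing S(n, m) for the sum, it gives S(n+1, m) = T S(n, m) - S(n, m+1). *)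
under eq_bigr do rewrite /bump /= add1n FS binS natrD mulrDr scalerDl.
rewrite big_split /= addrA.
have -> : \sum_(i < n.+1) ((-1) ^+ i.+1 * 'C(n, i)%:R) *: F n m.+1 i =
   - \sum_(i < n.+1) ((-1) ^+ i * 'C(n, i)%:R) *: F n m.+1 i.
  by rewrite -sumrN; apply: eq_bigr => i _; rewrite exprS mulN1r mulNr scaleNr.
rewrite IH big_ord_recr /= bin_small // mulr0 scale0r addr0.
have -> : cend_T (F n m 0%N) + \sum_(i < n) ((-1) ^+ i.+1 * 'C(n, i.+1)%:R) *: F n m.+1 i
    = cend_T (\sum_(t < n.+1) ((-1) ^+ t * 'C(n, t)%:R) *: F n m t).
  rewrite [in RHS]big_ord_recl linearD linear_sum /= bin0 mulr1 expr0 scale1r.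
  congr (_ + _); apply: eq_bigr => -[t /= ht] _; rewrite linearZ /=.
  by rewrite /bump /= add1n -FS Fpre.
by rewrite IH cend_TM addrK.
Qed.

Lemma cend_prodDl_pred n f g : cend_prod n (cend_D f) g = - (n%:R *: cend_prod n.-1 f g).
Proof.
case: n => [|n]; first by rewrite cend_prodDl0 scale0r oppr0.
exact: cend_prodDl.
Qed.

Lemma cend_prodDr_pred n f g :
  cend_prod n f (cend_D g) = cend_D (cend_prod n f g) + n%:R *: cend_prod n.-1 f g.
Proof.
case: n => [|n]; first by rewrite cend_prodDr0 scale0r addr0.
exact: cend_prodDr.
Qed.

Lemma cend_prodD n f f' g : cend_prod n (f + f') g = cend_prod n f g + cend_prod n f' g.
Proof. by have := cend_prod_linl n g 1 f f'; rewrite !scale1r. Qed.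

Lemma cend_prod0 n g : cend_prod n 0 g = 0.
Proof. by have := cend_prod_linl n g (-1) 0 0; rewrite !scaleN1r !addNr. Qed.

Lemma cend_prodZ n z f g : cend_prod n (z *: f) g = z *: cend_prod n f g.
Proof. by have := cend_prod_linl n g z f 0; rewrite !addr0 cend_prod0 addr0. Qed.

HB.instance Definition _ n f :=
  GRing.isLinear.Build k cend cend _ (cend_prod n f) (cend_prod_linr n f).

(** By [cend_ind] in a and then in b, both may be taken free of D: replacing a or b by its image
    under D changes the two sides alike, through absorption identities of binomials. What remains is
    a q^(n) T^m c for b = q, which is [cend_leibniz]. *)
Lemma cend_assocP : assoc_axiom cend_data.
Proof.
move=> n m a b c /=; elim/cend_ind: a n m => [p|a IH|a a' IH IH'] n m; first 1 last.
- rewrite cend_prodDl_pred -scaleN1r !cend_prodZ IH.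
  case: n => [|n].
    by rewrite scale0r scaler0 big_ord1 subnn cend_prodDl0 scaler0.
  rewrite [RHS]big_ord_recr /= subnn cend_prodDl0 scaler0 addr0 scalerA scaler_sumr.
  apply: eq_bigr => -[t /=]; rewrite ltnS => ht _.
  rewrite subSn // cend_prodDl -scaleNr !scalerA; congr (_ *: _).
  have := mul_bin_down n.+1 t; rewrite /= subSn // => h.
  rewrite mulN1r mulrN mulNr -!mulrA; congr (- _).
  by rewrite mulrCA -!natrM h mulnC.
- by rewrite !cend_prodD IH IH' -big_split /=; apply: eq_bigr => t _;
    rewrite cend_prodD scalerDr.
elim/cend_ind: b n m => [q|b IH|b b' IH IH'] n m; first 1 last.
- rewrite cend_prodDr_pred cend_prodD cend_prodDl_pred cend_prodZ !IH.
  under [RHS]eq_bigr do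
    rewrite cend_prodDl_pred linearN linearZ /= natrD scalerDl opprD scalerDr.
  rewrite big_split /=; congr (_ + _).
    rewrite scaler_sumr -sumrN; apply: eq_bigr => t _; rewrite scalerN !scalerA.
    case: m => [|m]; first by rewrite !(mulr0, mul0r) !scale0r.
    by rewrite addSn /=; congr (- (_ *: _)); rewrite mulrC.
  rewrite [RHS]big_ord_recl /= scale0r oppr0 scaler0 add0r.
  case: n => [|n]; first by rewrite scale0r big_ord0.
  rewrite scaler_sumr; apply: eq_bigr => t _.
  rewrite /bump /= add1n subSS addnS /= scalerN !scalerA -scaleNr; congr (_ *: _).
  rewrite exprS mulN1r !mulNr opprK mulrCA -!mulrA; congr (_ * _).
  by rewrite -!natrM [in RHS]mulnC -mul_bin_diag.
- rewrite linearD /= cend_prodD IH IH' -big_split /=; apply: eq_bigr => t _.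
  by rewrite cend_prodD linearD scalerDr.
rewrite !cend_prodC.
under [RHS]eq_bigr do rewrite !cend_prodC scalerAr.
rewrite -mulr_sumr cend_leibniz.
have -> : iter n (@cend_T) (cendC q) = cendC q^`(n).
  by elim: n => //= n ->; rewrite cend_TC.
by rewrite -cendCM cend_prodC cendCM mulrA.
Qed.

Definition cendConf : assocConf k := AssocConf cend_confP cend_assocP.

End Cend.

(** * Normal words form a basis *)

Section NcSeries.
Variables (k : fieldType) (X : choiceType).

(** A series is its coefficient function on words. No support condition is imposed, since only
    single coefficients are ever extracted. *)
Definition ncseries : Type := seq X -> k^o.
HB.instance Definition _ := GRing.Lmodule.on ncseries.
Implicit Types f g h : ncseries.

Definition strip (a : X) f : ncseries := fun s => f (a :: s).

(* Cauchy product over factorizations of the word s, defined by recursion on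
   s so that [strip a] is a twisted derivation. *)
Fixpoint ncmul_at (f g : ncseries) (s : seq X) : k :=
  if s is a :: s' then f [::] * g s + ncmul_at (strip a f) g s' else f [::] * g [::].
Definition ncmul f g : ncseries := ncmul_at f g.
Definition ncone : ncseries := fun s => (s == [::])%:R.
Definition letter (a : X) : ncseries := fun s => (s == [:: a])%:R.

Fact ncmul0l g : ncmul 0 g = 0.
Proof.
apply/funext; elim => [|a s IH]; first by rewrite /ncmul /= mul0r.
by rewrite /ncmul /= mul0r add0r; apply: IH.
Qed.

Fact ncmulDl : left_distributive ncmul +%R.
Proof.
move=> f g h; apply/funext => s; elim: s f g => [|a s IH] f g.
  by rewrite /ncmul /= mulrDl.
rewrite /ncmul /= [RHS]addrACA -mulrDl; congr (_ + _); exact: IH.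
Qed.

Fact ncmulDr : right_distributive ncmul +%R.
Proof.
move=> f g h; apply/funext => s; elim: s f => [|a s IH] f.
  by rewrite /ncmul /= mulrDr.
rewrite /ncmul /= [RHS]addrACA -mulrDr; congr (_ + _); exact: IH.
Qed.

Fact ncmulZl c f g : ncmul (c *: f) g = c *: ncmul f g.
Proof.
apply/funext => s; elim: s f => [|a s IH] f; first exact: esym (mulrA c _ _).
rewrite [RHS](mulrDr c) [in RHS]mulrA; congr (_ + _); exact: IH.
Qed.

Fact ncmulZr c f g : ncmul f (c *: g) = c *: ncmul f g.
Proof.
apply/funext => s; elim: s f => [|a s IH] f; first exact: mulrCA _ c _.
rewrite [RHS](mulrDr c) [in RHS]mulrCA; congr (_ + _); exact: IH.
Qed.

Lemma strip_mul a f g : strip a (ncmul f g) = f [::] *: strip a g + ncmul (strip a f) g.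
Proof. by []. Qed.

Fact ncmulA : associative ncmul.
Proof.
move=> f g h; apply/funext => s; elim: s f g => [|a s IH] f g.
  by rewrite /ncmul /= mulrA.
rewrite -[LHS]/(strip a _ s) -[RHS]/(strip a _ s) !strip_mul !ncmulDl.
rewrite scalerDr scalerA -addrA ncmulZl.
by congr (_ + (_ + _)); apply: IH.
Qed.

Fact ncmul1l : left_id ncone ncmul.
Proof.
move=> g; apply/funext => -[|a s]; first by rewrite /ncmul /= mul1r.
rewrite /ncmul /= mul1r; have -> : strip a ncone = 0 by [].
by rewrite -/(ncmul 0 g s) ncmul0l addr0.
Qed.

Fact ncmul1r : right_id ncone ncmul.
Proof.
move=> f; apply/funext => s; elim: s f => [|a s IH] f; first by rewrite /ncmul /= mulr1.
by rewrite /ncmul /= mulr0 add0r; apply: IH.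
Qed.

Fact ncone_neq0 : ncone != 0.
Proof.
by apply/eqP => /(congr1 (fun f : ncseries => f [::])) /eqP; rewrite /ncone eqxx oner_eq0.
Qed.

HB.instance Definition _ := GRing.Zmodule_isNzRing.Build ncseries
  ncmulA ncmul1l ncmul1r ncmulDl ncmulDr ncone_neq0.

Fact ncscaleAl (c : k) f g : c *: (f * g) = (c *: f) * g.
Proof. by rewrite [RHS]ncmulZl. Qed.
HB.instance Definition _ := GRing.Lmodule_isLalgebra.Build k ncseries ncscaleAl.

Fact ncscaleAr (c : k) f g : c *: (f * g) = f * (c *: g).
Proof. by rewrite [RHS]ncmulZr. Qed.
HB.instance Definition _ := GRing.Lalgebra_isAlgebra.Build k ncseries ncscaleAr.

Fact strip_linear a : linear (strip a).
Proof. by []. Qed.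
HB.instance Definition _ a := GRing.isLinear.Build k ncseries ncseries _
  (strip a) (@strip_linear a).

Lemma strip_letterM a b f : strip a (letter b * f) = if a == b then f else 0.
Proof.
rewrite [LHS]strip_mul {1}/letter /= scale0r add0r.
have -> : strip a (letter b) = if a == b then 1 else 0 :> ncseries.
  apply/funext => s; rewrite /strip /letter eqseq_cons.
  by case: (a == b).
by case: (a == b); [apply: ncmul1l | apply: ncmul0l].
Qed.

Lemma letterM_nil a f : (letter a * f : ncseries) [::] = 0.
Proof. exact: mul0r. Qed.

End NcSeries.

(** * A model that separates normal words *)

Section FreeModel.
Variables (k : fieldType) (B : choiceType).

Local Notation A0 := (ncseries k (B * bool)%type).
Local Notation W := (cend A0).
Local Notation ltr := (@letter k (B * bool)%type).

Definition cstrip (a : B * bool) (w : W) : W := map_poly (map_poly (strip a)) w.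

Lemma coef_cstrip a (w : W) i j :
  (cstrip a w : {poly {poly A0}})`_i`_j = strip a (w : {poly {poly A0}})`_i`_j.
Proof. by rewrite /cstrip !coef_map. Qed.

Lemma cend_eqP (w w' : W) :
  (forall i j, (w : {poly {poly A0}})`_i`_j = (w' : {poly {poly A0}})`_i`_j) -> w = w'.
Proof. by move=> h; apply/polyP => i; apply/polyP => j; apply: h. Qed.

Lemma coef_cendCM (p : {poly A0}) (w : W) i :
  (cendC p * w : {poly {poly A0}})`_i = p * (w : {poly {poly A0}})`_i.
Proof. exact: coefCM. Qed.

Fact cstrip_linear a : linear (cstrip a).
Proof.
move=> c u v; apply: cend_eqP => i j; rewrite coef_cstrip.
rewrite [in LHS]coefD [in RHS]coefD !cend_scaleE !coef_cendCM !(coefD, coefCM) !coef_cstrip.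
by rewrite linearD /= -!scalerAl !mul1r.
Qed.
HB.instance Definition _ a := GRing.isLinear.Build k W W _ (cstrip a) (@cstrip_linear a).

Lemma cstripD a u v : cstrip a (u + v) = cstrip a u + cstrip a v.
Proof. exact: linearD. Qed.

Lemma cend_T0 : cend_T (0 : W) = 0.
Proof. exact: linear0. Qed.

Lemma cstrip_letter a b (w : W) :
  cstrip a (cendC (ltr b)%:P * w) = if a == b then w else 0.
Proof.
apply: cend_eqP => i j; rewrite coef_cstrip coef_cendCM coefCM strip_letterM.
by case: (a == b); rewrite // !coef0.
Qed.

Definition xmul (w : W) : W := cendC 'X * w.

Lemma cstrip_xmul a w : cstrip a (xmul w) = xmul (cstrip a w).
Proof.
apply: cend_eqP => i j; rewrite coef_cstrip !coef_cendCM !coefXM coef_cstrip.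
by case: (j == 0)%N; rewrite ?linear0.
Qed.

Lemma xmul0 : xmul 0 = 0.
Proof. exact: mulr0. Qed.

(* P_b + x Q_b, with free letters P_b = (b, false) and Q_b = (b, true). Being of
   degree 1 in x, it has locality 2, and the two letters record the index n of b_(n). *)
Definition fgenW (b : B) : W :=
  cendC ((ltr (b, false))%:P + 'X * (ltr (b, true))%:P).

Lemma fgenWM b w :
  fgenW b * w = cendC (ltr (b, false))%:P * w + xmul (cendC (ltr (b, true))%:P * w).
Proof.
rewrite /fgenW /xmul mulrA -cendCM -mulrDl; congr (_ * w).
exact: polyCD.
Qed.

Lemma fgenW_T b w : cend_T (fgenW b * w) =
  cendC (ltr (b, true))%:P * w + fgenW b * cend_T w.
Proof.
rewrite /fgenW cend_TM derivD derivM derivX !derivC mulr0 mul1r addr0 add0r.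
by [].
Qed.

Lemma fgenW_locality : @locality_le k B 2 (cendConf A0) fgenW.
Proof.
move=> a b n hn /=; rewrite cend_prodC -[fgenW b]mulr1.
suff -> : iter n (@cend_T k A0) (fgenW b * 1) = 0 by rewrite mulr0.
rewrite -(subnK hn) iterD /= fgenW_T -[1]/(cendC 1) cend_TC derivC [X in _ + X]mulr0 addr0.
by rewrite cend_TM derivC cend_TC derivC mul0r mulr0 addr0 linear0.
Qed.

Lemma cstrip_fgenF b c w : cstrip (c, false) (fgenW b * w) = if c == b then w else 0.
Proof.
rewrite fgenWM linearD /= cstrip_xmul !cstrip_letter !xpair_eqE !andbT andbF.
by rewrite /xmul mulr0 addr0.
Qed.

Lemma cstrip_fgenT b c w : cstrip (c, true) (fgenW b * w) = if c == b then xmul w else 0.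
Proof.
rewrite fgenWM linearD /= cstrip_xmul !cstrip_letter !xpair_eqE !andbT andbF.
by case: ifP => _; rewrite add0r // /xmul mulr0.
Qed.

Lemma xmul_linear : linear xmul.
Proof. by move=> c u v; rewrite /xmul mulrDr scalerAr. Qed.
HB.instance Definition _ := GRing.isLinear.Build k W W _ xmul xmul_linear.

(* On T^m (fgenW c * z) with m < 2, the map [wnext n d] returns z if (n, d) = (m, c)
   and 0 otherwise. *)
Definition wnext (n : nat) (d : B) (Z : W) : W :=
  let Z1 := cstrip (d, true) Z - xmul (cstrip (d, false) Z) in
  if n == 0%N then cstrip (d, false) Z - cend_T Z1 else Z1.

Fact wnext_linear n d : linear (wnext n d).
Proof.
move=> c u v; have h : cstrip (d, true) (c *: u + v) - xmul (cstrip (d, false) (c *: u + v)) =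
    c *: (cstrip (d, true) u - xmul (cstrip (d, false) u)) +
    (cstrip (d, true) v - xmul (cstrip (d, false) v)).
  by rewrite !linearP /= addrACA -scalerDr.
rewrite /wnext /=; case: ifP => _ //.
by rewrite h !linearP /= addrACA -scalerDr.
Qed.
HB.instance Definition _ n d := GRing.isLinear.Build k W W _ (wnext n d) (@wnext_linear n d).

(** For m = 0 the Q-part and the P-part of the argument are x z and z, so [Z1], the Q-part minus x
    times the P-part, is 0. For m = 1 they are z + x T z and T z, so [Z1] = z; subtracting T [Z1]
    from the P-part then leaves z for m = 0 and 0 for m = 1. *)
Lemma wnextE (n m : 'I_2) c d z :
  wnext n d (iter m (@cend_T k A0) (fgenW c * z)) =
  if (n == m) && (d == c) then z else 0.
Proof.
case: n m => [[|[]]// ?] [[|[]]// ?]; rewrite /wnext -val_eqE /= ?fgenW_T ?cstripD;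
  rewrite !(cstrip_fgenF, cstrip_fgenT, cstrip_letter) ?xpair_eqE ?andbT ?andbF;
  case: eqP => _; rewrite ?(add0r, addr0, subr0, oppr0, xmul0, cend_T0) //.
- by rewrite subrr cend_T0 subr0.
- by rewrite addrK subrr.
- by rewrite subrr.
- by rewrite addrK.
Qed.

Lemma cstrip_D a w : cstrip a (cend_D w) = cend_D (cstrip a w).
Proof.
apply: cend_eqP => i j; rewrite coef_cstrip ![(cend_D _)`_i]coefXM.
by case: i => [|i] /=; [rewrite !coef0 linear0 | rewrite coef_cstrip].
Qed.

Lemma cstrip_D1 a i : cstrip a (iter i (@cend_D k A0) 1) = 0.
Proof.
elim: i => [|i IH]; last by rewrite iterS cstrip_D IH linear0.
have strip1 : strip a (1 : A0) = 0 by [].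
rewrite /cstrip /= -[1 in LHS]/(1%:P%:P) map_polyC /= map_polyC /=.
by rewrite strip1 !polyC0.
Qed.

Lemma wnext_D1 n d i : wnext n d (iter i (@cend_D k A0) 1) = 0.
Proof. by rewrite /wnext !cstrip_D1 xmul0 subr0 cend_T0 subr0; case: ifP. Qed.

Definition whead (p : Defs.prefix B 2) (l : B * nat) : B := if p is (b, _) :: _ then b else l.1.

(** The image of a normal word with its first letter split off. The split is made there because T^n
    acts on the letter that follows, so that [wnext] recognises n and that letter together. *)
Fixpoint zeta (p : Defs.prefix B 2) (l : B * nat) : W :=
  if p is (_, n) :: p' then iter n (@cend_T k A0) (fgenW (whead p' l) * zeta p' l)
  else iter l.2 (@cend_D k A0) 1.

(** Decodes [zeta] from the left. The last step reads the coefficient of D^i at x^0 and at the empty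
    word in the letters. *)
Fixpoint wdec (p : Defs.prefix B 2) (l : B * nat) (Z : W) : k :=
  if p is (_, n) :: p' then wdec p' l (wnext n (whead p' l) Z)
  else (Z : {poly {poly A0}})`_l.2`_0 [::].

Definition wdual (u : word B 2) (w : W) : k :=
  wdec u.1 u.2 (cstrip (whead u.1 u.2, false) w).

Lemma wdec_lin p l c Z Z' : wdec p l (c *: Z + Z') = c * wdec p l Z + wdec p l Z'.
Proof.
elim: p Z Z' => [|[b n] p IH] Z Z' /=; last by rewrite linearP IH.
rewrite !coefD cend_scaleE coef_cendCM coefCM.
by rewrite -scalerAl mul1r.
Qed.

Lemma wdec0 p l : wdec p l 0 = 0.
Proof. by have := wdec_lin p l (-1) 0 0; rewrite scaler0 addr0 mulN1r addNr. Qed.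

Lemma wdual_lin u c w w' : wdual u (c *: w + w') = c * wdual u w + wdual u w'.
Proof. by rewrite /wdual linearP wdec_lin. Qed.

Lemma wdual0 u : wdual u 0 = 0.
Proof. by rewrite /wdual linear0 wdec0. Qed.

(** At x^0 every summand begins with a letter P or Q, so a word that is too long is invisible to the
    last step of [wdec]. *)
Lemma iterT_fgen_nil (n : 'I_2) c z i :
  (iter n (@cend_T k A0) (fgenW c * z) : {poly {poly A0}})`_i`_0 [::] = 0.
Proof.
have h w : (fgenW c * w : {poly {poly A0}})`_i`_0 [::] = 0.
  rewrite fgenWM coefD coefD !coef_cendCM coefXM coefCM eqxx addr0.
  exact: letterM_nil.
case: n => [[|[]]// ?] /=; first exact: h.
rewrite fgenW_T coefD coefD -[LHS]/(_ + _) h addr0 coef_cendCM coefCM.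
exact: letterM_nil.
Qed.

Lemma wdec_zeta p l p' l' : whead p l = whead p' l' ->
  wdec p l (zeta p' l') = ((p, l) == (p', l'))%:R.
Proof.
elim: p p' => [|[b n] p IH] [|[b' n'] p'] /=.
- case: l l' => b i [b' i'] /= ->; rewrite !xpair_eqE eqxx /=.
  have -> : iter i' (@cend_D k A0) 1 = 'X^i' :> {poly {poly A0}}.
    elim: i' => [|i' IH] /=; first by rewrite expr0.
    by rewrite IH /cend_D exprS.
  by rewrite coefXn coefMn coef1 !eqxx; case: (i == i').
- by move=> _; rewrite iterT_fgen_nil.
- by move=> _; rewrite wnext_D1 wdec0.
- move=> ->; rewrite wnextE; case: ifP => [/andP[/eqP-> /eqP h]|h].
    by rewrite IH // !xpair_eqE eqseq_cons eqxx.
  by rewrite wdec0; case: eqP => // -[en ep el]; rewrite en ep el !eqxx in h.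
Qed.

Definition free_hom (A : assocConf k) (N : nat) (e : B -> A)
    (l : locality_le N e) :
  freeConf k B N -> A := projT1 (cid (free_lift l)).

Lemma free_homP (A : assocConf k) N (e : B -> A) (l : locality_le N e) : conf_hom (free_hom l).
Proof. by rewrite /free_hom; case: cid => ? [[]]. Qed.

Lemma free_hom_gen (A : assocConf k) N (e : B -> A) (l : locality_le N e) b :
  free_hom l (gen k N b) = e b.
Proof. by rewrite /free_hom; case: cid => ? [[]]. Qed.

Definition psi : freeConf k B 2 -> cendConf A0 := free_hom fgenW_locality.

Lemma psi_hom : conf_hom psi.
Proof. exact: (free_homP fgenW_locality). Qed.

Lemma psi_nword (u : word B 2) : psi (nword k u) = fgenW (whead u.1 u.2) * zeta u.1 u.2.
Proof.
case: u => p l; have h := psi_hom.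
elim: p => [|[b n] p IH] /=.
  rewrite /nword /=; case: l => b i /=; elim: i => [|i IH] /=.
    rewrite mulr1; exact: (free_hom_gen fgenW_locality b).
  rewrite -[psi _]/(psi (confD _)) (conf_homD h) IH /=.
  exact: cend_DMC.
rewrite -[LHS]/(psi (gen k 2 b *_(n) nword k (p, l))) (conf_homM h) IH /=.
rewrite [psi _](free_hom_gen fgenW_locality b); exact: cend_prodC.
Qed.

Lemma wdual_nword (u v : word B 2) : wdual u (psi (nword k v)) = (u == v)%:R.
Proof.
rewrite psi_nword /wdual cstrip_fgenF; case: eqP => [h|h].
  by rewrite wdec_zeta //; case: u v {h} => ? ? [].
by rewrite wdec0; case: eqP h => // ->.
Qed.

End FreeModel.

(** * Finite supports, spans and bases *)

Section Bases.
Variables (k : fieldType) (V : lmodType k) (I : choiceType).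
Implicit Types (e : I -> V) (c : I -> k).

Lemma k_comb_seq e c (s : seq I) : uniq s -> (forall i, c i != 0 -> i \in s) ->
  k_comb c e = \sum_(i <- s) c i *: e i.
Proof.
move=> us hs; rewrite /k_comb -(fsbig_widen [set` s] [set: I]) //.
  by rewrite -fsbig_seq.
by move=> i [_ hi]; have [c0|/hs /hi //] := eqVneq (c i) 0; rewrite /= c0 scale0r.
Qed.

Lemma fin_supp_seq (M : nmodType) (s : seq I) (c : I -> M) : (forall i, c i != 0 -> i \in s) -> fin_supp c.
Proof.
by move=> h; apply: (sub_finite_set _ (finite_seq s)) => i /= /h.
Qed.

Lemma fin_supp_ex (M : nmodType) (c : I -> M) : fin_supp c ->
  exists2 s : seq I, uniq s & forall i, c i != 0 -> i \in s.
Proof.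
move=> /finite_seqP[s hs]; exists (undup s); first exact: undup_uniq.
by move=> i hi; rewrite mem_undup; have : [set` s] i by rewrite -hs.
Qed.

(** The predicate P carries the side condition of each use: the length of words in [len_span], their
    order in [below], a bound on leading words in [Sword_le]. *)
Definition spans (P : I -> Prop) e (x : V) :=
  exists2 r : seq (k * I), (forall y, y \in r -> P y.2) & x = \sum_(y <- r) y.1 *: e y.2.

Lemma spans0 P e : spans P e 0.
Proof. by exists [::]; rewrite ?big_nil. Qed.

Lemma spansD P e x y : spans P e x -> spans P e y -> spans P e (x + y).
Proof.
move=> [r hr ->] [r' hr' ->]; exists (r ++ r'); last by rewrite big_cat.
by move=> z; rewrite mem_cat => /orP[/hr|/hr'].
Qed.

Lemma spansZ P e a x : spans P e x -> spans P e (a *: x).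
Proof.
move=> [r hr ->]; exists [seq (a * y.1, y.2) | y <- r].
  by move=> _ /mapP[y /hr hy ->].
by rewrite big_map scaler_sumr; apply: eq_bigr => y _; rewrite scalerA.
Qed.

Lemma spansN P e x : spans P e x -> spans P e (- x).
Proof. by move=> h; rewrite -scaleN1r; apply: spansZ. Qed.

Lemma spans_elt (P : I -> Prop) e i : P i -> spans P e (e i).
Proof.
move=> hi; exists [:: (1, i)]; last by rewrite big_seq1 scale1r.
by move=> y; rewrite inE => /eqP ->.
Qed.

Lemma spans_sum P e (T : Type) (r : seq T) (Q : pred T) (F : T -> V) :
  (forall i, Q i -> spans P e (F i)) -> spans P e (\sum_(i <- r | Q i) F i).
Proof.
by move=> h; apply: big_ind => //; [apply: spans0 | move=> x y; apply: spansD].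
Qed.

Lemma spansW (P Q : I -> Prop) e x : (forall i, P i -> Q i) -> spans P e x -> spans Q e x.
Proof. by move=> h [r hr ->]; exists r => // y /hr/h. Qed.

Lemma is_k_basisP e : (forall x, spans (fun=> True) e x) ->
  (forall c (s : seq I), uniq s -> (forall i, c i != 0 -> i \in s) ->
     \sum_(i <- s) c i *: e i = 0 -> forall i, c i = 0) ->
  is_k_basis e.
Proof.
move=> sp ind x; have [r _ ->] := sp x.
(* The list r may repeat an index, so the coefficients of equal indices are collected. *)
pose c i := \sum_(y <- r | y.2 == i) y.1.
pose s := undup (map snd r).
have cs i : c i != 0 -> i \in s.
  rewrite mem_undup => ci; apply: contraNT ci => hi.
  rewrite /c big_seq_cond big1 // => y /andP[yr /eqP yi].
  by case/negP: hi; rewrite -yi; apply: map_f.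
exists c; split.
  split; first exact: fin_supp_seq cs.
  rewrite (k_comb_seq _ (undup_uniq _) cs).
  under [RHS]eq_bigr do rewrite /c scaler_suml.
  rewrite (exchange_big_dep xpredT) //= big_seq [RHS]big_seq; apply: eq_bigr => y yr.
  rewrite big_mkcond /= (bigD1_seq y.2) ?undup_uniq ?mem_undup ?map_f //= eqxx.
  rewrite big1 ?addr0 // => i hi; rewrite eq_sym.
  by case: ifP hi => // ->.
move=> c' [hc' ex]; have [s' us' hs'] := fin_supp_ex hc'.
have cs2 i : c i - c' i != 0 -> i \in undup (s ++ s').
  rewrite mem_undup mem_cat => h; apply/orP; have [c0|/cs] := eqVneq (c i) 0; last by left.
  by right; apply: hs'; apply: contraNneq h => ->; rewrite c0 subrr.
apply/funext => i; apply/eqP; rewrite -subr_eq0; apply/eqP.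
apply: (ind (fun i => c i - c' i) _ (undup_uniq _) cs2).
under eq_bigr do rewrite scalerBl.
rewrite sumrB -!k_comb_seq ?undup_uniq //.
- rewrite -ex (k_comb_seq _ (undup_uniq _) cs).
  under eq_bigr do rewrite /c scaler_suml.
  rewrite (exchange_big_dep xpredT) //= -sumrB big_seq big1 // => y yr.
  rewrite big_mkcond /= (bigD1_seq y.2) ?undup_uniq ?mem_undup ?map_f //= eqxx.
  rewrite big1 ?addr0 ?subrr // => j hj; rewrite eq_sym.
  by case: ifP hj => // ->.
- by move=> j hj; rewrite mem_undup mem_cat hs' ?orbT.
- by move=> j hj; rewrite mem_undup mem_cat cs.
Qed.

End Bases.

Lemma linear_sumZ (k : fieldType) (V V' : lmodType k) (phi : V -> V') (T : Type)
    (r : seq T) (c : T -> k) (f : T -> V) : linear phi ->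
  phi (\sum_(y <- r) c y *: f y) = \sum_(y <- r) c y *: phi (f y).
Proof.
move=> lin; elim: r => [|y r IH]; last by rewrite !big_cons lin IH.
by rewrite !big_nil; have := lin (-1) 0 0; rewrite scaler0 addr0 scaleN1r addNr.
Qed.

Lemma spans_map (k : fieldType) (V V' : lmodType k) (I I' : choiceType)
    (e : I -> V) (e' : I' -> V') (P : I -> Prop) (Q : I' -> Prop) (phi : V -> V') :
  linear phi -> (forall i, P i -> spans Q e' (phi (e i))) ->
  forall x, spans P e x -> spans Q e' (phi x).
Proof.
move=> lin h x [r hr ->].
have phi0 : phi 0 = 0.
  by have := lin (-1) 0 0; rewrite scaler0 addr0 scaleN1r addNr.
elim: r hr => [|y r IH] hr; first by rewrite big_nil phi0; apply: spans0.
rewrite big_cons lin; apply: spansD.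
  by apply/spansZ/h/hr; rewrite mem_head.
by apply: IH => z hz; apply: hr; rewrite inE hz orbT.
Qed.

(** * Normal words span C(B, N) *)

Section Spanning.
Variables (k : fieldType) (B : choiceType) (N : nat).
Local Notation C := (freeConf k B N).
Local Notation nw := (@nword k B N).
Implicit Types u v : word B N.

(** Length survives the rewriting of b_(n) with n >= N. Later this shows that such products only
    produce words of the same length, which can be compared by their first letters. *)
Definition len_span (j : nat) : C -> Prop := spans (fun u => size u.1 = j) nw.

Lemma conf_lin (A : assocConf k) n (a : A) : linear (confp n a).
Proof. by move=> c x y; rewrite confpDr_add confpZr. Qed.

Lemma confD_linear (A : assocConf k) : linear (@confD k A).
Proof. by move=> c x y; rewrite confDD confDZ. Qed.

Lemma len_span_gen (j n : nat) b x : (n < N)%N ->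
  len_span j x -> len_span j.+1 (gen k N b *_(n) x).
Proof.
move=> hn; apply: (spans_map (@conf_lin _ n _)) => u hu.
apply: (@spans_elt _ _ _ _ nw ((b, Ordinal hn) :: u.1, u.2)) => /=.
by rewrite hu.
Qed.

Lemma len_span_D j x : len_span j x -> len_span j (confD x).
Proof.
apply: (spans_map (@confD_linear _)) => -[p l] /= <- {j}.
elim: p => [|[b n] p IH].
  by case: l => b i; apply: (@spans_elt _ _ _ _ nw ([::], (b, i.+1))).
rewrite /nword [X in spans _ _ X](confD_prod (assoc_confP C)); apply: spansD; last exact: len_span_gen.
case: n => -[|n] hn.
  by rewrite [X in spans _ _ X](confpDl0 (assoc_confP C)); apply: spans0.
rewrite [X in spans _ _ X](confpDl (assoc_confP C)) //; apply/spansN/spansZ/len_span_gen; first exact: ltnW.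
exact: (@spans_elt _ _ _ _ nw (p, l)).
Qed.

(* 0 = (b_(n) c)_(m) x for n >= N expresses b_(n) (c_(m) x) through smaller n. *)
Lemma len_span_mul j n b x : len_span j x -> len_span j.+1 (gen k N b *_(n) x).
Proof.
elim: j n b x => [|j IH] n b.
  apply: (spans_map (@conf_lin _ n _)) => -[[|? ?] [c i]] //= _; elim: i n => [|i IH] n.
    have [hn|hn] := ltnP n N; last by rewrite [X in spans _ _ X]gen_locality //; apply: spans0.
    apply: (@len_span_gen 0) => //.
    exact: (@spans_elt _ _ _ _ nw ([::], (c, 0%N))).
  rewrite /nword [X in spans _ _ X](@confpDr _ C).
  by apply: spansD; [apply: len_span_D | apply: spansZ]; apply: IH.
move: n b; elim/ltn_ind => n IHn b.
have [hn|hn] := ltnP n N; first by move=> x; apply: len_span_gen.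
apply: (spans_map (@conf_lin _ n _)) => -[[|[c m] p] l] //= [hp].
have hw : len_span j (nword k (p, l)) by apply: (@spans_elt _ _ _ _ nw (p, l)).
have := @assoc_assocP _ C n m (gen k N b) (gen k N c) (nword k (p, l)).
rewrite gen_locality // confp0l big_ord_recl /= expr0 bin0 mul1r scale1r subn0 addn0.
move/esym/eqP; rewrite addr_eq0 => /eqP ->; apply/spansN/spans_sum => t _.
apply/spansZ/IHn; first by have := ltn_ord t; rewrite /bump /=; lia.
exact: IH.
Qed.

Lemma spans_nword (x : C) : spans (fun=> True) nw x.
Proof.
elim/fclW: x => s; rewrite fcl_teval.
have W j y : len_span j y -> spans (fun=> True) nw y by apply: spansW.
have hgen n b y : spans (fun=> True) nw y -> spans (fun=> True) nw (gen k N b *_(n) y).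
  apply: (spans_map (@conf_lin _ n _)) => u _.
  exact/W/len_span_mul/(@spans_elt _ _ _ (fun v => size v.1 = size u.1)).
have hD y : spans (fun=> True) nw y -> spans (fun=> True) nw (confD y).
  apply: (spans_map (@confD_linear _)) => u _.
  exact/W/len_span_D/(@spans_elt _ _ _ (fun v => size v.1 = size u.1)).
elim: s => [b||s IHs t IHt|c s IHs|s IHs|n s IHs t IHt] /=.
- exact: (@spans_elt _ _ _ _ nw ([::], (b, 0%N))).
- exact: spans0.
- exact: spansD.
- exact: spansZ.
- exact: hD.
have lin : linear (fun x : C => x *_(n) teval (@gen k B N) t).
  by move=> c x y; rewrite confpDl_add confpZl.
apply: (spans_map lin) IHs => -[p [b i]] _.
(* The left factor is now a normal word; associativity peels off its letters one at a time. *)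
elim: p n {lin} => [|[c m] p IH] n.
  elim: i n => [|i IH] n; first exact: hgen.
  rewrite /nword /=; case: n => [|n].
    by rewrite [X in spans _ _ X](confpDl0 (assoc_confP C)); apply: spans0.
  by rewrite [X in spans _ _ X](confpDl (assoc_confP C)) //; apply/spansN/spansZ/IH.
rewrite /nword /= [X in spans _ _ X](@assoc_assocP _ C); apply: spans_sum => t' _.
exact/spansZ/hgen/IH.
Qed.

End Spanning.

(** * Coordinates in the basis of normal words *)

Section NwordBasis.
Variables (k : fieldType) (B : choiceType).
Local Notation C := (freeConf k B 2).
Local Notation nw := (@nword k B 2).
Implicit Types u v : word B 2.

Lemma wdual_sum u (T : Type) (r : seq T) (a : T -> k) (f : T -> C) :
  wdual u (psi (\sum_(y <- r) a y *: f y)) = \sum_(y <- r) a y * wdual u (psi (f y)).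
Proof.
rewrite (linear_sumZ _ _ _ (conf_hom_lin (@psi_hom k B))).
elim: r => [|y r IH]; last by rewrite !big_cons wdual_lin IH.
by rewrite !big_nil; exact: wdual0.
Qed.

(** Spanning is [spans_nword]; independence follows by applying to a relation the functionals
    [wdual u] after [psi], which are dual to the normal words. *)
Theorem nword_basis : is_k_basis nw.
Proof.
apply: is_k_basisP; first exact: spans_nword.
move=> c s us cs h0 u; have := wdual_sum u s c nw.
have [//|cu] := eqVneq (c u) 0; have us' := cs _ cu.
rewrite h0 (bigD1_seq u) //= wdual_nword eqxx mulr1 big1 ?addr0.
  by move=> <-; have := wdual_sum u [::] c nw; rewrite !big_nil.
by move=> v vu; rewrite wdual_nword eq_sym (negPf vu) mulr0.
Qed.

(** Replaces the coordinates, which are defined by choice, by an explicit linear functional. *)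
Lemma coordsE u (f : C) : coords f u = wdual u (psi f).
Proof.
have [c [[fc ec] uc]] := nword_basis f.
have [fc' ec'] : [set c : word B 2 -> k | fin_supp c /\ f = k_comb c nw] (coords f).
  by rewrite /coords; apply: xgetPex; exists c.
rewrite [in RHS]ec'; have [s us hs] := fin_supp_ex fc'.
rewrite (k_comb_seq _ us hs) wdual_sum.
have [us'|us'] := boolP (u \in s).
  rewrite (bigD1_seq u) //= wdual_nword eqxx mulr1 big1 ?addr0 // => v vu.
  by rewrite wdual_nword eq_sym (negPf vu) mulr0.
rewrite big_seq big1 => [|v vs]; first by apply/eqP; apply: contraNT us' => /hs.
by rewrite wdual_nword; case: eqP us' vs => [->/negP//|_ _ _]; rewrite mulr0.
Qed.

Lemma coords_nword u v : coords (nw v) u = (u == v)%:R.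
Proof. by rewrite coordsE wdual_nword. Qed.

Lemma coords_lin u c (f g : C) : coords (c *: f + g) u = c * coords f u + coords g u.
Proof.
by rewrite !coordsE (conf_hom_lin (@psi_hom k B)) wdual_lin.
Qed.

Lemma coords0 u : coords (0 : C) u = 0.
Proof. by have := coords_lin u (-1) 0 0; rewrite scaler0 addr0 mulN1r addNr. Qed.

Lemma coordsD u (f g : C) : coords (f + g) u = coords f u + coords g u.
Proof. by have := coords_lin u 1 f g; rewrite scale1r mul1r. Qed.

Lemma spans_occurs (P : word B 2 -> Prop) (f : C) u : spans P nw f -> occurs u f -> P u.
Proof.
move=> [r hr ->]; rewrite /occurs => h; have [[a v] vr /= vu] : exists2 y, y \in r & y.2 = u.
  apply: contrapT => H; case/negP: h; rewrite coordsE wdual_sum big_seq big1 // => y yr.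
  rewrite wdual_nword; case: eqP => [e|]; rewrite ?mulr0 //.
  by case: H; exists y.
by rewrite -vu; apply: (hr _ vr).
Qed.

Lemma nword_inj : injective nw.
Proof.
move=> u v h; have := coords_nword u u; rewrite h coords_nword eqxx.
by case: eqP => // _ /esym /eqP; rewrite oner_eq0.
Qed.

End NwordBasis.

(** * Leading words *)

Section Leading.
Variables (k : fieldType) (B : choiceType) (ltB : rel B).
Hypotheses (ltB_irr : irreflexive ltB) (ltB_trans : transitive ltB).
Local Notation C := (freeConf k B 2).
Local Notation nw := (@nword k B 2).
Local Notation "u <w v" := (@word_lt B 2 ltB u v) (at level 70).
Implicit Types u v w : word B 2.

Lemma wt_lt_irr (p : Defs.prefix B 2) x : wt_lt ltB p x p x = false.
Proof.
elim: p => [|[b n] p IH] /=; first by rewrite ltB_irr ltnn andbF.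
by rewrite ltB_irr ltnn IH !andbF.
Qed.

Lemma word_lt_irr u : (u <w u) = false.
Proof. by rewrite /word_lt ltnn wt_lt_irr andbF. Qed.

Lemma wt_lt_trans (p q r : Defs.prefix B 2) x y z :
  size p = size q -> size q = size r ->
  wt_lt ltB p x q y -> wt_lt ltB q y r z -> wt_lt ltB p x r z.
Proof.
elim: p q r => [|[b n] p IH] [|[c m] q] [|[d l] r] //=.
  move=> _ _ /orP[h|/andP[/eqP h h']] /orP[g|/andP[/eqP g g']].
  - by rewrite (ltB_trans h g).
  - by rewrite -g h.
  - by rewrite h g.
  - by rewrite h g eqxx (ltn_trans h' g') orbT.
move=> [e1] [e2] /orP[h|/andP[/eqP h h']] /orP[g|/andP[/eqP g g']].
- by rewrite (ltB_trans h g).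
- by rewrite -g h.
- by rewrite h g.
rewrite h g eqxx /=; apply/orP; right.
case/orP: h' => [h'|/andP[/eqP -> h']]; case/orP: g' => [g'|/andP[/eqP <- g']].
- by rewrite (ltn_trans h' g').
- by rewrite h'.
- by rewrite g'.
- by rewrite eqxx (IH _ _ e1 e2 h' g') orbT.
Qed.

Lemma word_lt_trans : transitive (@word_lt B 2 ltB).
Proof.
move=> v u w; rewrite /word_lt /wsize /= !eqSS !ltnS.
move=> /orP[h|/andP[/eqP h h']] /orP[g|/andP[/eqP g g']].
- by rewrite (ltn_trans h g).
- by rewrite -g h.
- by rewrite h g.
- by rewrite h g eqxx (wt_lt_trans h g h' g') orbT.
Qed.

Lemma word_le_anti u v : word_le ltB u v -> word_le ltB v u -> u = v.
Proof.
move=> /orP[/eqP//|h] /orP[/eqP//|g].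
by have := word_lt_trans h g; rewrite word_lt_irr.
Qed.

Lemma word_lt_wpre p u v : u <w v -> wpre p u <w wpre p v.
Proof.
rewrite /word_lt /wsize /= !size_cat !eqSS !eqn_add2l !ltnS !ltn_add2l.
move=> /orP[->//|/andP[-> h]]; apply/orP; right; apply/andP; split=> //.
by elim: p => //= -[b n] p ->; rewrite !eqxx !orbT.
Qed.

Lemma leadP u (f : C) : occurs u f -> (forall v, occurs v f -> word_le ltB v u) ->
  lead ltB f = Some u.
Proof.
move=> h1 h2; apply: xget_unique => // -[v [g1 g2]|f0].
  by congr Some; apply: word_le_anti; [apply: h2 | apply: g2].
by move: h1; rewrite /occurs f0 coords0 eqxx.
Qed.

(** Phrased by [spans] rather than by [occurs], so that it passes through linear maps such as
    [act p]. *)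
Definition below u (r : C) : Prop := spans (fun v => v <w u) nw r.

Lemma coords_below u r : below u r -> coords r u = 0.
Proof.
move=> h; apply/eqP; rewrite -[_ == _]negbK; apply/negP => /(spans_occurs h).
by rewrite word_lt_irr.
Qed.

Lemma coords_lead a u r : below u r -> coords (a *: nw u + r) u = a.
Proof. by move=> h; rewrite coords_lin coords_nword eqxx mulr1 coords_below ?addr0. Qed.

Lemma lead_nword a u r : a != 0 -> below u r -> lead ltB (a *: nw u + r) = Some u.
Proof.
move=> a0 h; apply: leadP; first by rewrite /occurs coords_lead.
move=> v; rewrite /occurs coords_lin coords_nword /word_le.
case: (v == u) => [//|]; rewrite mulr0 add0r => hv.
by rewrite (spans_occurs h hv) orbT.
Qed.

Lemma lead_nword1 u r : below u r -> lead ltB (nw u + r) = Some u.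
Proof. by move=> h; rewrite -[nw u]scale1r; apply: lead_nword h; rewrite oner_eq0. Qed.

Lemma act_nword p u : act p (nw u) = nw (wpre p u).
Proof. by rewrite /nword /= /act foldr_cat. Qed.

Lemma act_lin p : linear (@act k B 2 p).
Proof. by elim: p => // -[b n] p IH c x y; rewrite /= IH; exact: (@conf_lin k C). Qed.

Lemma below_act p u r : below u r -> below (wpre p u) (act p r).
Proof.
apply: (spans_map (@act_lin p)) => v hv.
by rewrite act_nword; apply: spans_elt; apply: word_lt_wpre.
Qed.

Lemma below_elt u v : v <w u -> below u (nw v).
Proof. exact: (@spans_elt _ _ _ (fun w => w <w u)). Qed.

Lemma word_lt_size u v : (size u.1 < size v.1)%N -> u <w v.
Proof. by rewrite /word_lt /wsize ltnS => ->. Qed.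

Lemma word_lt_ltB b c n m p q x y : ltB b c -> size p = size q ->
  ((b, n) :: p, x) <w ((c, m) :: q, y).
Proof. by move=> h e; rewrite /word_lt /wsize /= e ltnn eqxx h. Qed.

Lemma word_lt_ltn b (n m : 'I_2) p q x y : (n < m)%N -> size p = size q ->
  ((b, n) :: p, x) <w ((b, m) :: q, y).
Proof. by move=> h e; rewrite /word_lt /wsize /= e ltnn !eqxx h orbT. Qed.

Lemma trivial_mod0 S : trivial_mod ltB S (0 : C).
Proof. by exists [::]; rewrite ?big_nil. Qed.

End Leading.

(** * The S_1-words of the loop Virasoro algebra *)

Section ConfIdentities.
Variables (k : fieldType) (A : assocConf k).
Implicit Types a b c : A.

Lemma confpNr n a b : a *_(n) (- b) = - (a *_(n) b).
Proof. by rewrite -scaleN1r confpZr scaleN1r. Qed.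

Lemma confpNl n a b : (- a) *_(n) b = - (a *_(n) b).
Proof. by rewrite -scaleN1r confpZl scaleN1r. Qed.

Lemma confpBr n a b b' : a *_(n) (b - b') = a *_(n) b - a *_(n) b'.
Proof. by rewrite confpDr_add confpNr. Qed.

Lemma confpBl n a a' b : (a - a') *_(n) b = a *_(n) b - a' *_(n) b.
Proof. by rewrite confpDl_add confpNl. Qed.

Lemma confDN a : confD (- a) = - confD a.
Proof. by rewrite -scaleN1r confDZ scaleN1r. Qed.

Lemma confDB a b : confD (a - b) = confD a - confD b.
Proof. by rewrite confDD confDN. Qed.

Lemma confDn_linear t : linear (@confDn k A t).
Proof. by elim: t => // t IH c x y; rewrite /= IH confDD confDZ. Qed.

Lemma confDnD t a b : confDn t (a + b) = confDn t a + confDn t b.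
Proof. by have := confDn_linear t 1 a b; rewrite !scale1r. Qed.

Lemma confDnB t a b : confDn t (a - b) = confDn t a - confDn t b.
Proof. by have := confDn_linear t (-1) b a; rewrite !scaleN1r ![- _ + _]addrC. Qed.

Lemma assoc_prod0 m a b c : (a *_(0) b) *_(m) c = a *_(0) (b *_(m) c).
Proof.
by rewrite (@assoc_assocP _ A) big_ord1 expr0 mul1r scale1r addn0.
Qed.

Lemma assoc_prod1 m a b c :
  (a *_(1) b) *_(m) c = a *_(1) (b *_(m) c) - a *_(0) (b *_(m.+1) c).
Proof.
rewrite (@assoc_assocP _ A) big_ord_recl big_ord1 /= expr0 mul1r scale1r addn0.
by rewrite expr1 mulr1 scaleN1r addn1.
Qed.

(** Expand (a_(n) b)_(1) c, which is 0 by locality: b_(1+t) c vanishes for t > 0, so only the term t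
    = 0 is left. *)
Lemma local2_prod1 n a b c : local_at 2 a b -> local_at 2 b c -> (2 <= n)%N ->
  a *_(n) (b *_(1) c) = 0.
Proof.
move=> hab hbc hn; have := @assoc_assocP _ A n 1 a b c.
rewrite hab // confp0l big_ord_recl big1 => [|t _].
  by rewrite /= expr0 bin0 mul1r scale1r subn0 addr0 => <-.
by rewrite [b *_(_) c]hbc // confp0r scaler0.
Qed.

(** Expanding (a_(n) b)_(0) c = 0 leaves the terms t = 0 and t = 1, that is a_(n) (b_(0) c) = n
    a_(n-1) (b_(1) c); for n > 2 the right side vanishes by [local2_prod1]. *)
Lemma local2_prod0 n a b c : local_at 2 a b -> local_at 2 b c -> (2 <= n)%N ->
  a *_(n) (b *_(0) c) = if n == 2 then 2%:R *: (a *_(1) (b *_(1) c)) else 0.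
Proof.
move=> hab hbc hn; have := @assoc_assocP _ A n 0 a b c.
rewrite hab // confp0l; case: n hn => [|[|n]] // _.
rewrite 2!big_ord_recl big1 => [|t _].
  rewrite /= /bump /= addr0 expr0 bin0 mul1r scale1r subn0 expr1 bin1 addn0.
  rewrite mulN1r scaleNr => /esym/eqP; rewrite subr_eq0 => /eqP ->.
  case: n => [|n] //.
  by rewrite [X in _ *: X](@local2_prod1 n.+2) // scaler0.
by rewrite [b *_(_) c]hbc // confp0r scaler0.
Qed.

Lemma confDn_prod0 t a b : confDn t (a *_(0) b) = a *_(0) confDn t b.
Proof.
elim: t => //= t ->; rewrite (confD_prod (assoc_confP A)).
by rewrite (confpDl0 (assoc_confP A)) add0r.
Qed.

Lemma confDn_prod1 t a b :
  confDn t (a *_(1) b) = a *_(1) confDn t b - t%:R *: (a *_(0) confDn t.-1 b).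
Proof.
elim: t => [|t /= ->]; first by rewrite scale0r subr0.
rewrite confDB confDZ confpDr scale1r -[confD (a *_(0) _)]/(confDn 1 _) confDn_prod0 /=.
rewrite -addrA; congr (_ + _); case: t => [|t].
  by rewrite scale0r oppr0 scale1r subrr.
by rewrite /= [in RHS]mulrS scalerDl scale1r opprD addrA subrr sub0r.
Qed.

End ConfIdentities.

Section LoopGSB.
Variable k : fieldType.
Local Notation C := (freeConf k int 2).
Local Notation L := (gen k 2 (B := int)).
Local Notation nw := (@nword k int 2).
Local Notation "u <w v" := (@word_lt int 2 loop_lt u v) (at level 70).
Local Notation o0 := (@ord0 1).
Local Notation o1 := (@ord_max 1).

Lemma loop_lt_irr : irreflexive loop_lt.
Proof. by move=> i; rewrite /loop_lt ltxx eqxx ltxx. Qed.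

Lemma loop_lt_trans : transitive loop_lt.
Proof. by move=> j i l; rewrite /loop_lt; lia. Qed.

Lemma loop_lt0 i : i != 0 -> loop_lt 0 i.
Proof. by rewrite /loop_lt; lia. Qed.

Local Notation irr := loop_lt_irr.
Local Notation trans := loop_lt_trans.

(* The elements of S_1; S1elt 0 0 j = 0 is not one of them, but allowing it
   avoids case distinctions in the compositions. *)
Definition S1elt (n : 'I_2) (i j : int) : C :=
  if n == o0 then L i *_(0) L j - L 0 *_(0) L (i + j) else L i *_(1) L j + L (i + j).

(* The leading words of normal S_1-words are those with a redex before the last letter. *)
Definition redex (b : int * 'I_2) : bool := b != (0, o0).

Lemma S1P f : S1 k f <-> exists n i j, redex (i, n) /\ f = S1elt n i j.
Proof.
split=> [[i [j [[i0 ->]|->]]]|[n [i [j [r ->]]]]].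
- by exists o0, i, j; rewrite /redex xpair_eqE (negPf i0).
- by exists o1, i, j; rewrite /redex xpair_eqE andbF.
exists i, j; move: r; rewrite /redex /S1elt xpair_eqE.
by case: (n == o0); rewrite ?andbT ?andbF => r0; [left | right].
Qed.

(** For index 1, associativity adds the term L_i(0) (L_j(m+1) c). Here m + 1 may be 2, so this need
    not be a word; [len_span_mul] rewrites it at the same length, and it stays below because (i, 0)
    precedes (i, 1). *)
Lemma S1elt_mul n i j (m : 'I_2) c : redex (i, n) -> exists2 r,
  S1elt n i j *_(m) nw c = nw ((i, n) :: (j, m) :: c.1, c.2) + r &
  below loop_lt ((i, n) :: (j, m) :: c.1, c.2) r.
Proof.
rewrite /redex xpair_eqE /S1elt; case: (unliftP o0 n) => [n'|] ->; last first.
  rewrite eqxx andbT => i0; rewrite confpBl !assoc_prod0.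
  eexists; [reflexivity|apply: spansN].
  apply: (@below_elt _ _ _ _ ((0, o0) :: (i + j, m) :: c.1, c.2)).
  by apply: word_lt_ltB => //; apply: loop_lt0.
have -> : lift o0 n' = o1 by apply/val_inj; rewrite /= [n']ord1.
have -> : (o1 == o0) = false by [].
move=> _; rewrite confpDl_add assoc_prod1 -addrA; eexists; [reflexivity|].
apply: spansD.
  apply/spansN; apply: (spans_map (@conf_lin _ C 0 (L i))) (len_span_mul m.+1 j _); last first.
    exact: (@spans_elt _ _ _ (fun v => size v.1 = size c.1) nw c).
  move=> v hv; apply: (@below_elt _ _ _ _ ((i, o0) :: v.1, v.2)).
  by apply: word_lt_ltn => //; rewrite hv.
apply: (@below_elt _ _ _ _ ((i + j, m) :: c.1, c.2)).
exact: word_lt_size.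
Qed.

(** D^t does not commute with L_i(1): the correction t L_i(0) D^(t-1) L_j has the same length and a
    smaller index. For t = 0 its coefficient is 0. *)
Lemma S1elt_D n i j t : redex (i, n) -> exists2 r,
  confDn t (S1elt n i j) = nw ([:: (i, n)], (j, t)) + r &
  below loop_lt ([:: (i, n)], (j, t)) r.
Proof.
rewrite /redex xpair_eqE /S1elt; case: (unliftP o0 n) => [n'|] ->; last first.
  rewrite eqxx andbT => i0; rewrite confDnB !confDn_prod0.
  eexists; [reflexivity|apply: spansN].
  apply: (@below_elt _ _ _ _ ([:: (0, o0)], (i + j, t))).
  by apply: word_lt_ltB => //; apply: loop_lt0.
have -> : lift o0 n' = o1 by apply/val_inj; rewrite /= [n']ord1.
have -> : (o1 == o0) = false by [].
move=> _; rewrite confDnD confDn_prod1 -addrA; eexists; [reflexivity|].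
apply: spansD.
  apply/spansN/spansZ/(@below_elt _ _ _ _ ([:: (i, o0)], (j, t.-1))).
  exact: word_lt_ltn.
apply: (@below_elt _ _ _ _ ([::], (i + j, t))).
exact: word_lt_size.
Qed.

Lemma S1elt_lead n i j : redex (i, n) ->
  lead loop_lt (S1elt n i j) = Some ([:: (i, n)], (j, 0%N)).
Proof. move=> /(S1elt_D j 0)[r e h]; rewrite -[S1elt n i j]/(confDn 0 _) e.
exact: (lead_nword1 irr trans). Qed.

Lemma lead_act_mul p n i j (m : 'I_2) c : redex (i, n) ->
  lead loop_lt (act p (S1elt n i j *_(m) nw c)) =
  Some (wpre p ((i, n) :: (j, m) :: c.1, c.2)).
Proof.
move=> /(S1elt_mul j m c)[r -> h].
rewrite addrC -[r]scale1r act_lin scale1r addrC act_nword.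
by apply: (lead_nword1 irr trans); apply: below_act.
Qed.

Lemma lead_act_D p n i j t : redex (i, n) ->
  lead loop_lt (act p (confDn t (S1elt n i j))) = Some (wpre p ([:: (i, n)], (j, t))).
Proof.
move=> /(S1elt_D j t)[r -> h].
rewrite addrC -[r]scale1r act_lin scale1r addrC act_nword.
by apply: (lead_nword1 irr trans); apply: below_act.
Qed.

Lemma Sword_lead x : normal_Sword loop_lt (S1 k) x ->
  exists2 u, lead loop_lt x = Some u & has redex u.1.
Proof.
move=> [p s w m c /S1P[n [i [j [r ->]]]] _ _|p s t /S1P[n [i [j [r ->]]]]].
  by rewrite lead_act_mul //; eexists; [reflexivity | rewrite has_cat /= r orbT].
by rewrite lead_act_D //; eexists; [reflexivity | rewrite has_cat /= r orbT].
Qed.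

Lemma redex_Sword (u : word int 2) : has redex u.1 ->
  exists2 x, normal_Sword loop_lt (S1 k) x & lead loop_lt x = Some u.
Proof.
case: u => p l /= h; have [i0] := hasP h; move: h => /split_find.
case=> [[i n] p1 p2 r] _ _ _.
(* A redex directly before the last letter gives a normal word of the second kind, an earlier one a
   word of the first kind. *)
rewrite cat_rcons; case: p2 => [|[j m] p2].
  case: l => j t; exists (act p1 (confDn t (S1elt n i j))); last by rewrite lead_act_D.
  by apply: Sword_snd; apply/S1P; exists n, i, j.
exists (act p1 (S1elt n i j *_(m) nw (p2, l))); last by rewrite lead_act_mul.
apply: (Sword_fst _ _ _ (w := ([:: (i, n)], (j, 0%N)))) => //; last exact: S1elt_lead.
by apply/S1P; exists n, i, j.
Qed.

Lemma L0wordE n t i : L0word k n t i = nw (nseq n (0, o0), (i, t)).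
Proof. by elim: n => // n IH; rewrite -[LHS]/(L 0 *_(0) L0word k n t i) IH. Qed.

Lemma Irr_S1 : Irr loop_lt (S1 k) = [set x | exists i t n, x = L0word k n t i].
Proof.
apply/seteqP; split=> x /= [].
  move=> [p [i t]] [-> h]; exists i, t, (size p); rewrite L0wordE.
  suff -> : p = nseq (size p) (0, o0) by rewrite size_nseq.
  apply/all_pred1P; apply/negPn; rewrite -has_predC; apply/negP => hp.
  have [y /h + hy] := @redex_Sword (p, (i, t)) hp; exact.
move=> i [t [n ->]]; rewrite L0wordE; eexists; split; first by reflexivity.
move=> v /Sword_lead[u -> hu] [e]; move: hu; rewrite e /= has_nseq /redex eqxx.
by rewrite andbF.
Qed.

End LoopGSB.

(** * Triviality of the compositions of S_1 *)

Section GSB.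
Variable k : fieldType.
Hypothesis char0 : forall n : nat, n.+1%:R != 0 :> k.
Local Notation C := (freeConf k int 2).
Local Notation L := (gen k 2 (B := int)).
Local Notation nw := (@nword k int 2).
Local Notation o0 := (@ord0 1).
Local Notation o1 := (@ord_max 1).
Local Notation irr := loop_lt_irr.
Local Notation trans := loop_lt_trans.
Local Notation S1e := (@S1elt k).

Lemma S1elt0 i j : S1e o0 i j = L i *_(0) L j - L 0 *_(0) L (i + j).
Proof. by []. Qed.

Lemma S1elt1 i j : S1e o1 i j = L i *_(1) L j + L (i + j).
Proof. by []. Qed.

Definition Sword_le (w : word int 2) (x : C) : Prop :=
  normal_Sword loop_lt (S1 k) x /\ exists2 v, lead loop_lt x = Some v & word_le loop_lt v w.

Lemma trivial_mod_spans w h : lead loop_lt h = Some w ->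
  spans (Sword_le w) (fun x : C => x) h -> trivial_mod loop_lt (S1 k) h.
Proof.
move=> hw [r hr e]; exists r; split=> // x /hr[hx [v ev vw]]; split=> //.
by rewrite ev hw.
Qed.

Lemma spans_mul w p n i j (m : 'I_2) c :
  (redex (i, n) -> word_le loop_lt (wpre p ((i, n) :: (j, m) :: c.1, c.2)) w) ->
  spans (Sword_le w) (fun x : C => x) (act p (S1e n i j *_(m) nw c)).
Proof.
move=> h; have [r|/negPn/eqP [-> ->]] := boolP (redex (i, n)).
  apply: (@spans_elt _ _ _ _ (fun x : C => x)); split.
    apply: (Sword_fst _ _ _ (w := ([:: (i, n)], (j, 0%N)))) => //; last exact: S1elt_lead.
    by apply/S1P; exists n, i, j.
  by eexists; [apply: lead_act_mul | apply: h].
rewrite S1elt0 add0r subrr confp0l.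
have -> : act p (0 : C) = 0.
  by have := act_lin p (-1) (0 : C) 0; rewrite scaler0 addr0 scaleN1r addNr.
exact: spans0.
Qed.

Lemma spans_act w p n i j :
  (redex (i, n) -> word_le loop_lt (wpre p ([:: (i, n)], (j, 0%N))) w) ->
  spans (Sword_le w) (fun x : C => x) (act p (S1e n i j)).
Proof.
move=> h; have [r|/negPn/eqP [-> ->]] := boolP (redex (i, n)).
  apply: (@spans_elt _ _ _ _ (fun x : C => x)); split.
    by rewrite -[S1e n i j]/(confDn 0 _); apply: Sword_snd; apply/S1P; exists n, i, j.
  by eexists; [rewrite -[S1e n i j]/(confDn 0 _); apply: lead_act_D | apply: h].
rewrite S1elt0 add0r subrr.
have -> : act p (0 : C) = 0.
  by have := act_lin p (-1) (0 : C) 0; rewrite scaler0 addr0 scaleN1r addNr.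
exact: spans0.
Qed.

Lemma S1_monic f : S1 k f -> Defs.monic loop_lt f.
Proof.
move=> /S1P[n [i [j [r ->]]]]; eexists; first exact: S1elt_lead.
have [r' e h] := S1elt_D k j 0 r; rewrite -[S1elt k n i j]/(confDn 0 _) e.
by rewrite -[nword _ _]scale1r (coords_lead irr).
Qed.

Lemma wle_lt (u v : word int 2) : word_lt loop_lt u v -> word_le loop_lt u v.
Proof. by rewrite /word_le => ->; rewrite orbT. Qed.

Lemma gen_prod2 (a b : int) : L a *_(2) L b = 0.
Proof. exact: gen_locality. Qed.

(* f = S1e n i j and g = S1e m j l overlap in L_i(n) L_j(m) L_l. *)
Lemma inter_trivial00 i j l : i != 0 ->
  trivial_mod loop_lt (S1 k) (S1e o0 i j *_(0) L l - L i *_(0) S1e o0 j l).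
Proof.
move=> i0; pose w : word int 2 := ([:: (i, o0); (0, o0)], (j + l, 0%N)).
have E : S1e o0 i j *_(0) L l - L i *_(0) S1e o0 j l =
   nw w - nw ([:: (0, o0); (i + j, o0)], (l, 0%N)).
  by rewrite !S1elt0 confpBl confpBr !assoc_prod0 opprB addrC subrKA.
apply: (@trivial_mod_spans w).
  rewrite E; apply: (lead_nword1 irr trans).
  apply/spansN/(@below_elt _ _ _ _ ([:: (0, o0); (i + j, o0)], (l, 0%N))).
  by apply: word_lt_ltB => //; apply: loop_lt0.
(* Both words of [E] rewrite to L_0(0) L_0(0) L_(i+j+l), the first one through L_0(0) L_i(0)
   L_(j+l). *)
have -> : S1e o0 i j *_(0) L l - L i *_(0) S1e o0 j l =
   S1e o0 i 0 *_(0) L (j + l) + (L 0 *_(0) S1e o0 i (j + l) - L 0 *_(0) S1e o0 (i + j) l).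
  rewrite E !S1elt0 !(confpBl, confpBr) !assoc_prod0 addr0 addrA opprB.
  by rewrite subrKA [_ + (j + l)]addrA subrKA.
apply: spansD; last apply: spansD; last apply: spansN.
- by apply: (@spans_mul w [::] o0 i 0 o0 ([::], (j + l, 0%N))); rewrite /word_le eqxx.
- apply: (@spans_act w [:: (0, o0)] o0 i (j + l)) => _.
  by apply/wle_lt/word_lt_ltB => //; apply: loop_lt0.
- apply: (@spans_act w [:: (0, o0)] o0 (i + j) l) => _.
  by apply/wle_lt/word_lt_ltB => //; apply: loop_lt0.
Qed.

(** The words L_i(0) L_j(1) L_l cancel; the two that remain rewrite to L_0(0) L_(i+j+l) with
    opposite signs. The leading coefficient is -1. *)
Lemma inter_trivial01 i j l : i != 0 ->
  trivial_mod loop_lt (S1 k) (S1e o0 i j *_(1) L l - L i *_(0) S1e o1 j l).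
Proof.
move=> i0; pose w : word int 2 := ([:: (0, o0); (i + j, o1)], (l, 0%N)).
have E : S1e o0 i j *_(1) L l - L i *_(0) S1e o1 j l =
   -1 *: nw w + - nw ([:: (i, o0)], (j + l, 0%N)).
  rewrite S1elt0 S1elt1 confpBl confpDr_add !assoc_prod0 scaleN1r opprD addrA.
  by rewrite [LHS](ACl ((1*3)*2*4))%AC /= subrr add0r.
apply: (@trivial_mod_spans w).
  rewrite E; apply: (lead_nword irr trans); first by rewrite oppr_eq0 oner_eq0.
  apply/spansN/(@below_elt _ _ _ _ ([:: (i, o0)], (j + l, 0%N))).
  exact: word_lt_size.
have -> : S1e o0 i j *_(1) L l - L i *_(0) S1e o1 j l =
   - (L 0 *_(0) S1e o1 (i + j) l) - S1e o0 i (j + l).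
  by rewrite E S1elt0 S1elt1 confpDr_add scaleN1r opprB opprD [i + (j + l)]addrA addrA subrK.
apply: spansD; apply: spansN.
  by apply: (@spans_act w [:: (0, o0)] o1 (i + j) l); rewrite /word_le eqxx.
by apply: (@spans_act w [::] o0 i (j + l)) => _; apply/wle_lt/word_lt_size.
Qed.

Lemma inter_trivial10 i j l :
  trivial_mod loop_lt (S1 k) (S1e o1 i j *_(0) L l - L i *_(1) S1e o0 j l).
Proof.
pose w : word int 2 := ([:: (i, o1); (0, o0)], (j + l, 0%N)).
have E : S1e o1 i j *_(0) L l - L i *_(1) S1e o0 j l =
   nw w + (nw ([:: (i + j, o0)], (l, 0%N)) - nw ([:: (i, o0); (j, o1)], (l, 0%N))).
  rewrite S1elt0 S1elt1 confpDl_add confpBr !assoc_prod1 opprB !addrA.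
  by rewrite [LHS](ACl (4*3*2*(1*5)))%AC /= subrr addr0.
apply: (@trivial_mod_spans w).
  rewrite E; apply: (lead_nword1 irr trans); apply: spansD; last apply: spansN.
    by apply: (@below_elt _ _ _ _ ([:: (i + j, o0)], (l, 0%N))); apply: word_lt_size.
  by apply: (@below_elt _ _ _ _ ([:: (i, o0); (j, o1)], (l, 0%N))); apply: word_lt_ltn.
(* Rewriting the leading word creates L_i(0) L_0(1) L_(j+l), which the second term removes; the
   third removes L_i(0) L_j(1) L_l, and the last two take L_i(0) L_(j+l) and L_(i+j)(0) L_l to the
   common word L_0(0) L_(i+j+l). *)
have -> : S1e o1 i j *_(0) L l - L i *_(1) S1e o0 j l =
   S1e o1 i 0 *_(0) L (j + l) + L i *_(0) S1e o1 0 (j + l) - L i *_(0) S1e o1 j l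
   - S1e o0 i (j + l) + S1e o0 (i + j) l.
  rewrite E !S1elt0 !S1elt1 confpDl_add !confpDr_add !assoc_prod1 addr0 add0r.
  rewrite [_ + (j + l)]addrA !opprD !opprK !addrA.
  by rewrite [RHS](ACl (1*10*6*(2*4)*(3*7)*(5*8)*(9*11)))%AC /= addNr !subrr !addr0.
apply: spansD; [apply: spansD; [apply: spansD; [apply: spansD |]|]|];
  try apply: spansN.
- by apply: (@spans_mul w [::] o1 i 0 o0 ([::], (j + l, 0%N))); rewrite /word_le eqxx.
- by apply: (@spans_act w [:: (i, o0)] o1 0 (j + l)) => _; apply/wle_lt/word_lt_ltn.
- by apply: (@spans_act w [:: (i, o0)] o1 j l) => _; apply/wle_lt/word_lt_ltn.
- by apply: (@spans_act w [::] o0 i (j + l)) => _; apply/wle_lt/word_lt_size.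
- by apply: (@spans_act w [::] o0 (i + j) l) => _; apply/wle_lt/word_lt_size.
Qed.

(** All words of length 3 cancel and a difference of two elements of S_1 is left. It is 0 for j = 0;
    otherwise the order of i + j and i decides which of them has the leading word. *)
Lemma inter_trivial11 i j l :
  trivial_mod loop_lt (S1 k) (S1e o1 i j *_(1) L l - L i *_(1) S1e o1 j l).
Proof.
have E : S1e o1 i j *_(1) L l - L i *_(1) S1e o1 j l =
   nw ([:: (i + j, o1)], (l, 0%N)) - nw ([:: (i, o1)], (j + l, 0%N)).
  rewrite !S1elt1 confpDl_add confpDr_add !assoc_prod1 gen_prod2 confp0r subr0.
  by rewrite opprD addrA [LHS](ACl ((1*3)*2*4))%AC /= subrr add0r.
have E2 : S1e o1 i j *_(1) L l - L i *_(1) S1e o1 j l = S1e o1 (i + j) l - S1e o1 i (j + l).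
  by rewrite E !S1elt1 [i + (j + l)]addrA opprD addrACA subrr addr0.
have [j0|j0] := eqVneq j 0.
  by rewrite E2 j0 addr0 add0r subrr; apply: trivial_mod0.
have [h|h] := orP (@loop_lt_total (i + j) i ltac:(by lia)).
- pose w : word int 2 := ([:: (i, o1)], (j + l, 0%N)).
  have lw : word_lt loop_lt ([:: (i + j, o1)], (l, 0%N)) w by apply: word_lt_ltB.
  apply: (@trivial_mod_spans w).
    rewrite E addrC -scaleN1r; apply: (lead_nword irr trans).
      by rewrite oppr_eq0 oner_eq0.
    exact: (@below_elt _ _ _ _ ([:: (i + j, o1)], (l, 0%N))).
  rewrite E2; apply: spansD; last apply: spansN.
    by apply: (@spans_act w [::] o1 (i + j) l) => _; apply: wle_lt.
  by apply: (@spans_act w [::] o1 i (j + l)) => _; rewrite /word_le eqxx.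
- pose w : word int 2 := ([:: (i + j, o1)], (l, 0%N)).
  have lw : word_lt loop_lt ([:: (i, o1)], (j + l, 0%N)) w by apply: word_lt_ltB.
  apply: (@trivial_mod_spans w).
    rewrite E; apply: (lead_nword1 irr trans); apply: spansN.
    exact: (@below_elt _ _ _ _ ([:: (i, o1)], (j + l, 0%N))).
  rewrite E2; apply: spansD; last apply: spansN.
    by apply: (@spans_act w [::] o1 (i + j) l) => _; rewrite /word_le eqxx.
  by apply: (@spans_act w [::] o1 i (j + l)) => _; apply: wle_lt.
Qed.

Lemma ord2P (x : 'I_2) : x = o0 \/ x = o1.
Proof. by case: x => -[|[|//]] hx; [left | right]; apply: val_inj. Qed.

Lemma inter_trivial (n m : 'I_2) i j l : redex (i, n) ->
  trivial_mod loop_lt (S1 k) (S1e n i j *_(m) L l - L i *_(n) S1e m j l).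
Proof.
move=> r; have [en|en] := ord2P n; have [em|em] := ord2P m; subst n m.
- by apply: inter_trivial00; move: r; rewrite /redex xpair_eqE andbT.
- by apply: inter_trivial01; move: r; rewrite /redex xpair_eqE andbT.
- exact: inter_trivial10.
- exact: inter_trivial11.
Qed.

(** Locality kills everything but n = 2 on a relation of index 0. There 2 L_b(1) (L_i(1) L_j -
    L_0(1) L_(i+j)) remains, and the two terms L_(i+j) needed to form S_1-words cancel. The leading
    coefficient is 2. *)
Lemma lmul_trivial b n i j m : (2 <= n)%N -> redex (i, m) ->
  trivial_mod loop_lt (S1 k) (L b *_(n) S1e m i j).
Proof.
move=> hn r; have gl i' j' : local_at 2 (L i') (L j') by exact: gen_locality.
have [em|em] := ord2P m; subst m; last first.
  rewrite S1elt1 confpDr_add (local2_prod1 (gl _ _) (gl _ _)) // gen_locality // addr0.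
  exact: trivial_mod0.
have i0 : i != 0 by move: r; rewrite /redex xpair_eqE andbT.
rewrite S1elt0 confpBr !(local2_prod0 (gl _ _) (gl _ _)) //; case: eqP => _; last first.
  by rewrite subrr; apply: trivial_mod0.
pose w : word int 2 := ([:: (b, o1); (i, o1)], (j, 0%N)).
have lw : word_lt loop_lt ([:: (b, o1); (0, o1)], (i + j, 0%N)) w.
  apply: (@word_lt_wpre _ _ [:: (b, o1)] ([:: (0, o1)], (i + j, 0%N)) ([:: (i, o1)], (j, 0%N))).
  by apply: word_lt_ltB => //; apply: loop_lt0.
apply: (@trivial_mod_spans w).
  apply: (@lead_nword _ _ _ irr trans 2%:R w); first exact: char0.
  apply/spansN/spansZ.
  exact: (@below_elt _ _ _ _ ([:: (b, o1); (0, o1)], (i + j, 0%N))).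
have -> : 2%:R *: (L b *_(1) (L i *_(1) L j)) - 2%:R *: (L b *_(1) (L 0 *_(1) L (i + j))) =
   2%:R *: (L b *_(1) S1e o1 i j) - 2%:R *: (L b *_(1) S1e o1 0 (i + j)).
  rewrite -!scalerBr !S1elt1 !confpDr_add add0r; congr (_ *: _).
  by rewrite opprD addrACA subrr addr0.
apply: spansD; last apply: spansN; apply: spansZ.
  by apply: (@spans_act w [:: (b, o1)] o1 i j); rewrite /word_le eqxx.
by apply: (@spans_act w [:: (b, o1)] o1 0 (i + j)) => _; apply: wle_lt.
Qed.

Lemma S1elt_dfree n i j : redex (i, n) -> dfree (S1e n i j).
Proof.
move=> r u; have [en|en] := ord2P n; subst n; rewrite /occurs.
  rewrite S1elt0 -scaleN1r addrC coords_lin.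
  rewrite (@coords_nword _ _ u ([:: (i, o0)], (j, 0%N))).
  rewrite (@coords_nword _ _ u ([:: (0, o0)], (i + j, 0%N))).
  by case: (u =P _) => [-> //|_]; case: (u =P _) => [-> //|_]; rewrite mulr0 addr0 eqxx.
rewrite S1elt1 coordsD (@coords_nword _ _ u ([:: (i, o1)], (j, 0%N))).
rewrite (@coords_nword _ _ u ([::], (i + j, 0%N))).
by case: (u =P _) => [-> //|_]; case: (u =P _) => [-> //|_]; rewrite addr0 eqxx.
Qed.

(** Leading words have two letters and the elements are D-free. So inclusions, right intersections
    and right multiplications do not occur, a right inclusion forces f = g, and an intersection
    overlaps in exactly one letter. *)
Theorem S1_GSB : is_GSB loop_lt (S1 k).
Proof.
split; first exact: S1_monic.
move=> f g h /S1P[n [i [j [rf ->]]]] /S1P[m [i' [j' [rg ->]]]].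
have lf := S1elt_lead k j rf; have lg := S1elt_lead k j' rg.
case=> {h} [u v p q c|u v p t|u v w p q c|u v p t|b r hr|b r].
- rewrite lf lg => -[<-] [<-] _ [] /(congr1 size).
  by rewrite !size_cat /=; lia.
- rewrite lf lg => -[<-] [<-] [] e; have := congr1 size e; rewrite size_cat /=.
  case: p e => [|? p] /=; last by lia.
  move=> [<- <-] _ <- ; rewrite add0n => <-.
  by rewrite subrr; apply: trivial_mod0.
- rewrite lf lg => -[<-] [<-] _ p0 -> [] e ec; have := congr1 size e.
  case: p p0 e => // -[b s] p _ /= e; rewrite !size_cat /wsize /= => e1 e2; 
  have hc : size c.1 = 0%N by move: e2; case: (size c.1).
  have hp : size p = 0%N by move: e1; rewrite hc addn1 => -[].
  move: e; rewrite (size0nil hp) (size0nil hc) => -[<- <- <- <-].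
  case: c hc ec {e1 e2} => c [l t] /= /size0nil -> [-> ->].
  exact: inter_trivial.
- rewrite lf lg => -[<-] [<-] _ p0 [] /(congr1 size); case: p p0 => // ? p _.
  by rewrite size_cat /=; lia.
- exact: lmul_trivial.
- case=> [[u [hu hw _]]|[h _]]; last by case: h; apply: S1elt_dfree.
  by move: hu; rewrite lf => -[] e; case: hw; rewrite -e.
Qed.

End GSB.

(** * The two ideals coincide *)

Section LoopRelations.
Variables (k : fieldType) (A : assocConf k) (e : int -> A).
Hypotheses (two_neq0 : 2%:R != 0 :> k) (e_loc : locality_le 2 e).

Definition rel0 := forall i j,
  e i *_(0) e j + e j *_(1) confD (e i) - 2 *: (e j *_(0) e i) + confD (e (i + j)) = 0.
Definition rel1 := forall i j, e i *_(1) e j + e j *_(1) e i + 2 *: e (i + j) = 0.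

Lemma scale2_eq0 (x : A) : x + x = 0 -> x = 0.
Proof.
move=> h; apply/eqP; have : (2%:R : k) *: x = 0 by rewrite scaler_nat mulr2n.
by move/eqP; rewrite scaler_eq0 (negPf two_neq0).
Qed.

(** Since e_j(1) D e_i = D (e_j(1) e_i) + e_j(0) e_i, one of the two copies of e_j(0) e_i is
    absorbed, and the rest gathers under D. *)
Lemma rel0_expand i j : rel0 ->
  e i *_(0) e j - e j *_(0) e i + confD (e j *_(1) e i + e (i + j)) = 0.
Proof.
move=> F0; rewrite -[RHS](F0 i j) confpDr scale1r confDD scaler_nat mulr2n opprD !addrA.
by rewrite [RHS](ACl (1*4*2*(3*5)*6))%AC /= subrr addr0.
Qed.

(* With g i j = e i_(1) e j + e (i + j): rel1 makes g antisymmetric, applying e a_(2)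
   to rel0 gives e a_(1) g i j = 0, and then comparing g a i_(1) e j with g i a_(1) e j
   yields 2 g (a + i) j = g a (i + j) + g i (a + j), whence g = 0. *)
Lemma rel_prod1 : rel0 -> rel1 -> forall i j, e i *_(1) e j + e (i + j) = 0.
Proof.
move=> F0 F1; pose g i j := e i *_(1) e j + e (i + j).
have gC i j : g j i = - g i j.
  apply/eqP; rewrite -addr_eq0 /g addrACA [j + i]addrC -mulr2n -scaler_nat.
  by apply/eqP; rewrite -[RHS](F1 j i) [j + i]addrC.
(* The (0)-products contribute 2 e_a(1) (e_i(1) e_j - e_j(1) e_i), and the D-term contributes 2
   e_a(1) (e_j(1) e_i + e_(i+j)); the sum is 2 e_a(1) g i j. *)
have ag a i j : e a *_(1) g i j = 0.
  have := congr1 (confp 2 (e a)) (rel0_expand i j F0).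
  have el b c : local_at 2 (e b) (e c) := @e_loc b c.
  rewrite confp0r confpDr_add confpBr !(local2_prod0 (el _ _) (el _ _)) // eqxx confpDr confpDr_add.
  rewrite (local2_prod1 (n := 2) (el _ _) (el _ _)) //.
  rewrite [e a *_(2) e _]e_loc // addr0 confD0 add0r confpDr_add scalerDr addrA subrK.
  by rewrite -scalerDr -confpDr_add => /eqP; rewrite scaler_eq0 (negPf two_neq0) => /eqP.
have step a i j : g a i *_(1) e j = g (a + i) j - g a (i + j).
  have h : e a *_(1) (e i *_(1) e j) = - (e a *_(1) e (i + j)).
    by apply/eqP; rewrite -addr_eq0 -confpDr_add; apply/eqP; apply: ag.
  rewrite {1}/g confpDl_add assoc_prod1 [e i *_(2) e j]e_loc // confp0r subr0 h.
  by rewrite /g [a + (i + j)]addrA opprD addrACA subrr addr0 addrC.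
have key a i j : g (a + i) j + g (a + i) j = g a (i + j) + g i (a + j).
  have := step i a j; rewrite gC confpNl step [i + a]addrC opprB => /eqP.
  by rewrite subr_eq addrAC eq_sym subr_eq eq_sym => /eqP <-; rewrite addrC.
have g0 a j : g a j = g 0 (a + j).
  by have := key a 0 j; rewrite addr0 add0r => /addrI.
(* By [g0], g depends on i + j only, so it is symmetric as well as antisymmetric. *)
move=> i j; apply: scale2_eq0; rewrite -/(g i j) {2}[g i j]g0 [i + j]addrC -g0 gC.
exact: addNr.
Qed.

(* (e i_(1) e j)_(0) e l expresses e i_(1) (e j_(0) e l), which is symmetric in j and l. *)
Lemma rel_prod0 : rel0 -> rel1 -> forall i j, e i *_(0) e j = e 0 *_(0) e (i + j).
Proof.
move=> F0 F1; have s1 i j : e i *_(1) e j = - e (i + j).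
  by apply/eqP; rewrite -addr_eq0; apply/eqP/rel_prod1.
have sym i j : e i *_(0) e j = e j *_(0) e i.
  have := rel0_expand i j F0; rewrite s1 [j + i]addrC addNr confD0 addr0 => /eqP.
  by rewrite subr_eq0 => /eqP.
have M i j l : e i *_(1) (e j *_(0) e l) = - (e (i + j) *_(0) e l) - e i *_(0) e (j + l).
  have := assoc_prod1 0 (e i) (e j) (e l); rewrite !s1 confpNl confpNr opprK => ->.
  by rewrite addrK.
(* The first index -j is chosen so that exchanging the other two, i + j and j, turns e_i(0) e_j into
   e_0(0) e_(i+j); the remaining terms agree. *)
move=> i j; have := M (- j) (i + j) j; rewrite sym M [j + _]addrC => /addIr/oppr_inj.
by rewrite addNr [- j + _]addrC addrK.
Qed.

End LoopRelations.

Lemma rel_S1 (k : fieldType) (A : assocConf k) (e : int -> A) :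
  (forall i j, e i *_(1) e j + e (i + j) = 0) ->
  (forall i j, e i *_(0) e j = e 0 *_(0) e (i + j)) -> rel0 e /\ rel1 e.
Proof.
move=> s1 s0; have s1' i j : e i *_(1) e j = - e (i + j).
  by apply/eqP; rewrite -addr_eq0 s1.
split=> i j.
  rewrite confpDr scale1r s1' s0 [e j *_(0) _]s0 [j + i]addrC scaler_nat mulr2n opprD.
  by rewrite confDN !addrA [LHS](ACl ((1*4)*(3*5)*(2*6)))%AC /= !subrr addNr !addr0.
by rewrite !s1' [j + i]addrC scaler_nat mulr2n -opprD addNr.
Qed.

(** * Inclusions of ideals as relations in a quotient *)

Section QuotientRelations.
Variables (k : fieldType) (S : set (freeConf k int 2)).
Local Notation q := (@quot_pi k (freeConf k int 2) S).
Local Notation L := (gen k 2 (B := int)).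

Lemma quot_pi0 : q 0 = 0.
Proof. by []. Qed.

Lemma quot_piP x : Id S x <-> q x = 0.
Proof. by rewrite -quot_pi0 quot_pi_eq subr0. Qed.

Lemma quot_piD x y : q (x + y) = q x + q y.
Proof. by have := conf_hom_lin (quot_pi_hom S) 1 x y; rewrite !scale1r. Qed.

Lemma quot_piZ c x : q (c *: x) = c *: q x.
Proof. by have := conf_hom_lin (quot_pi_hom S) c x 0; rewrite quot_pi0 !addr0. Qed.

Lemma quot_piN x : q (- x) = - q x.
Proof. by rewrite -scaleN1r quot_piZ scaleN1r. Qed.

Lemma quot_piM n x y : q (x *_(n) y) = q x *_(n) q y.
Proof. exact: (conf_homM (quot_pi_hom S)). Qed.

Lemma quot_pi_D x : q (confD x) = confD (q x).
Proof. exact: (conf_homD (quot_pi_hom S)). Qed.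

Lemma quot_pi_locality : locality_le 2 (fun i => q (L i)).
Proof. by move=> a b n hn; rewrite -quot_piM gen_locality. Qed.

Let qE := (quot_piD, quot_piZ, quot_piN, quot_piM, quot_pi_D).

Lemma quot_rel_Sminus : Sminus k `<=` Id S <->
  rel0 (fun i => q (L i)) /\ rel1 (fun i => q (L i)).
Proof.
split=> [h|[F0 F1] _ [i [j [->|->]]]].
  by split=> i j; rewrite -!qE; apply/quot_piP; apply: h; exists i, j; tauto.
by apply/quot_piP; rewrite !qE; apply: F0.
by apply/quot_piP; rewrite !qE; apply: F1.
Qed.

Lemma quot_rel_S1 : S1 k `<=` Id S <->
  (forall i j, q (L i) *_(1) q (L j) + q (L (i + j)) = 0) /\
  (forall i j, q (L i) *_(0) q (L j) = q (L 0) *_(0) q (L (i + j))).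
Proof.
split=> [h|[s1 s0] _ [i [j [[_ ->]|->]]]].
  split=> i j.
    by rewrite -!qE; apply/quot_piP; apply: h; exists i, j; right.
  have [->|i0] := eqVneq i 0; first by rewrite add0r.
  apply/eqP; rewrite -subr_eq0 -!quot_piM -quot_piN -quot_piD; apply/eqP/quot_piP; apply: h.
  by exists i, j; left.
by apply/quot_piP; rewrite !qE s0 subrr.
by apply/quot_piP; rewrite !qE s1.
Qed.

End QuotientRelations.

Lemma Id_sub (k : fieldType) (A : assocConf k) (S S' : set A) :
  S `<=` Id S' -> Id S `<=` Id S'.
Proof. by move=> h x hx; apply: hx; split=> //; apply: Id_ideal. Qed.

Lemma sub_Id (k : fieldType) (A : assocConf k) (S : set A) : S `<=` Id S.
Proof. by move=> x Sx I [_]; apply. Qed.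

Lemma Id_Sminus (k : fieldType) : 2%:R != 0 :> k -> Id (Sminus k) = Id (S1 k).
Proof.
move=> two; apply/seteqP; split; apply: Id_sub.
  have [s1 s0] := (quot_rel_S1 (S1 k)).1 (@sub_Id _ _ _).
  by apply/quot_rel_Sminus; apply: rel_S1.
have [F0 F1] := (quot_rel_Sminus (Sminus k)).1 (@sub_Id _ _ _).
apply/quot_rel_S1; split.
  exact: (rel_prod1 two (@quot_pi_locality _ _)).
exact: (rel_prod0 two (@quot_pi_locality _ _)).
Qed.

(** * Changing the index set of a basis *)

Lemma range_bij (X J : choiceType) (f : J -> X) (A : set X) :
  injective f -> A = [set x | exists j, x = f j] ->
  exists (h : A -> J) (h' : J -> A),
    [/\ cancel h h', cancel h' h & forall x, f (h x) = val x].
Proof.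
move=> fI eA; have sA : A `<=` [set x | exists j, x = f j] by rewrite eA.
have hx (x : A) : {j | val x = f j} by apply: cid; apply: sA; apply: set_valP.
have hj j : f j \in A by rewrite inE eA; exists j.
pose h (x : A) := sval (hx x); pose h' j : A := SigSub (hj j).
have hE x : f (h x) = val x by rewrite /h; case: (hx x).
exists h, h'; split=> // [x|j]; first by apply: val_inj; rewrite /= hE.
by apply: fI; rewrite hE.
Qed.

Section Reindex.
Variables (k : fieldType) (V : lmodType k).

Lemma is_k_basis_reindex (I I' : choiceType) (e : I -> V) (h : I' -> I) (h' : I -> I') :
  cancel h h' -> cancel h' h -> is_k_basis e -> is_k_basis (e \o h).
Proof.
move=> hK h'K be x.
have comb (c : I -> k) : k_comb (c \o h) (e \o h) = k_comb c e.
  by rewrite /k_comb [RHS](reindex_fsbigT h) //; exists h'.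
have fin (c : I -> k) : fin_supp c -> fin_supp (c \o h).
  move=> /fin_supp_ex[s _ hs]; apply: (@fin_supp_seq _ _ (map h' s)) => i /hs hi.
  by rewrite -(hK i) map_f.
have fin' (c : I' -> k) : fin_supp c -> fin_supp (c \o h').
  move=> /fin_supp_ex[s _ hs]; apply: (@fin_supp_seq _ _ (map h s)) => i /hs hi.
  by rewrite -(h'K i) map_f.
have [c [[fc ->] uc]] := be x.
exists (c \o h); split; first by rewrite comb; split=> //; apply: fin.
move=> c1 [fc1 e1]; have e2 : c1 = (c1 \o h') \o h.
  by apply/funext => i /=; rewrite hK.
rewrite e2 -(uc (c1 \o h')) //; split; first exact: fin'.
by rewrite e1 {1}e2 comb.
Qed.

Lemma is_k_basis_indep (I : choiceType) (e : I -> V) (s : seq I) (c : I -> k) :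
  is_k_basis e -> uniq s -> \sum_(i <- s) c i *: e i = 0 -> forall i, i \in s -> c i = 0.
Proof.
move=> be us h0 i hi; have [c0 [_ uc]] := be 0.
have u0 : c0 = fun=> 0.
  apply: uc; split; first by apply: (@fin_supp_seq _ _ [::]) => j; rewrite eqxx.
  by rewrite (@k_comb_seq _ _ _ _ _ [::]) ?big_nil // => j; rewrite eqxx.
have : c0 = fun j => if j \in s then c j else 0.
  have hs j : (if j \in s then c j else 0) != 0 -> j \in s by case: ifP; rewrite // eqxx.
  apply: uc; split; first exact: fin_supp_seq hs.
  rewrite (k_comb_seq _ us hs) -[LHS]h0 big_seq [RHS]big_seq.
  by apply: eq_bigr => j ->.
by rewrite u0 => /(congr1 (fun f => f i)); rewrite hi.
Qed.

(** The bases of the theorem are indexed by sets of elements; injectivity of f lets the proof index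
    them by parameters instead. *)
Lemma is_k_basis_range (X J : choiceType) (f : J -> X) (g : X -> V) (A : set X) :
  injective f -> A = [set x | exists j, x = f j] -> is_k_basis (fun j => g (f j)) ->
  is_k_basis (fun x : A => g (val x)).
Proof.
move=> fI eA be; have [h [h' [hK h'K hE]]] := range_bij fI eA.
rewrite (_ : (fun x : A => _) = (fun j => g (f j)) \o h); last first.
  by apply/funext => x /=; rewrite hE.
exact: is_k_basis_reindex hK h'K be.
Qed.

End Reindex.

(** * Bases over k[D] and bases over k *)

Section KDBasis.
Variables (k : fieldType) (C : confAlg k).
Implicit Types (p : {poly k}) (x : C).

Definition Dfam (I : Type) (e : I -> C) (ti : nat * I) : C := confDn ti.1 (e ti.2).

Lemma polyD_widen n p x : (size p <= n)%N -> polyD p x = \sum_(t < n) p`_t *: confDn t x.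
Proof.
move=> hn; rewrite /polyD (big_ord_widen_cond n xpredT (fun t => p`_t *: confDn t x)) //.
rewrite big_mkcond; apply: eq_bigr => t _; case: ltnP => //= h.
by rewrite nth_default // scale0r.
Qed.

Variable I : choiceType.
Implicit Type e : I -> C.

Definition coef_fam (c : I -> {poly k}) (ti : nat * I) : k := (c ti.2)`_ti.1.

Lemma fin_supp_coef_fam (c : I -> {poly k}) : fin_supp c -> fin_supp (coef_fam c).
Proof.
move=> /fin_supp_ex[s _ hs]; pose n := (\max_(i <- s) size (c i))%N.
apply: (@fin_supp_seq _ _ [seq (t, i) | t <- iota 0 n, i <- s]) => -[t i].
rewrite /coef_fam /= => h; have hi : i \in s.
  by apply: hs; apply: contraNneq h => ->; rewrite coef0.
apply/allpairsP; exists (t, i); split=> //=; rewrite mem_iota /= add0n.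
apply: leq_trans (@leq_bigmax_seq _ s xpredT (fun i => size (c i)) i hi isT).
by rewrite ltnNge; apply: contraNN h => h; rewrite nth_default.
Qed.

Lemma kD_comb_coef e c : fin_supp c -> kD_comb c e = k_comb (coef_fam c) (Dfam e).
Proof.
move=> /fin_supp_ex[s us hs]; pose n := (\max_(i <- s) size (c i))%N.
rewrite /kD_comb -(fsbig_widen [set` s] [set: I]) //; last first.
  move=> i [_ hi] /=; have [->|/hs/hi//] := eqVneq (c i) 0.
  by rewrite /polyD size_poly0 big_ord0.
rewrite -fsbig_seq // (@k_comb_seq _ _ _ _ _ [seq (t, i) | t <- iota 0 n, i <- s]).
- rewrite big_allpairs_dep exchange_big /=; apply: eq_big_seq => i hi.
  rewrite (@polyD_widen n).
    by rewrite -(big_mkord xpredT (fun t => (c i)`_t *: confDn t (e i))) /index_iota subn0.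
  exact: (@leq_bigmax_seq _ s xpredT (fun i => size (c i)) i hi isT).
- by apply: allpairs_uniq; rewrite ?iota_uniq // => -[? ?] [? ?].
- move=> [t i]; rewrite /coef_fam /= => h; have hi : i \in s.
    by apply: hs; apply: contraNneq h => ->; rewrite coef0.
  apply/allpairsP; exists (t, i); split=> //=; rewrite mem_iota /= add0n.
  apply: leq_trans (@leq_bigmax_seq _ s xpredT (fun i => size (c i)) i hi isT).
  by rewrite ltnNge; apply: contraNN h => h; rewrite nth_default.
Qed.

Lemma coef_fam_surj (c : nat * I -> k) : fin_supp c ->
  exists2 c' : I -> {poly k}, fin_supp c' & coef_fam c' = c.
Proof.
move=> /fin_supp_ex[s _ hs]; pose n := (\max_(y <- s) y.1)%N.+1.
have E i t : (\poly_(t < n) c (t, i))`_t = c (t, i).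
  rewrite coef_poly; case: ltnP => // h; apply/esym/eqP; apply: contraLR h => /hs h.
  by rewrite -ltnNge ltnS (@leq_bigmax_seq _ s xpredT (fun y => y.1) (t, i) h isT).
exists (fun i => \poly_(t < n) c (t, i)).
  apply: (@fin_supp_seq _ _ (map snd s)) => i h.
  have [t ht] : exists t, c (t, i) != 0.
    apply: contrapT => /forallNP H; case/negP: h; apply/eqP/polyP => t.
    by rewrite E coef0; apply/eqP/negPn/negP/H.
  by apply/mapP; exists (t, i) => //; apply: hs.
by apply/funext => -[t i]; rewrite /coef_fam E.
Qed.

Lemma coef_fam_inj : injective coef_fam.
Proof.
move=> c c' h; apply/funext => i; apply/polyP => t.
by have := congr1 (fun f => f (t, i)) h.
Qed.

(** [coef_fam] is a bijection between finitely supported families that preserves the combination, so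
    existence and uniqueness both carry over. *)
Lemma is_kD_basisP e : is_kD_basis e <-> is_k_basis (Dfam e).
Proof.
split=> be x; have [c [[fc ex] uc]] := be x.
  exists (coef_fam c); split.
    by rewrite -kD_comb_coef //; split=> //; apply: fin_supp_coef_fam.
  move=> c1 /[dup] -[/coef_fam_surj[c2 fc2 <-] ex2] _.
  by rewrite (uc c2) //; split=> //; rewrite kD_comb_coef.
have [c' fc' ec'] := coef_fam_surj fc; exists c'; split.
  by split=> //; rewrite kD_comb_coef // ec'.
move=> c1 [fc1 e1]; apply: coef_fam_inj; rewrite ec'; apply: uc; split.
  exact: fin_supp_coef_fam.
by rewrite e1 kD_comb_coef.
Qed.

End KDBasis.
Arguments Dfam {k C I}.

Lemma is_kD_basis_range (k : fieldType) (C : confAlg k) (X J : choiceType)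
    (f : J -> X) (g : X -> C) (A : set X) :
  injective f -> A = [set x | exists j, x = f j] -> is_kD_basis (fun j => g (f j)) ->
  is_kD_basis (fun x : A => g (val x)).
Proof.
move=> fI eA /is_kD_basisP be; apply/is_kD_basisP.
have [h [h' [hK h'K hE]]] := range_bij fI eA.
rewrite (_ : Dfam _ = Dfam (fun j => g (f j)) \o (fun y : nat * A => (y.1, h y.2))); last first.
  by apply/funext => -[t x] /=; rewrite /Dfam /= hE.
apply: (is_k_basis_reindex (h' := fun y : nat * J => (y.1, h' y.2))) be.
  by move=> [t x] /=; rewrite hK.
by move=> [t x] /=; rewrite h'K.
Qed.

(** * The flip under locality 2 *)

Section Flip.
Variables (k : fieldType) (A : assocConf k).
Implicit Types a b : A.

Lemma confDn0 t : confDn t (0 : A) = 0.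
Proof. by elim: t => //= t ->; rewrite confD0. Qed.

Lemma cflipE M n b a : (forall m, (n + M <= m)%N -> b *_(m) a = 0) ->
  cflip n b a =
  \sum_(j < M) ((-1) ^+ (n + j) / (j`!)%:R) *: confDn j (b *_(n + j) a).
Proof.
move=> h; rewrite /cflip -(fsbig_widen [set` iota 0 M] [set: nat]) //; last first.
  move=> j [_ /= /negP]; rewrite mem_iota /= add0n -leqNgt => hj.
  by rewrite h ?leq_add2l // confDn0 scaler0.
rewrite -fsbig_seq ?iota_uniq //.
rewrite -(big_mkord xpredT
  (fun j => ((-1) ^+ (n + j) / (j`!)%:R) *: confDn j (b *_(n + j) a))).
by rewrite /index_iota subn0.
Qed.

Lemma cflip_loc0 a b : local_at 2 b a -> cflip 0 b a = b *_(0) a - confD (b *_(1) a).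
Proof.
move=> h; rewrite (@cflipE 2) // big_ord_recl big_ord1 /= expr0 expr1 !fact0 invr1.
by rewrite !mulr1 scale1r scaleN1r.
Qed.

Lemma cflip_loc1 a b : local_at 2 b a -> cflip 1 b a = - (b *_(1) a).
Proof. by move=> h; rewrite (@cflipE 1) // big_ord1 /= expr1 divr1 scaleN1r. Qed.

Lemma cflip_loc2 n a b : local_at 2 b a -> (2 <= n)%N -> cflip n b a = 0.
Proof.
move=> h hn; rewrite (@cflipE 0) ?big_ord0 // => m hm; apply: h.
by apply: leq_trans hn _; rewrite addn0 in hm.
Qed.

End Flip.

Section KDSingle.
Variables (k : fieldType) (C : confAlg k).

Definition single (I : eqType) (m : I) (p : {poly k}) (i : I) : {poly k} :=
  if i == m then p else 0.

Lemma fin_supp_single (I : choiceType) (m : I) p : fin_supp (single m p).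
Proof.
apply: (@fin_supp_seq _ _ [:: m]) => i; rewrite /single inE.
by case: ifP; rewrite // eqxx.
Qed.

Lemma kD_comb_single (I : choiceType) (m : I) p (e : I -> C) :
  kD_comb (single m p) e = polyD p (e m).
Proof.
rewrite /kD_comb -(fsbig_widen [set m] [set: I]) //; last first.
  move=> i [_ /= /eqP/negPf im]; rewrite /single im.
  by rewrite /polyD size_poly0 big_ord0.
by rewrite fsbig_set1 /single eqxx.
Qed.

Lemma polyD_NX (x : C) : polyD (- 'X) x = - confD x.
Proof.
rewrite (@polyD_widen _ _ 2) ?size_polyN ?size_polyX //.
rewrite 2!big_ord_recl big_ord0 /= !coefN !coefX /= oppr0 scale0r add0r addr0.
by rewrite scaleN1r.
Qed.

Lemma polyD_C (c : k) (x : C) : polyD c%:P x = c *: x.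
Proof.
by rewrite (@polyD_widen _ _ 1) ?size_polyC_leq1 // big_ord1 coefC.
Qed.

End KDSingle.

Section EnvRels.
Variables (k : fieldType) (LW : lieConf k) (ell : int -> LW).
Hypothesis hLW : is_loop_virasoro ell.
Local Notation L := (gen k 2 (B := int)).

(** [env_rels] admits any coordinates c of the product; uniqueness in the k[D]-basis leaves only one
    choice. *)
Lemma lw_coord0 i j c : fin_supp c -> ell i *_(0) ell j = kD_comb c ell ->
  c = single (i + j) (- 'X).
Proof.
move=> fc ec; have [c0 [_ uc]] := lw_basis hLW (ell i *_(0) ell j).
rewrite -(uc c) //; apply: uc; split; first exact: fin_supp_single.
by rewrite kD_comb_single polyD_NX (lw_prod0 hLW).
Qed.

Lemma lw_coord1 i j c : fin_supp c -> ell i *_(1) ell j = kD_comb c ell ->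
  c = single (i + j) (- 2)%:P.
Proof.
move=> fc ec; have [c0 [_ uc]] := lw_basis hLW (ell i *_(1) ell j).
rewrite -(uc c) //; apply: uc; split; first exact: fin_supp_single.
by rewrite kD_comb_single polyD_C (lw_prod1 hLW) scaleNr.
Qed.

Lemma env_rels_Sminus : env_rels ell 2 = Sminus k.
Proof.
have E0 i j : L i *_(0) L j - cflip 0 (L j) (L i) - kD_comb (single (i + j) (- 'X)) L =
    L i *_(0) L j + L j *_(1) confD (L i) - 2 *: (L j *_(0) L i) + confD (L (i + j)).
  rewrite kD_comb_single polyD_NX opprK (cflip_loc0 (@gen_locality k int 2 _ _)) confpDr scale1r scaler_nat mulr2n.
  by rewrite opprB opprD !addrA [RHS](ACl (1*2*5*(3*4)*6))%AC /= subrr addr0.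
have E1 i j : L i *_(1) L j - cflip 1 (L j) (L i) - kD_comb (single (i + j) (- 2)%:P) L =
    L i *_(1) L j + L j *_(1) L i + 2 *: L (i + j).
  by rewrite kD_comb_single polyD_C (cflip_loc1 (@gen_locality k int 2 _ _)) scaleNr !opprK.
apply/seteqP; split=> x /=.
  move=> [i [j [n [c [hn fc ec ->]]]]]; exists i, j; case: n hn ec => [|[|//]] _ ec.
    by left; rewrite (lw_coord0 fc ec) E0.
  by right; rewrite (lw_coord1 fc ec) E1.
move=> [i [j [->|->]]]; exists i, j.
  exists 0%N, (single (i + j) (- 'X)); split=> //; first exact: fin_supp_single.
  by rewrite kD_comb_single polyD_NX (lw_prod0 hLW).
exists 1%N, (single (i + j) (- 2)%:P); split=> //; first exact: fin_supp_single.
by rewrite kD_comb_single polyD_C (lw_prod1 hLW) scaleNr.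
Qed.

End EnvRels.

Section ConfHom.
Variables (k : fieldType) (A A' : assocConf k) (phi : A -> A').

Lemma conf_hom0 : conf_hom phi -> phi 0 = 0.
Proof.
by move=> h; have := conf_hom_lin h (-1) 0 0; rewrite scaler0 addr0 scaleN1r addNr.
Qed.

Lemma conf_hom_ker : conf_hom phi ->
  is_ideal [set x | phi x = 0].
Proof.
move=> h; split=> /=; first exact: conf_hom0.
- by move=> c x y hx hy; rewrite (conf_hom_lin h) hx hy scaler0 addr0.
- by move=> x hx; rewrite (conf_homD h) hx confD0.
- by move=> n x y hx; rewrite (conf_homM h) hx confp0r.
- by move=> n x y hx; rewrite (conf_homM h) hx confp0l.
Qed.

Lemma conf_hom_sum (T : Type) (r : seq T) (c : T -> k) (f : T -> A) : conf_hom phi ->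
  phi (\sum_(y <- r) c y *: f y) = \sum_(y <- r) c y *: phi (f y).
Proof. by move=> h; apply: linear_sumZ (conf_hom_lin h). Qed.

End ConfHom.

(** * The basis of the universal envelope *)

(* The spanning family L_0(0)^n D^t L_i is separated by the homomorphisms to
   k[x][D] sending L_i to - alpha^i x, for all alpha <> 0: they kill S_1 and
   map it to (-1)^(n+1) alpha^i D^t x^(n+1). *)
Section EvalModels.
Variables (k : fieldType) (alpha : k).
Hypothesis alpha0 : alpha != 0.
Local Notation A0 := (k^o).
Local Notation W := (cend A0).
Local Notation C := (freeConf k int 2).
Local Notation L := (gen k 2 (B := int)).

Definition evalP (c : k) (n : nat) : {poly A0} := (c : A0)%:P * 'X^n.

Lemma evalPM c d m n : evalP c m * evalP d n = evalP (c * d) (m + n).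
Proof. by rewrite /evalP mulrACA -polyCM exprD. Qed.

Lemma deriv_evalP1 c : (evalP c 1)^`() = evalP c 0.
Proof. by rewrite /evalP derivM derivC derivXn mul0r add0r. Qed.

Lemma deriv_evalP0 c : (evalP c 0)^`() = 0.
Proof. by rewrite /evalP expr0 mulr1 derivC. Qed.

(** Sign and degree come from L_i(1) L_j = - L_(i+j), since (-alpha^i x) (-alpha^j x)' = alpha^(i+j)
    x. *)
Definition evalW (i : int) : cendConf A0 := cendC (evalP (- alpha ^ i) 1).

Lemma evalW_locality : locality_le 2 evalW.
Proof.
move=> a b n hn /=; rewrite cend_prodC -(subnK hn) iterD /= !cend_TC deriv_evalP1.
by rewrite deriv_evalP0 /cendC polyC0 linear0 mulr0.
Qed.

Lemma evalW_prod1 i j : evalW i *_(1) evalW j + evalW (i + j) = 0.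
Proof.
rewrite /= cend_prodC /= cend_TC -cendCM deriv_evalP1 evalPM mulrNN -expfzDr //.
apply: (etrans (esym (polyCD _ _))).
by rewrite /evalP -mulrDl -polyCD addrN polyC0 mul0r polyC0.
Qed.

Lemma evalW_prod0 i j : evalW i *_(0) evalW j = evalW 0 *_(0) evalW (i + j).
Proof.
rewrite /= !cend_prodC /= -!cendCM !evalPM !mulrNN -!expfzDr //.
by rewrite add0r.
Qed.

Definition evalPhi : C -> cendConf A0 := free_hom evalW_locality.

Lemma evalPhi_hom : conf_hom evalPhi.
Proof. exact: (free_homP evalW_locality). Qed.

Lemma evalPhi_gen i : evalPhi (L i) = evalW i.
Proof. exact: (free_hom_gen evalW_locality). Qed.

Lemma evalPhi_S1 x : Id (S1 k) x -> evalPhi x = 0.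
Proof.
have h := evalPhi_hom.
move=> Sx; apply: (Sx [set y | evalPhi y = 0]); split; first exact: conf_hom_ker.
have hadd y z : evalPhi (y + z) = evalPhi y + evalPhi z.
  by have := conf_hom_lin h 1 y z; rewrite !scale1r.
have hN y : evalPhi (- y) = - evalPhi y.
  have := conf_hom_lin h (-1) y 0.
  by rewrite !scaleN1r (conf_hom0 h) !addr0.
move=> _ [i [j [[_ ->]|->]]] /=.
  by rewrite hadd hN !(conf_homM h) !evalPhi_gen evalW_prod0 subrr.
by rewrite hadd (conf_homM h) !evalPhi_gen evalW_prod1.
Qed.

Lemma evalPhi_L0word n t i :
  evalPhi (L0word k n t i) =
  iter t (@cend_D k A0) (cendC (evalP ((-1) ^+ n.+1 * alpha ^ i) n.+1)).
Proof.
have h := evalPhi_hom.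
elim: n => [|n IH].
  rewrite /L0word /= expr1 mulN1r; elim: t => [|t IH] /=; first exact: evalPhi_gen.
  by rewrite -[LHS]/(evalPhi (confD _)) (conf_homD h) IH.
rewrite -[LHS]/(evalPhi (L 0 *_(0) L0word k n t i)) (conf_homM h) IH evalPhi_gen /= cend_prodC /=.
elim: t {IH} => [|t IH]; last by rewrite iterS -cend_DMC IH.
rewrite -cendCM evalPM expr0z mulrA [in RHS]exprS.
by congr (cendC (evalP _ _)).
Qed.

Lemma coef_evalPhi n t i t' m :
  (evalPhi (L0word k n t i) : {poly {poly A0}})`_t'`_m =
  if (t' == t) && (m == n.+1) then (-1) ^+ n.+1 * alpha ^ i else 0.
Proof.
rewrite evalPhi_L0word.
have E (p : {poly A0}) : iter t (@cend_D k A0) (cendC p) = 'X^t * p%:P :> {poly {poly A0}}.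
  elim: t => [|t IH]; first by rewrite mul1r.
  by rewrite iterS IH /cend_D mulrA -exprS.
rewrite E coefXnM; case: ltngtP => /= [h|h|->]; rewrite ?coef0 ?subnn ?coefC //=.
  by rewrite subn_eq0 leqNgt h coef0.
by rewrite /evalP coefCM coefXn; case: eqP => _; [rewrite [LHS]mulr1 | rewrite [LHS]mulr0].
Qed.

End EvalModels.

(** * Laurent polynomials vanishing at many points *)

Section LaurentIndep.
Variable k : fieldType.
Hypothesis char0 : forall n : nat, n.+1%:R != 0 :> k.

Lemma natr_inj : injective (fun n : nat => n.+1%:R : k).
Proof.
suff H m n : (m < n)%N -> m.+1%:R != n.+1%:R :> k.
  move=> m n /= /eqP e; apply/eqP; case: ltngtP => // /H; first by rewrite e.
  by rewrite eq_sym e.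
move=> mn; rewrite eq_sym -subr_eq0 -natrB ?ltnS ?(ltnW mn) // subSS.
by rewrite -(prednK (_ : 0 < n - m)%N) ?subn_gt0 // char0.
Qed.

(** Multiplication by a^M makes all exponents nonnegative. The resulting polynomial p vanishes at 1,
    ..., [size p], which are distinct and too many. *)
Lemma laurent_indep (s : seq int) (c : int -> k) : uniq s ->
  (forall a : k, a != 0 -> \sum_(i <- s) c i * a ^ i = 0) ->
  forall i, i \in s -> c i = 0.
Proof.
move=> us h i hi; pose M := (\max_(i <- s) absz i)%N.
have hM j : j \in s -> (absz j <= M)%N by move=> hj; apply: (@leq_bigmax_seq _ s xpredT).
pose d (j : int) := absz (j + M%:Z).
have dE j : j \in s -> (d j)%:Z = j + M%:Z by move=> /hM; rewrite /d; lia.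
pose p : {poly k} := \sum_(j <- s) c j *: 'X^(d j).
have p0 : p = 0.
  apply/eqP; apply/negP => /negP pN0.
  have := @max_poly_roots k p [seq n.+1%:R | n <- iota 0 (size p)] pN0.
  rewrite size_map size_iota ltnn => H; suff: false by []; apply: H.
    apply/allP => _ /mapP[n _ ->]; rewrite /root horner_sum.
    have a0 := char0 n; set a := n.+1%:R in a0 *.
    have := congr1 (fun x => x * a ^ M) (h a a0); rewrite mul0r mulr_suml => e.
    rewrite -[X in _ == X]e; apply/eqP/eq_big_seq => j hj.
    by rewrite hornerZ hornerXn exprnP dE // -mulrA -expfzDr.
  by rewrite map_inj_uniq ?iota_uniq //; apply: natr_inj.
have := congr1 (fun q : {poly k} => q`_(d i)) p0.
rewrite /p coef_sum coef0 (bigD1_seq i) //= coefZ coefXn eqxx mulr1 big_seq_cond big1 ?addr0 //.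
move=> j /andP[hj ji]; rewrite coefZ coefXn; case: eqP => [e|_]; last by rewrite mulr0.
by move: ji; have := dE j hj; rewrite -e (dE i hi) => /addIr ->; rewrite eqxx.
Qed.

End LaurentIndep.

(** * Spanning and independence in the envelope *)

Section UBasis.
Variables (k : fieldType) (S : set (freeConf k int 2)).
Hypothesis char0 : forall n : nat, n.+1%:R != 0 :> k.
Hypothesis IdS : Id S = Id (S1 k).
Local Notation C := (freeConf k int 2).
Local Notation L := (gen k 2 (B := int)).
Local Notation U := (quotConf S).
Local Notation q := (@quot_pi k C S).

Lemma q_rels : (forall i j, q (L i) *_(1) q (L j) + q (L (i + j)) = 0) /\
  (forall i j, q (L i) *_(0) q (L j) = q (L 0) *_(0) q (L (i + j))).
Proof. by apply/quot_rel_S1; rewrite IdS; apply: sub_Id. Qed.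

Lemma q_prod1 i j : q (L i) *_(1) q (L j) = - q (L (i + j)).
Proof. by apply/eqP; rewrite -addr_eq0 q_rels.1. Qed.

Definition L0fam (ni : nat * int) : U := q (L0word k ni.1 0 ni.2).
Local Notation fam := (Dfam L0fam).
Local Notation sp := (spans (fun=> True) fam).

Lemma L0famS n i : q (L 0) *_(0) L0fam (n, i) = L0fam (n.+1, i).
Proof. by rewrite /L0fam -quot_piM. Qed.

Lemma fam_elt t ni : sp (fam (t, ni)).
Proof. exact: spans_elt. Qed.

Lemma sp_D x : sp x -> sp (confD x).
Proof. by apply: (spans_map (@confD_linear _ _)) => -[t ni] _; apply: (fam_elt t.+1). Qed.

Lemma sp_Dn t x : sp x -> sp (confDn t x).
Proof. by move=> hx; elim: t => // t IH; apply: sp_D. Qed.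

Lemma sp_gen i : sp (q (L i)).
Proof. exact: (fam_elt 0 (0%N, i)). Qed.

(** L_b(0) L_0 = L_0(0) L_b in the quotient, so L_b moves to the right past every L_0 until it meets
    L_i. Powers of D come out because L_b(0) commutes with D. *)
Lemma sp_mul0 b x : sp x -> sp (q (L b) *_(0) x).
Proof.
apply: (spans_map (@conf_lin _ U 0 _)) => -[t [n i]] _.
rewrite [X in sp X](esym (confDn_prod0 t (q (L b)) (L0fam (n, i)))); apply: sp_Dn.
elim: n => [|n IH].
  rewrite [X in sp X]q_rels.2 [X in sp X](L0famS 0); exact: (fam_elt 0).
rewrite -L0famS -[X in sp X]assoc_prod0 q_rels.2 addr0 [X in sp X]assoc_prod0.
apply: (spans_map (@conf_lin _ U 0 _)) IH => -[t' [n' i']] _.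
rewrite [X in sp X](esym (confDn_prod0 t' (q (L 0)) (L0fam (n', i')))) L0famS.
exact: (fam_elt t').
Qed.

(** Expanding (L_b(1) L_0)(0) y = - L_b(0) y gives L_b(1) (L_0(0) y) = - L_b(0) y + L_b(0) (L_0(1)
    y), with one factor L_0 fewer under the (1)-product. *)
Lemma sp_mul1 b x : sp x -> sp (q (L b) *_(1) x).
Proof.
apply: (spans_map (@conf_lin _ U 1 _)) => -[t [n i]] _.
suff h : sp (q (L b) *_(1) L0fam (n, i)).
  have := confDn_prod1 t (q (L b)) (L0fam (n, i)) => /esym/eqP; rewrite subr_eq => /eqP e.
  rewrite [X in sp X]e; apply: spansD; first exact: sp_Dn.
  by apply/spansZ/sp_mul0/sp_Dn; exact: (fam_elt 0).
elim: n b => [|n IH] b.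
  by rewrite [X in sp X]q_prod1; apply/spansN/sp_gen.
have := assoc_prod1 0 (q (L b)) (q (L 0)) (L0fam (n, i)).
rewrite q_prod1 addr0 => /esym/eqP; rewrite subr_eq L0famS => /eqP ->.
apply: spansD; last exact/sp_mul0/IH.
by rewrite confpNl; apply/spansN/sp_mul0; exact: (fam_elt 0).
Qed.

Lemma spans_fam x : sp x.
Proof.
have [y <-] := quot_pi_surj x.
have lin : linear q by exact: (conf_hom_lin (quot_pi_hom S)).
apply: (spans_map lin) (spans_nword y) => -[p [b t]] _.
elim: p => [|[a n] p IH].
  rewrite /nword /= (_ : q _ = confDn t (q (L b))); first exact/sp_Dn/sp_gen.
  by elim: t => // t IH; rewrite -[LHS]/(q (confD _)) quot_pi_D IH.
rewrite -[nword _ _]/(L a *_(n) nword k (p, (b, t))) quot_piM.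
by have [->|->] := ord2P n; [apply: sp_mul0 | apply: sp_mul1].
Qed.

Lemma q_L0word n t i : q (L0word k n t i) = fam (t, (n, i)).
Proof.
rewrite -[RHS]/(confDn t (L0fam (n, i))); elim: n => [|n IH].
  by elim: t => // t IH; rewrite -[LHS]/(q (confD _)) quot_pi_D IH.
by rewrite -L0famS confDn_prod0 -IH -quot_piM.
Qed.

Lemma cend_coefZ (c : k) (w : cend k^o) t m :
  ((c *: w : cend k^o) : {poly {poly k^o}})`_t`_m = c * (w : {poly {poly k^o}})`_t`_m.
Proof.
by rewrite cend_scaleE [(cendC _ * _)`_t]coefCM coefCM -scalerAl mul1r.
Qed.

(** A relation goes to 0 under [evalPhi] for each alpha <> 0. Its coefficient at D^t x^(n+1)
    involves only the words with these t and n, and it is a Laurent polynomial in alpha with, up to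
    sign, the coefficients of the relation. *)
Lemma fam_basis : is_k_basis fam.
Proof.
apply: is_k_basisP; first exact: spans_fam.
move=> c s us cs h0 [t0 [n0 i0]]; have [//|/cs j0s] := eqVneq (c (t0, (n0, i0))) 0.
pose f (j : nat * (nat * int)) := L0word k j.2.1 j.1 j.2.2.
have hS : Id (S1 k) (\sum_(j <- s) c j *: f j).
  rewrite -IdS; apply/quot_piP; rewrite (conf_hom_sum _ _ _ (quot_pi_hom S)) -[RHS]h0.
  by apply: eq_bigr => -[t [n i]] _; rewrite q_L0word.
pose s' := [seq j.2.2 | j <- s & (j.1 == t0) && (j.2.1 == n0)].
have us' : uniq s'.
  rewrite map_inj_in_uniq ?filter_uniq // => -[t [n i]] [t' [n' i']].
  rewrite !mem_filter /= => /andP[/andP[/eqP -> /eqP ->] _] /andP[/andP[/eqP -> /eqP ->] _].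
  by move=> ->.
have i0s' : i0 \in s'.
  by apply/mapP; exists (t0, (n0, i0)); rewrite ?mem_filter //= !eqxx.
have H a : a != 0 -> \sum_(i <- s') (c (t0, (n0, i)) * (-1) ^+ n0.+1) * a ^ i = 0.
  move=> a0; have := evalPhi_S1 a0 hS.
  rewrite (conf_hom_sum _ _ _ (evalPhi_hom a)) => e.
  have := congr1 (fun w : {poly {poly k^o}} => w`_t0`_n0.+1) e.
  rewrite !coef0 /= => {}e; rewrite -[RHS]e [in RHS]coef_sum coef_sum.
  rewrite big_map big_filter big_mkcond /=; apply: eq_bigr => -[t [n i]] _ /=.
  rewrite cend_coefZ [X in _ = _ * X](coef_evalPhi a) /= eqSS ![_ == t]eq_sym ![_ == n]eq_sym.
  by case: ifP => [/andP[/eqP -> /eqP ->]|_]; rewrite ?mulr0 // mulrA.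
have := laurent_indep char0 us' H i0s' => /eqP; rewrite mulf_eq0 signr_eq0 orbF.
by move/eqP.
Qed.

End UBasis.

(** * Linear maps given on a basis *)

Section LinearExtension.
Variables (k : fieldType) (V V' : lmodType k) (I : choiceType) (e : I -> V).

Lemma k_comb_lin (W : lmodType k) (f : I -> W) a (c c' : I -> k) :
  fin_supp c -> fin_supp c' ->
  k_comb (fun i => a * c i + c' i) f = a *: k_comb c f + k_comb c' f.
Proof.
move=> /fin_supp_ex[s us hs] /fin_supp_ex[s' us' hs'].
have H (d : I -> k) : (forall i, d i != 0 -> (i \in s) || (i \in s')) ->
    k_comb d f = \sum_(i <- undup (s ++ s')) d i *: f i.
  by move=> h; apply: k_comb_seq; rewrite ?undup_uniq // => i /h; rewrite mem_undup mem_cat.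
rewrite H => [|i]; last first.
  apply: contraR; rewrite negb_or => /andP[h h'].
  have -> : c i = 0 by apply/eqP; apply: contraNT h => /hs.
  have -> : c' i = 0 by apply/eqP; apply: contraNT h' => /hs'.
  by rewrite mulr0 addr0.
rewrite (H c) => [|i /hs-> //]; rewrite (H c') => [|i /hs'->]; last by rewrite orbT.
rewrite scaler_sumr -big_split; apply: eq_bigr => i _ /=.
by rewrite scalerDl scalerA.
Qed.

Lemma linear_extension (f : I -> V') : is_k_basis e ->
  exists phi : V -> V', linear phi /\ forall i, phi (e i) = f i.
Proof.
move=> be; pose co x := projT1 (cid (be x)).
have coP x : [/\ fin_supp (co x), x = k_comb (co x) e &
    forall c, fin_supp c -> x = k_comb c e -> co x = c].
  by rewrite /co; case: cid => c /= [[h1 h2] h3]; split=> // c' g1 g2; apply: h3.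
exists (fun x => k_comb (co x) f); split=> [a x y|i].
  have [fx ex _] := coP x; have [fy ey _] := coP y; have [_ _ u] := coP (a *: x + y).
  rewrite -k_comb_lin //; congr k_comb; apply: u.
    move: fx fy => /fin_supp_ex[s _ hs] /fin_supp_ex[s' _ hs'].
    apply: (@fin_supp_seq _ _ (s ++ s')) => i; rewrite mem_cat.
    apply: contraR; rewrite negb_or => /andP[h h'].
    have -> : co x i = 0 by apply/eqP; apply: contraNT h => /hs.
    have -> : co y i = 0 by apply/eqP; apply: contraNT h' => /hs'.
    by rewrite mulr0 addr0.
  by rewrite k_comb_lin // -ex -ey.
pose d (j : I) : k := (j == i)%:R.
have dP j : d j != 0 -> j \in [:: i] by rewrite /d inE; case: (j == i); rewrite ?eqxx.
have dE (W : lmodType k) (g : I -> W) : k_comb d g = g i.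
  by rewrite (k_comb_seq _ _ dP) // big_seq1 /d eqxx scale1r.
have [_ _ u] := coP (e i).
by rewrite (u d) ?dE //; apply: fin_supp_seq dP.
Qed.

Lemma linear_ext (phi psi : V -> V') : linear phi -> linear psi ->
  (forall x, spans (fun=> True) e x) -> (forall i, phi (e i) = psi (e i)) ->
  forall x, phi x = psi x.
Proof.
move=> l1 l2 sp h x; have [r _ ->] := sp x.
have z (f : V -> V') : linear f -> f 0 = 0.
  by move=> l; have := l (-1) 0 0; rewrite scaler0 addr0 scaleN1r addNr.
elim: r => [|y r IH]; first by rewrite big_nil !z.
by rewrite !big_cons l1 l2 IH h.
Qed.

Lemma is_k_basis_spans : is_k_basis e -> forall x, spans (fun=> True) e x.
Proof.
move=> be x; have [c [[/fin_supp_ex[s us hs] ->] _]] := be x.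
by rewrite (k_comb_seq _ us hs); apply: spans_sum => i _; apply/spansZ/spans_elt.
Qed.

End LinearExtension.

(** * Embedding of the loop Virasoro algebra *)

Section Minus.
Variables (k : fieldType) (A : assocConf k).
Hypothesis char0 : forall n : nat, n.+1%:R != 0 :> k.
Implicit Types a b x y : A.

Lemma local_ex b a : exists M, forall m, (M <= m)%N -> b *_(m) a = 0.
Proof. exact: conf_local (assoc_confP A) b a. Qed.

Definition flipc n j : k := (-1) ^+ (n + j) / (j`!)%:R.

Lemma flipcSl n j : flipc n.+1 j = - flipc n j.
Proof. by rewrite /flipc addSn exprS mulN1r mulNr. Qed.

Lemma flipcSr n j : j.+1%:R * flipc n j.+1 = - flipc n j.
Proof.
have fn0 : (j`!)%:R != 0 :> k by rewrite -(prednK (fact_gt0 j)).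
by rewrite /flipc addnS exprS factS natrM; field; rewrite fn0 -mulrS char0.
Qed.

Lemma confDnZ t c a : confDn t (c *: a) = c *: confDn t a.
Proof. by have := confDn_linear t c a 0; rewrite !addr0 confDn0 addr0. Qed.

Lemma cflip_linr n b : linear (cflip n b : A -> A).
Proof.
move=> c x y; have [M hM] := local_ex b x; have [M' hM'] := local_ex b y.
have hs m : (n + maxn M M' <= m)%N -> b *_(m) x = 0 /\ b *_(m) y = 0.
  by move=> h; split; [apply: hM | apply: hM']; lia.
rewrite (@cflipE _ _ (maxn M M')) => [|m /hs[h1 h2]]; last first.
  by rewrite confpDr_add confpZr h1 h2 scaler0 addr0.
rewrite (@cflipE _ _ (maxn M M') n b x) => [|m /hs[] //].
rewrite (@cflipE _ _ (maxn M M') n b y) => [|m /hs[] //].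
rewrite scaler_sumr -big_split; apply: eq_bigr => j _ /=.
by rewrite confpDr_add confpZr confDn_linear scalerDr !scalerA [c * _]mulrC.
Qed.

Lemma cflip_linl n a : linear (fun b : A => cflip n b a).
Proof.
move=> c x y; have [M hM] := local_ex x a; have [M' hM'] := local_ex y a.
have hs m : (n + maxn M M' <= m)%N -> x *_(m) a = 0 /\ y *_(m) a = 0.
  by move=> h; split; [apply: hM | apply: hM']; lia.
rewrite (@cflipE _ _ (maxn M M')) => [|m /hs[h1 h2]]; last first.
  by rewrite confpDl_add confpZl h1 h2 scaler0 addr0.
rewrite (@cflipE _ _ (maxn M M') n x a) => [|m /hs[] //].
rewrite (@cflipE _ _ (maxn M M') n y a) => [|m /hs[] //].
rewrite scaler_sumr -big_split; apply: eq_bigr => j _ /=.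
by rewrite confpDl_add confpZl confDn_linear scalerDr !scalerA [c * _]mulrC.
Qed.

Section OnePair.
Variables (n : nat) (b a : A) (M : nat).
Hypothesis hM : forall m, (M <= m)%N -> b *_(m) a = 0.
Local Notation t j := (confDn j (b *_((n + j).-1) a)).

(** Moving D out of b_(n+j) (D a) produces the factor n + j. Its part j lowers j! to (j-1)! and
    shifts the sum by one, as here; its part n is [flip_pred]. *)
Lemma flip_shift :
  \sum_(j < M.+2) (j%:R * flipc n j) *: t j = - confD (cflip n b a).
Proof.
rewrite (@cflipE _ _ M.+1) => [|m hm]; last by apply: hM; lia.
rewrite big_ord_recl mul0r scale0r add0r.
have -> : confD (\sum_(j < M.+1) flipc n j *: confDn j (b *_(n + j) a)) =
    \sum_(j < M.+1) flipc n j *: confDn j.+1 (b *_(n + j) a).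
  by elim/big_rec2: _ => [|j u v _ <-]; rewrite ?confD0 // confDD confDZ.
rewrite -sumrN; apply: eq_bigr => j _.
by rewrite lift0 flipcSr addnS scaleNr.
Qed.

Lemma flip_pred :
  \sum_(j < M.+2) (n%:R * flipc n j) *: t j = - (n%:R *: cflip n.-1 b a).
Proof.
case: n => [|n']; first by rewrite scale0r oppr0 big1 // => j _; rewrite mul0r scale0r.
rewrite (@cflipE _ _ M.+2) => [|m hm]; last by apply: hM; lia.
rewrite scaler_sumr -sumrN; apply: eq_bigr => j _.
by rewrite flipcSl /= mulrN scaleNr scalerA.
Qed.

Lemma cflip_Dr : cflip n b (confD a) = - (n%:R *: cflip n.-1 b a).
Proof.
rewrite (@cflipE _ _ M.+2) => [|m hm]; last first.
  by rewrite confpDr !hM ?confD0 ?scaler0 ?addr0 //; lia.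
have E (j : nat) : flipc n j *: confDn j (b *_(n + j) confD a) =
   flipc n j *: confDn j.+1 (b *_(n + j) a) +
   ((n%:R * flipc n j) *: t j + (j%:R * flipc n j) *: t j).
  rewrite confpDr confDnD scalerDr; congr (_ + _).
    by rewrite /confDn -iterSr.
  by rewrite -scalerDl -mulrDl -natrD confDnZ scalerA mulrC.
rewrite (eq_bigr _ (fun (j : 'I_M.+2) _ => E j)) big_split /= big_split /= flip_pred flip_shift.
rewrite [X in X + _](_ : _ = confD (cflip n b a)); first by rewrite addrCA subrr addr0.
rewrite (@cflipE _ _ M.+2) => [|m hm]; last by apply: hM; lia.
by elim/big_rec2: _ => [|j u v _ ->]; rewrite ?confD0 // confDD confDZ.
Qed.

Lemma cflip_Dl : cflip n (confD b) a = confD (cflip n b a) + n%:R *: cflip n.-1 b a.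
Proof.
have Dl m : confD b *_(m) a = - (m%:R *: (b *_(m.-1) a)).
  case: m => [|m]; first by rewrite (confpDl0 (assoc_confP A)) scale0r oppr0.
  by rewrite (confpDl (assoc_confP A)).
rewrite (@cflipE _ _ M.+2) => [|m hm]; last by rewrite Dl hM ?scaler0 ?oppr0 //; lia.
have E (j : nat) : flipc n j *: confDn j (confD b *_(n + j) a) =
   - ((n%:R * flipc n j) *: t j) - (j%:R * flipc n j) *: t j.
  by rewrite Dl -opprD -scalerDl -mulrDl -natrD -scaleNr confDnZ scalerA mulrN mulrC scaleNr.
rewrite (eq_bigr _ (fun (j : 'I_M.+2) _ => E j)) big_split /= !sumrN flip_pred flip_shift.
by rewrite !opprK addrC.
Qed.

End OnePair.
End Minus.

Section Embedding.
Variables (k : fieldType) (LW : lieConf k) (ell : int -> LW).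
Hypothesis hLW : is_loop_virasoro ell.
Variables (A : assocConf k) (e : int -> A).
Hypothesis char0 : forall n : nat, n.+1%:R != 0 :> k.
Hypotheses (e_loc : locality_le 2 e)
  (e_prod1 : forall i j, e i *_(1) e j = - e (i + j))
  (e_prod0 : forall i j, e i *_(0) e j = e 0 *_(0) e (i + j)).

Local Notation mp n x y := (@confp k (conf_minus A) n x y).

Lemma minus_linl n y : linear (fun x : A => mp n x y : A).
Proof.
move=> c x x'; rewrite /= confpDl_add confpZl cflip_linr opprD addrACA.
by rewrite -scalerBr.
Qed.

Lemma minus_linr n x : linear (fun y : A => mp n x y : A).
Proof.
move=> c y y'; rewrite /= confpDr_add confpZr cflip_linl opprD addrACA.
by rewrite -scalerBr.
Qed.

Lemma minus_Dl n (x y : A) : mp n (confD x) y = - (n%:R *: mp n.-1 x y) :> A.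
Proof.
have [M hM] := local_ex y x; rewrite /= (cflip_Dr char0 n hM) scalerBr !opprB opprK.
rewrite addrC; congr (_ + _); case: n => [|n].
  by rewrite (confpDl0 (assoc_confP A)) scale0r oppr0.
by rewrite (confpDl (assoc_confP A)).
Qed.

Lemma minus_Dr n (x y : A) :
  mp n x (confD y) = confD (mp n x y : A) + n%:R *: (mp n.-1 x y : A) :> A.
Proof.
have [M hM] := local_ex y x; rewrite /= (cflip_Dl char0 n hM) confpDr confDB scalerBr.
by rewrite opprD addrACA.
Qed.

(** The (0)-products depend on i + j only, so they cancel, and D (e_j(1) e_i) is what the flip
    leaves. *)
Lemma minus_gen0 i j : mp 0 (e i) (e j) = - confD (e (i + j)) :> A.
Proof.
rewrite /= cflip_loc0; last exact: e_loc.
rewrite e_prod1 e_prod0 [e j *_(0) _]e_prod0 [j + i]addrC confDN opprK.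
by rewrite opprD addrA subrr add0r.
Qed.

Lemma minus_gen1 i j : mp 1 (e i) (e j) = - (2 *: e (i + j)) :> A.
Proof.
rewrite /= cflip_loc1; last exact: e_loc.
by rewrite !e_prod1 [j + i]addrC opprK -opprD -mulr2n scaler_nat.
Qed.

Lemma minus_gen2 n i j : (2 <= n)%N -> mp n (e i) (e j) = 0 :> A.
Proof. by move=> hn; rewrite /= cflip_loc2 ?e_loc ?subr0 //; apply: e_loc. Qed.

Lemma lie_confpDr n (x y : LW) :
  x *_(n) confD y = confD (x *_(n) y) + n%:R *: (x *_(n.-1) y).
Proof.
rewrite (confD_prod (lie_confP LW)); case: n => [|n].
  by rewrite (confpDl0 (lie_confP LW)) scale0r addr0 add0r.
by rewrite (confpDl (lie_confP LW)) //= addrAC addNr add0r.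
Qed.

Lemma lie_confpDl n (x y : LW) : confD x *_(n) y = - (n%:R *: (x *_(n.-1) y)).
Proof.
case: n => [|n]; last by rewrite (confpDl (lie_confP LW)).
by rewrite (confpDl0 (lie_confP LW)) scale0r oppr0.
Qed.

(** The linear map D^t ell_i |-> D^t e_i commutes with D by construction. The products on both sides
    follow the same rules for D in either argument ([minus_Dl], [minus_Dr]), so compatibility
    reduces to the generators. *)
Theorem loop_hom : exists phi : LW -> conf_minus A,
  [/\ conf_hom phi, forall i, phi (ell i) = e i &
      forall t i, phi (confDn t (ell i)) = confDn t (e i)].
Proof.
have be : is_k_basis (Dfam ell) by apply/is_kD_basisP; apply: lw_basis.
have sp := is_k_basis_spans be.
have [phi [lin hphi]] := linear_extension (Dfam e) be.
have hphi' t i : phi (confDn t (ell i)) = confDn t (e i) by apply: (hphi (t, i)).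
have linD : linear (@confD k LW) by exact: (confD_lin (lie_confP LW)).
have phi0 : phi 0 = 0.
  by have := lin (-1) 0 0; rewrite scaler0 addr0 scaleN1r addNr.
have phiZ c x : phi (c *: x) = c *: phi x.
  by have := lin c x 0; rewrite phi0 !addr0.
have phiN x : phi (- x) = - phi x by rewrite -scaleN1r phiZ scaleN1r.
have phiD x y : phi (x + y) = phi x + phi y.
  by have := lin 1 x y; rewrite !scale1r.
have phi_D x : phi (confD x) = confD (phi x).
  apply: (@linear_ext _ _ A _ _ (fun y => phi (confD y)) (fun y => confD (phi y)) _ _ sp)
    => [c y z|c y z|[t i]].
  - by rewrite linD lin.
  - by rewrite lin confDD confDZ.
  - rewrite -[confD _]/(confDn t.+1 (ell i)) hphi' /Dfam /=.
    by rewrite hphi'.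
have phiM_gen n i j : phi (ell i *_(n) ell j) = mp n (e i) (e j).
  case: n => [|[|n]].
  - by rewrite (lw_prod0 hLW) minus_gen0 phiN phi_D; rewrite (hphi' 0%N).
  - by rewrite (lw_prod1 hLW) minus_gen1 phiN phiZ (hphi' 0%N).
  - by rewrite (lw_prod2 hLW) // minus_gen2.
have phiM_r n i t j :
    phi (ell i *_(n) confDn t (ell j)) = mp n (e i) (confDn t (e j)).
  elim: t n => [|t IH] n; first exact: phiM_gen.
  rewrite -[confDn t.+1 (ell j)]/(confD (confDn t (ell j))) lie_confpDr.
  by rewrite phiD phi_D phiZ !IH [RHS]minus_Dr.
have phiM_lr n s i t j :
    phi (confDn s (ell i) *_(n) confDn t (ell j)) = mp n (confDn s (e i)) (confDn t (e j)).
  elim: s n => [|s IH] n; first exact: phiM_r.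
  rewrite -[confDn s.+1 (ell i)]/(confD (confDn s (ell i))) lie_confpDl.
  by rewrite phiN phiZ IH [RHS]minus_Dl.
have phiM n x y : phi (x *_(n) y) = mp n (phi x) (phi y).
  pose Pl (y : LW) (x : LW) : A := phi (x *_(n) y).
  pose Pr (y : LW) (x : LW) : A := mp n (phi x) (phi y).
  apply: (@linear_ext _ _ _ _ _ (Pl y) (Pr y) _ _ sp) => [c u v|c u v|[s i]].
  - by rewrite /Pl (confp_linl (lie_confP LW)) lin.
  - by rewrite /Pr lin; exact: minus_linl.
  pose Ql (y : LW) : A := phi (Dfam ell (s, i) *_(n) y).
  pose Qr (y : LW) : A := mp n (phi (Dfam ell (s, i))) (phi y).
  apply: (@linear_ext _ _ _ _ _ Ql Qr _ _ sp) => [c u v|c u v|[t j]].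
  - by rewrite /Ql (confp_linr (lie_confP LW)) lin.
  - by rewrite /Qr lin; exact: minus_linr.
  by rewrite /Ql /Qr !hphi; exact: phiM_lr.
exists phi; split=> //; last by move=> i; exact: (hphi' 0%N).
Qed.

End Embedding.

Theorem mainTheorem4 (R : realType) (LW : lieConf R[i]) (ell : int -> LW)
    (hLW : is_loop_virasoro ell) :
  let U := univ_env ell 2 in
  let pi := env_pi ell 2 in
  let A : set (freeConf R[i] int 2) :=
    [set x | exists i n, x = L0word R[i] n 0 i] in
  env_rels ell 2 = Sminus R[i] /\
  (* (i) *)
  Id (Sminus R[i]) = Id (S1 R[i]) /\
  (* (ii) *)
  is_GSB loop_lt (S1 R[i]) /\
  (* (iii) *)
  [/\ Irr loop_lt (S1 R[i]) = [set x | exists i t n, x = L0word R[i] n t i],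
      is_k_basis (fun x : Irr loop_lt (S1 R[i]) => pi (val x)),
      is_kD_basis (fun x : A => pi (val x)) &
      exists phi : LW -> conf_minus U,
        [/\ conf_hom phi, forall i, phi (ell i) = pi (gen R[i] 2 i) &
            injective phi]].
Proof.
move=> U pi A; set k : fieldType := R[i].
have char0 (n : nat) : n.+1%:R != 0 :> k by rewrite Num.Theory.pnatr_eq0.
have eS : env_rels ell 2 = Sminus k by apply: env_rels_Sminus.
have eI : Id (Sminus k) = Id (S1 k) by apply: Id_Sminus; apply: (char0 1%N).
have IdS : Id (env_rels ell 2) = Id (S1 k) by rewrite eS.
have fb := fam_basis char0 IdS.
have L0_inj : injective (fun j : nat * (nat * int) => L0word k j.2.1 j.1 j.2.2).
  move=> [t [n i]] [t' [n' i']] /=; rewrite !L0wordE => /nword_inj[e -> ->].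
  by have := congr1 size e; rewrite !size_nseq => ->.
split; first by [].
split; first by [].
split; first exact: S1_GSB.
split.
- exact: Irr_S1.
- apply: (is_k_basis_range (f := fun j : nat * (nat * int) => L0word k j.2.1 j.1 j.2.2)) => //.
    rewrite Irr_S1; apply/seteqP; split=> x /=.
      by move=> [i [t [n ->]]]; exists (t, (n, i)).
    by move=> [[t [n i]] ->]; exists i, t, n.
  rewrite (_ : (fun j => _) = Dfam (L0fam (env_rels ell 2))) //.
  by apply/funext => -[t [n i]]; apply: q_L0word.
- apply: (is_kD_basis_range (f := fun j : nat * int => L0word k j.1 0 j.2)) => //.
  + by move=> [n i] [n' i'] /= h; have := L0_inj (0%N, (n, i)) (0%N, (n', i')) h => -[-> ->].
  + apply/seteqP; split=> x /=.
      by move=> [i [n ->]]; exists (n, i).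
    by move=> [[n i] ->]; exists i, n.
  + by apply/is_kD_basisP.
have [phi [h1 h2 h3]] := loop_hom hLW char0 (quot_pi_locality (env_rels ell 2))
  (q_prod1 IdS) (q_rels IdS).2.
exists phi; split=> // x y exy; apply/eqP; rewrite -subr_eq0; apply/eqP.
have be : is_k_basis (Dfam ell) by apply/is_kD_basisP; apply: lw_basis.
have [c [[/fin_supp_ex[s us hs] ez] _]] := be (x - y).
have lin := conf_hom_lin h1.
have pz : phi (x - y) = 0.
  have := lin (-1) y x; rewrite scaleN1r addrC => ->.
  by rewrite exy scaleN1r addNr.
rewrite ez (k_comb_seq _ us hs) in pz *; rewrite (linear_sumZ _ _ _ lin) in pz.
(* The images D^t L_i are the members with n = 0 of the basis of the envelope, so the coefficients
   of x - y vanish. *)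
pose h (j : nat * int) := (j.1, (0%N, j.2)).
rewrite big_seq big1 // => -[t0 i0] js; have hI : injective h by move=> [? ?] [? ?] [-> ->].
have us' : uniq (map h s) by rewrite map_inj_uniq.
rewrite (_ : c (t0, i0) = 0) ?scale0r //.
apply: (is_k_basis_indep (c := fun j => c (j.1, j.2.2)) fb us' _ (map_f h js)).
rewrite big_map -[RHS]pz; apply: eq_bigr => -[t i] _ /=.
by congr (_ *: _); exact: esym (h3 t i).
Qed.
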